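(* For long-range Bernoulli percolation on $\mathbb Z$ with parameters $\beta,\lambda>0$ and percolation probability $\theta(\beta,\lambda)$, the following two properties hold: (i) For every $\beta>1$, one has $\theta(\beta,\lambda)>0$ for all sufficiently large $\lambda<\infty$. (ii) For every $\beta,\lambda>0$, if $\theta(\beta,\lambda)>0$ then $\beta\,\theta(\beta,\lambda)^2\ge 1$.
   Context: For $i\ne j$ in $\mathbb Z$ let $J_{i,j}=1/|i-j|^2$. For $\beta,\lambda>0$ define $p_{i,j}(\beta,\lambda)=1-\exp[-\beta J_{i,j}]$ if $|i-j|\ge 2$ and $p_{i,j}(\beta,\lambda)=1-\exp[-\lambda]$ if $|i-j|=1$. The long-range Bernoulli percolation measure $\mathbb P_{\beta,\lambda}$ on $\mathbb Z$ is the probability measure under which each unordered pair (edge) $\{i,j\}\subset\mathbb Z$, $i\neq j$, is open with probability $p_{i,j}(\beta,\lambda)$ and closed with probability $1-p_{i,j}(\beta,\lambda)$, independently for different edges. The percolation probability $\theta(\beta,\lambda)$ is the $\mathbb P_{\beta,\lambda}$-probability that $0$ is connected to infinity by a path of open edges, i.e. that the connected component of $0$ in the graph of open edges is infinite. *)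

(* Defs.v *)
From HB Require Import structures.
From mathcomp Require Import all_boot all_order all_algebra.
From mathcomp Require Import finmap.
From mathcomp Require Import all_classical all_reals all_analysis.
From mathcomp Require Import measurable_realfun.
From mathcomp Require Import ring lra.
Set Implicit Arguments.
Unset Strict Implicit.
Unset Printing Implicit Defensive.
Import Order.TTheory GRing.Theory Num.Theory.
Local Open Scope classical_set_scope.
Local Open Scope ring_scope.

Section bernoulli_product.
Context {R : realType} {E : countType}.
Implicit Types (p : E -> R) (w : E -> bool).

Definition is_open (e : E) : set (E -> bool) := [set w | w e].

(* The product sigma-algebra on [E -> bool]. *)
Definition config : Type := g_sigma_algebraType (range is_open).

Definition cylinder (F : {fset E}) (b : E -> bool) : set config :=
  [set w | forall e, e \in F -> w e = b e].

(* The states of the edges are independent, [e] being open with probability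
   [p e] and closed with probability [1 - p e]. *)
Definition is_bernoulli_product p (P : probability config R) : Prop :=
  forall (F : {fset E}) (b : E -> bool),
    P (cylinder F b) = (\prod_(e <- F) (if b e then p e else 1 - p e))%:E.

Lemma measurable_is_open e : measurable (is_open e : set config).
Proof. by apply: sub_sigma_algebra; exists e. Qed.

Lemma measurable_cylinder F b : measurable (cylinder F b).
Proof.
have -> : cylinder F b =
    \bigcap_(e in [set` F]) ([set w : config | w e = b e]).
  by apply/seteqP; split => w h e; exact: h.
apply: fin_bigcap_measurable => // e _.
case: (b e); first exact: measurable_is_open.
have -> : [set w : config | w e = false] = ~` (is_open e).
  by apply/seteqP; split => w /=; rewrite /is_open /=; case: (w e).
by apply: measurableC; exact: measurable_is_open.
Qed.

End bernoulli_product.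
Arguments config E : clear implicits.

(* Binary expansion of a point of [0, 1[ in variable proportions: its digits
   under the Lebesgue measure are independent Bernoulli variables. *)
Section digits.
Context {R : realType} (q : nat -> R).
Hypothesis q01 : forall n, 0 < q n < 1.
Let mu : {measure set (measurableTypeR R) -> \bar R} := @lebesgue_measure R.

Let step (r x : R) := if x < r then x / r else (x - r) / (1 - r).
Fixpoint remainder n (x : R) :=
  if n is m.+1 then step (q m) (remainder m x) else x.
Definition digit n x := remainder n x < q n.

Let weight n (b : bool) := if b then q n else 1 - q n.

Let weight_gt0 n b : 0 < weight n b.
Proof. by have := q01 n; rewrite /weight; case: b; lra. Qed.

Lemma digits_itv (b : nat -> bool) n : exists2 a : R,
  0 <= a & a + \prod_(i < n) weight i (b i) <= 1 /\
  forall x, 0 <= x < 1 ->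
    ((forall i, (i < n)%N -> digit i x = b i) <->
     a <= x < a + \prod_(i < n) weight i (b i)) /\
    ((forall i, (i < n)%N -> digit i x = b i) ->
     remainder n x = (x - a) / \prod_(i < n) weight i (b i)).
Proof.
elim: n => [|n [a a0 [a1 IH]]].
  exists 0 => //; rewrite big_ord0 add0r; split => // x x01; split => //.
  by move=> _; rewrite subr0 divr1.
have P0 : 0 < \prod_(i < n) weight i (b i) by apply: prodr_gt0 => i _.
rewrite big_ord_recr /=.
move: (\prod_(i < n) _) P0 a1 IH => P P0 a1 IH.
have q0 : 0 < q n by have := q01 n; lra.
have q1 : 0 < 1 - q n by have := q01 n; lra.
have qP : 0 < P * q n by exact: mulr_gt0.
have qP' : 0 < P * (1 - q n) by exact: mulr_gt0.
have recE x : (forall i, (i < n.+1)%N -> digit i x = b i) <->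
    (forall i, (i < n)%N -> digit i x = b i) /\ digit n x = b n.
  split=> [h|[h hn] i]; first by split => [i ni|]; apply: h => //; exact: ltnW.
  by rewrite ltnS leq_eqVlt => /predU1P[->//|]; exact: h.
have dig x : 0 <= x < 1 -> (forall i, (i < n)%N -> digit i x = b i) ->
    digit n x = (x < a + P * q n).
  move=> x01 h; rewrite /digit (proj2 (IH x x01) h).
  by rewrite ltr_pdivrMr// ltrBlDl [q n * _]mulrC.
exists (if b n then a else a + P * q n).
  by case: (b n) => //; rewrite addr_ge0// ltW.
split.
  by rewrite /weight; case: (b n); lra.
move=> x x01; have [IH1 IH2] := IH x x01.
split.
  rewrite recE; split.
    move=> [h]; have /andP[? ?] := (proj1 IH1) h.
    rewrite dig// /weight; case: (b n) => [->|/negbT]; first by lra.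
    by rewrite -leNgt => ?; lra.
  move=> hx.
  have h : forall i, (i < n)%N -> digit i x = b i.
    by apply/IH1; move: hx; rewrite /weight; case: (b n); lra.
  split => //; rewrite dig//; move: hx; rewrite /weight.
  case: (b n); first by case/andP.
  by move=> hx; apply/negbTE; rewrite -leNgt; lra.
move=> /recE [h hn]; move: (hn).
rewrite dig// => hx; rewrite /= /step -/(digit n x) hn IH2// /weight.
by case: (b n); field; rewrite ?gt_eqF//; lra.
Qed.

Let I01 : set R := `[0, 1[%classic.

Lemma measurable_remainder n : measurable_fun setT (remainder n).
Proof.
elim: n => [|n IH]; first exact: measurable_id.
apply: (measurable_fun_ifT (f := fun x => remainder n x < q n)
  (g := fun x => remainder n x / q n)
  (h := fun x => (remainder n x - q n) / (1 - q n))).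
- exact: measurable_fun_ltr.
- exact: measurable_funM.
- by apply: measurable_funM => //; exact: measurable_funB.
Qed.

Lemma measurable_digit n : measurable_fun setT (digit n).
Proof. by apply: measurable_fun_ltr => //; exact: measurable_remainder. Qed.

Let ok (o : option bool) (d : bool) := if o is Some b then d = b else True.
Let oweight n (o : option bool) := if o is Some b then weight n b else 1.

Let match_set (c : nat -> option bool) n : set R :=
  I01 `&` [set x | forall i, (i < n)%N -> ok (c i) (digit i x)].

Let measurable_match c n : measurable (match_set c n).
Proof.
apply: measurableI; first exact: measurable_itv.
have -> : [set x | forall i, (i < n)%N -> ok (c i) (digit i x)] =
    \bigcap_(i in `I_n) [set x | ok (c i) (digit i x)].
  by apply/seteqP; split => x h i; exact: h.
apply: fin_bigcap_measurable => // i _.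
case: (c i) => [b|/=]; last first.
  by rewrite (_ : [set _ | _] = setT)//; apply/seteqP.
by rewrite -[X in measurable X]setTI; exact: measurable_digit.
Qed.

Lemma digits_law (c : nat -> option bool) n :
  mu (match_set c n) = (\prod_(i < n) oweight i (c i))%:E.
Proof.
suff H m : forall c : nat -> option bool, (forall i, (m <= i)%N -> (i < n)%N -> c i) ->
    mu (match_set c n) = (\prod_(i < n) oweight i (c i))%:E.
  by apply: (H n) => i /leq_ltn_trans /[apply]; rewrite ltnn.
clear c; elim: m => [|m IH] c hc.
  pose b i := odflt true (c i).
  have cE i : (i < n)%N -> c i = Some (b i).
    by move=> /(hc i isT); rewrite /b; case: (c i).
  have [a a0 [a1 ha]] := digits_itv b n.
  have -> : \prod_(i < n) oweight i (c i) = \prod_(i < n) weight i (b i).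
    by apply: eq_bigr => i _; rewrite cE.
  have P0 : 0 < \prod_(i < n) weight i (b i) by apply: prodr_gt0 => i _.
  have -> : match_set c n = `[a, a + \prod_(i < n) weight i (b i)[%classic.
    apply/seteqP; split => x.
      rewrite /match_set /I01 /= !in_itv/= => -[x01 h].
      apply: (proj1 (proj1 (ha x x01))) => i ni.
      by move: (h i ni); rewrite cE.
    rewrite /= in_itv/= => hx.
    have x01 : 0 <= x < 1 by lra.
    split; first by rewrite /I01/= in_itv/=.
    by move=> i ni; rewrite /= cE//; exact: (proj2 (proj1 (ha x x01)) hx).
  rewrite [mu _]lebesgue_measure_itv/= lte_fin ltrDl P0.
  by rewrite -EFinD addrAC subrr add0r.
have [mn|nm] := ltnP m n; last first.
  apply: IH => i mi ni; apply: hc => //.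
  by move: (leq_trans ni nm); rewrite ltnNge mi.
case cm : (c m) => [b|].
  apply: IH => i; rewrite leq_eqVlt => /predU1P[<-|]; first by rewrite cm.
  exact: hc.
pose c' b (i : nat) := if i == m then Some b else c i.
have hc' b i : (m <= i)%N -> (i < n)%N -> c' b i.
  by rewrite leq_eqVlt eq_sym /c'; case: eqP => //= _; exact: hc.
have -> : match_set c n = match_set (c' true) n `|` match_set (c' false) n.
  apply/seteqP; split=> x.
    move=> [x01 h]; case dm : (digit m x); [left|right]; split => // i ni;
      by rewrite /c'; case: eqP => [->|_] //=; exact: h.
  by move=> [|] [x01 h]; split => // i ni; move: (h i ni);
    rewrite /c'; case: eqP => [->|_] //; rewrite cm.
rewrite measureU; [|exact: measurable_match..|]; last first.
  apply/seteqP; split => // x [[_ h1] [_ h2]] /=.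
  by move: (h1 m mn) (h2 m mn); rewrite /c' eqxx/= => ->.
apply: (etrans (congr2 adde (IH _ (hc' true)) (IH _ (hc' false)))).
apply: (congr1 (@EFin R) (x := _ + _)).
rewrite (bigD1 (Ordinal mn))//= [X in _ + X](bigD1 (Ordinal mn))//=.
rewrite [RHS](bigD1 (Ordinal mn))//= cm /c' eqxx/= mul1r.
have eqP b : \prod_(i < n | i != Ordinal mn)
    oweight i (if nat_of_ord i == m then Some b else c i) =
    \prod_(i < n | i != Ordinal mn) oweight i (c i).
  apply: eq_bigr => i; rewrite -val_eqE/= => /negbTE -> //.
by rewrite !eqP -mulrDl addrC subrK mul1r.
Qed.

Lemma digits_law_itv (c : nat -> option bool) n :
  mu ([set x | forall i, (i < n)%N -> ok (c i) (digit i x)] `&` `[0, 1[) =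
  (\prod_(i < n) oweight i (c i))%:E.
Proof. by rewrite setIC -digits_law. Qed.

End digits.

Section existence.
Context {R : realType} {E : countType} (p : E -> R).
Hypothesis p01 : forall e, 0 < p e < 1.

Let q (n : nat) : R := oapp p 2^-1 (pickle_inv n).

Let q01 n : 0 < q n < 1.
Proof. by rewrite /q; case: pickle_inv => [e|] //=; lra. Qed.

Let X (x : R) : config E := fun e => digit q (choice.pickle e) x.

Let mX : measurable_fun setT X.
Proof.
apply: (@measurability _ _ _ (config E) setT X (range (@is_open E)) erefl) => _ [_ [e _ <-] <-].
exact: measurable_digit.
Qed.

Definition digit_law (A : set (config E)) : \bar R :=
  (@lebesgue_measure R) (X @^-1` A `&` `[0, 1[).

Let mXI A : measurable A -> measurable (X @^-1` A `&` `[0, 1[).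
Proof.
move=> mA; apply: measurableI; last exact: measurable_itv.
by rewrite -[Y in measurable Y]setTI; exact: mX.
Qed.

Let P0 : digit_law set0 = 0%E.
Proof. by rewrite /digit_law preimage_set0 set0I measure0. Qed.

Let P_ge0 A : (0 <= digit_law A)%E. Proof. exact: measure_ge0. Qed.

Let P_sigma_additive : semi_sigma_additive digit_law.
Proof.
move=> F mF tF mUF; rewrite /digit_law preimage_bigcup setI_bigcupl.
apply: measure_semi_sigma_additive.
- by move=> n; exact: mXI.
- apply/trivIsetP => /= i j _ _ ij; rewrite setIACA -preimage_setI.
  by move/trivIsetP : tF => /(_ _ _ _ _ ij) ->//; rewrite preimage_set0 set0I.
- by rewrite -setI_bigcupl -preimage_bigcup; exact: mXI.
Qed.

#[local] HB.instance Definition _ := isMeasure.Build _ _ _ digit_law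
  P0 P_ge0 P_sigma_additive.

Let P_setT : digit_law setT = 1%E.
Proof.
rewrite /digit_law preimage_setT setTI lebesgue_measure_itv/= lte_fin ltr01.
by rewrite oppr0 adde0.
Qed.

#[local] HB.instance Definition _ :=
  Measure_isProbability.Build _ _ _ digit_law P_setT.

Lemma exists_bernoulli_product :
  exists Q : probability (config E) R, is_bernoulli_product p Q.
Proof.
exists digit_law => F b.
pose c n := if pickle_inv n is Some e then
  if e \in F then Some (b e) else None else None.
pose n := (\max_(e <- F) choice.pickle e).+1.
have lt_n e : e \in F -> (choice.pickle e < n)%N.
  by move=> eF; rewrite ltnS (leq_bigmax_seq (F := @choice.pickle E)).
transitivity ((\prod_(i < n) (if c i is Some d then
    (if d then q i else 1 - q i) else 1))%:E : \bar R).
  rewrite -[RHS](digits_law_itv q01); congr (lebesgue_measure (_ `&` _)).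
  apply/seteqP; split => x /=.
    move=> h i _; rewrite /c; case ie : (pickle_inv i) => [e|//].
    case: ifPn => // /h <-; rewrite /X; congr (digit q _ x).
    by have := @pickle_invK E i; rewrite /ocancel ie.
  by move=> h e eF; have := h _ (lt_n e eF); rewrite /c pickleK_inv eF.
congr EFin.
rewrite (bigID (fun i : 'I_n => c i))/= [X in _ * X]big1 ?mulr1; last first.
  by move=> i; case: (c i).
rewrite -(big_mkord (fun i => c i) (fun i => if c i is Some d then
    (if d then q i else 1 - q i) else 1)) -big_filter.
rewrite (perm_big [seq choice.pickle e | e <- F]); last first.
  apply: uniq_perm.
  - by apply: filter_uniq; exact: iota_uniq.
  - by rewrite map_inj_uniq ?fset_uniq.
  - move=> i; rewrite mem_filter mem_index_iota/=; apply/andP/mapP.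
      rewrite /c => -[]; case ie : (pickle_inv i) => [e|//].
      case: ifPn => // eF _ _; exists e => //.
      by have := @pickle_invK E i; rewrite /ocancel ie.
    by move=> [e eF ->]; rewrite /c pickleK_inv eF lt_n.
rewrite big_map big_seq [RHS]big_seq; apply: eq_bigr => e eF.
by rewrite /c /q pickleK_inv eF.
Qed.

End existence.

Lemma bernoulli_product_unique {R : realType} {E : countType} (p : E -> R)
    (P Q : probability (config E) R) :
  is_bernoulli_product p P -> is_bernoulli_product p Q ->
  forall A, measurable A -> P A = Q A.
Proof.
move=> bP bQ A mA.
pose G : set (set (config E)) :=
  [set B | B = set0 \/ exists F b, B = cylinder F b].
have cylT : cylinder fset0 (fun=> true) = [set: config E].
  by apply/seteqP; split => // w _ e; rewrite in_fset0.
apply: (measure_unique G (fun=> setT)) => //.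
- apply/seteqP; split; last first.
    apply: smallest_sub; first exact: sigma_algebra_measurable.
    move=> B [->|[F [b ->]]]; first exact: measurable0.
    exact: measurable_cylinder.
  apply: sub_sigma_algebra2 => _ [e _ <-]; right; exists [fset e]%fset, (fun=> true).
  apply/seteqP; split => w /=; rewrite /is_open /cylinder/=.
    by move=> we e'; rewrite in_fset1 => /eqP ->.
  by apply; rewrite in_fset1.
- move=> B C [->|[F [b ->]]]; first by rewrite set0I; left.
  move=> [->|[F' [b' ->]]]; first by rewrite setI0; left.
  have [bb'|] := pselect (forall e, e \in F -> e \in F' -> b e = b' e).
    right; exists (F `|` F')%fset, (fun e => if e \in F then b e else b' e).
    apply/seteqP; split => w.
      move=> [h h'] e; rewrite in_fsetU; case: ifPn => [/h //|_ /=].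
      exact: h'.
    move=> h; split=> e eF; move: (h e); rewrite in_fsetU eF ?orbT => ->//.
    by case: ifPn => // eF'; exact: bb'.
  move=> nbb'; left; apply/seteqP; split => // w [h h'] /=; apply: nbb' => e.
  by move=> /h <- /h' <-.
- by move=> _; right; exists fset0, (fun=> true).
- by rewrite bigcup_const//; exists 0%N.
- move=> B [->|[F [b ->]]]; first by rewrite !measure0.
  exact: etrans (bP F b) (esym (bQ F b)).
- by move=> _; rewrite (@le_lt_trans _ _ 1%E) ?ltry ?probability_le1.
Qed.

Lemma bigcup_countable_measurable d (T : measurableType d) (I : countType)
    (F : I -> set T) :
  (forall i, measurable (F i)) -> measurable (\bigcup_i F i).
Proof.
move=> mF.
have -> : \bigcup_i F i =
    \bigcup_n (if @pickle_inv I n is Some i then F i else set0).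
  apply/seteqP; split => x.
    by move=> [i _ Fix]; exists (choice.pickle i) => //; rewrite pickleK_inv.
  by move=> [n _]; case: pickle_inv => // i Fix; exists i.
by apply: bigcupT_measurable => n; case: pickle_inv => // i.
Qed.

(* The unordered pair {i, j}, i <> j, is represented by (i, j) with i < j. *)
Definition edge := {e : int * int | e.1 < e.2}.

Section percolation.
Context {R : realType}.

Definition coupling (i j : int) : R := 1 / `|i - j|%:~R ^+ 2.

Definition edge_prob (beta lambda : R) (e : edge) : R :=
  let: (i, j) := val e in
  if `|i - j| == 1 then 1 - expR (- lambda)
  else 1 - expR (- (beta * coupling i j)).

Lemma edge_prob_itv (beta lambda : {posnum R}) (e : edge) :
  0 < edge_prob beta%:num lambda%:num e < 1.
Proof.
have H (x : R) : 0 < x -> 0 < 1 - expR (- x) < 1.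
  move=> x0; rewrite subr_gt0 expR_lt1 oppr_lt0 x0/=.
  by rewrite ltrBlDr ltrDl expR_gt0.
case: e => -[i j] /= ij; rewrite /edge_prob/=; case: ifP => _; apply: H => //.
rewrite mulr_gt0// divr_gt0// exprn_gt0// ltr0z normr_gt0 subr_eq0.
by rewrite lt_eqF.
Qed.

(* By bernoulli_product_unique, the law is determined by percolation_lawP. *)
Definition percolation_law (beta lambda : {posnum R}) :
    probability (config edge) R :=
  projT1 (cid (exists_bernoulli_product (edge_prob_itv beta lambda))).

Lemma percolation_lawP (beta lambda : {posnum R}) :
  is_bernoulli_product (edge_prob beta%:num lambda%:num)
    (percolation_law beta lambda).
Proof. exact: projT2 (cid _). Qed.

Definition adjacent (w : config edge) : rel int := fun i j =>
  `[< exists2 e : edge, w e & val e = (i, j) \/ val e = (j, i) >].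

Definition cluster (w : config edge) (i : int) : set int :=
  [set j | exists2 s : seq int, path (adjacent w) i s & last i s = j].

Definition percolates : set (config edge) :=
  [set w | infinite_set (cluster w 0)].

Lemma measurable_adjacent i j : measurable [set w | adjacent w i j].
Proof.
have -> : [set w | adjacent w i j] = \bigcup_(e : edge)
    (if (val e == (i, j)) || (val e == (j, i)) then is_open e else set0).
  apply/seteqP; split => w /=.
    move=> /asboolP[e we eij]; exists e => //.
    by case: eij => ->; rewrite eqxx ?orbT.
  move=> [e _]; case: ifPn => // eij we; apply/asboolP; exists e => //.
  by case/orP: eij => /eqP; [left|right].
apply: bigcup_countable_measurable => e.
by case: ifPn => _; [exact: measurable_is_open | exact: measurable0].
Qed.

Lemma measurable_cluster i j : measurable [set w | cluster w i j].
Proof.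
have -> : [set w | cluster w i j] = \bigcup_(s : seq int)
    (if last i s == j then [set w | path (adjacent w) i s] else set0).
  apply/seteqP; split => w /=.
    by move=> [s ws sj]; exists s => //; rewrite sj eqxx.
  by move=> [s _]; case: ifPn => // /eqP sj ws; exists s.
apply: bigcup_countable_measurable => s; case: ifPn => _; last first.
  exact: measurable0.
elim: s i => [|k s IH] i /=.
  by rewrite (_ : [set _ | _] = setT)//; apply/seteqP; split.
have -> : [set w | adjacent w i k && path (adjacent w) k s] =
    [set w | adjacent w i k] `&` [set w | path (adjacent w) k s].
  by apply/seteqP; split => w /=; [move/andP | move=> ?; apply/andP].
by apply: measurableI; [exact: measurable_adjacent | exact: IH].
Qed.

Lemma measurable_percolates : measurable percolates.
Proof.
have -> : percolates = \bigcap_(n : nat) \bigcup_(j : int)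
    (if (n <= `|j|)%N then [set w | cluster w 0 j] else set0).
  apply/seteqP; split => w /=.
    move=> iw n _; apply: contrapT => h; apply: iw.
    apply: (@sub_finite_set _ _ [set` [seq (Posz k) | k <- iota 0 n] ++
        [seq - (Posz k) | k <- iota 0 n]]); last exact: finite_seq.
    move=> j wj /=; rewrite mem_cat.
    have jn : (`|j| < n)%N.
      by rewrite ltnNge; apply/negP => nj; apply: h; exists j; rewrite ?nj.
    apply/orP; have [j0|j0] := leP 0 j; [left|right]; apply/mapP;
      exists `|j|%N; rewrite ?mem_iota//.
      by rewrite gez0_abs.
    by rewrite ltz0_abs ?opprK.
  move=> h fw; have [s sE] := (finite_seqP _).1 fw.
  have [j _] := h (\max_(j <- s) `|j|%N).+1 I.
  case: ifPn => // nj wj.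
  have js : j \in s by have : [set` s] j by rewrite -sE.
  by move: nj; rewrite ltnNge (leq_bigmax_seq (F := fun j : int => `|j|%N)).
apply: bigcapT_measurable => n; apply: bigcup_countable_measurable => j.
by case: ifPn => _; [exact: measurable_cluster | exact: measurable0].
Qed.

Definition theta (beta lambda : {posnum R}) : R :=
  fine (percolation_law beta lambda percolates).

End percolation.

(* Main.v *)
Require Import Defs.
From mathcomp Require Import all_boot all_order all_algebra.
From mathcomp Require Import finmap.
From mathcomp Require Import all_classical all_reals all_analysis.
From mathcomp Require Import zify ring lra.
Import Order.TTheory GRing.Theory Num.Theory numFieldNormedType.Exports.
Local Open Scope classical_set_scope.
Local Open Scope ring_scope.
Set Implicit Arguments.
Unset Strict Implicit.
Unset Printing Implicit Defensive.

(* (i) A block is t-good if a cluster inside it has density at least t.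
   Good blocks with t > 3/4 which overlap by half share a cluster, so a block
   of C scales higher is bad only if two disjoint sub-blocks are bad, or if a
   single bad sub-block i disconnects the dense clusters on its two sides.
   The interaction of these is about t^2 log(min(i, 2C - i)), so the latter has
   probability at most i^{-beta t^2} times that of a bad sub-block, which is
   summable in i; the probability of being bad thus contracts geometrically
   while t decreases by a summable amount.

   (ii) Let f(N) be the probability that [0, N[ and [2N, 3N[ are not connected
   inside [0, 3N[. Only edges whose two endpoints have a large cluster matter
   at large scales, and these endpoints have density theta^2 among pairs; by
   Harris' inequality, a given crossing-free window of length 3N in the middle
   third of a window of length 3CN separates the latter with probability at
   least C^{-beta theta^2}, up to a constant. If beta theta^2 < 1, the number of
   such windows, of order C, wins: f(CN) >= 3 f(N) as long as f(N) is small.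
   Hence f does not tend to 0, and finite clusters are enclosed with a
   probability bounded below at arbitrarily large scales, independently of
   what happens near the origin, which contradicts theta > 0. *)

(* These names are shadowed by MathComp-Analysis. *)
Local Notation adjacent := Defs.adjacent.
Local Notation cluster := Defs.cluster.

(** * Finite expectations and the Harris inequality *)

Section events.
Context {E : countType}.
Implicit Types (w : E -> bool) (D : pred E) (s : seq E).

(** Two constraints shape the proof. Inequalities are proved for events that depend on finitely many
    edges, where a probability is an iterated average over single edges; infinite volume enters
    through limits, in [Theta m] decreasing to [theta] and in unions over cutoffs of long edges.
    Moreover, an edge has to be decoupled from the clusters at its endpoints. In (ii) these clusters
    are explored up to distance [m] without using the edge, hence independently of it; once
    restricted to edges shorter than [l], the two explorations are also independent of each other.
    The price is a union bound over long edges, of order [m M / l ^ 2], which is negligible since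
    [M] is a fixed multiple of [N] and [l] is close to [N]. In (i) the clusters on the two sides of
    a bad block only use edges inside one side, so that conditionally on them the edges across are
    still independent. The factor 3 in (ii) is 4 - 1: the [2 D] disjoint windows contribute at least
    [4 f] in total, and their pairs take back at most [f] when [4 D ^ 2 f <= 1]. *)

Definition upd w e b : E -> bool := fun e' => if e' == e then b else w e'.

Definition depends (T : Type) D (f : (E -> bool) -> T) :=
  forall w w', (forall e, D e -> w e = w' e) -> f w = f w'.

Definition local (T : Type) (f : (E -> bool) -> T) :=
  exists s, depends (mem s) f.

Definition decreasing (Q : (E -> bool) -> bool) :=
  forall w w', (forall e, w e -> w' e) -> Q w' -> Q w.

Lemma depends_sub T D D' (f : (E -> bool) -> T) :
  (forall e, D e -> D' e) -> depends D f -> depends D' f.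
Proof. by move=> DD' h w w' ww'; apply: h => e /DD'; exact: ww'. Qed.

Lemma depends2 T1 T2 T (g : T1 -> T2 -> T) D f1 f2 :
  depends D f1 -> depends D f2 -> depends D (fun w => g (f1 w) (f2 w)).
Proof. by move=> h1 h2 w w' ww'; rewrite (h1 w w' ww') (h2 w w' ww'). Qed.

Lemma depends1 T1 T (g : T1 -> T) D f1 :
  depends D f1 -> depends D (fun w => g (f1 w)).
Proof. by move=> h1 w w' ww'; rewrite (h1 w w' ww'). Qed.

Lemma depends_upd T D (f : (E -> bool) -> T) e w b :
  depends D f -> ~~ D e -> f (upd w e b) = f w.
Proof.
move=> h De; apply: h => e' De'; rewrite /upd; case: eqP => // ee'.
by move: De; rewrite -ee' De'.
Qed.

Lemma depends_all (I : eqType) D (l : seq I) (Q : I -> (E -> bool) -> bool) :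
  (forall i, i \in l -> depends D (Q i)) -> depends D (fun w => all (Q^~ w) l).
Proof.
move=> h w w' ww'; apply: eq_in_all => i il; exact: h.
Qed.

Lemma local_all (I : eqType) (l : seq I) (Q : I -> (E -> bool) -> bool) :
  (forall i, i \in l -> local (Q i)) -> local (fun w => all (Q^~ w) l).
Proof.
elim: l => [|i l IH] h; first by exists [::].
have [s1 h1] := h i (mem_head _ _).
have [|s2 h2] := IH; first by move=> j jl; apply: h; rewrite inE jl orbT.
exists (s1 ++ s2) => /=; apply: (depends2 andb).
  by apply: depends_sub h1 => e /= es; rewrite mem_cat es.
by apply: depends_sub h2 => e /= es; rewrite mem_cat es orbT.
Qed.

Lemma local2 T1 T2 T (g : T1 -> T2 -> T) f1 f2 :
  local f1 -> local f2 -> local (fun w => g (f1 w) (f2 w)).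
Proof.
move=> [s1 h1] [s2 h2]; exists (s1 ++ s2); apply: depends2.
  by apply: depends_sub h1 => e /= es; rewrite mem_cat es.
by apply: depends_sub h2 => e /= es; rewrite mem_cat es orbT.
Qed.

Lemma local1 T1 T (g : T1 -> T) f1 : local f1 -> local (fun w => g (f1 w)).
Proof. by move=> [s h]; exists s; exact: depends1. Qed.

Lemma local_edge e : local (fun w => w e).
Proof. by exists [:: e] => w w' ww'; apply: ww'; rewrite /= inE. Qed.

Lemma local_has (I : eqType) (l : seq I) (Q : I -> (E -> bool) -> bool) :
  (forall i, i \in l -> local (Q i)) -> local (fun w => has (Q^~ w) l).
Proof.
move=> h; have -> : (fun w => has (Q^~ w) l) =
    (fun w => ~~ all (fun i => ~~ Q i w) l).
  by apply: funext => w; rewrite -has_predC; apply: eq_has => i /=; rewrite negbK.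
by apply/local1/local_all => i /h; exact: local1.
Qed.

Lemma decreasing_and Q Q' : decreasing Q -> decreasing Q' ->
  decreasing (fun w => Q w && Q' w).
Proof. by move=> h h' w w' ww' /andP[/(h _ _ ww')-> /(h' _ _ ww')->]. Qed.

Lemma decreasing_all (I : eqType) (l : seq I) (Q : I -> (E -> bool) -> bool) :
  (forall i, i \in l -> decreasing (Q i)) -> decreasing (fun w => all (Q^~ w) l).
Proof.
by move=> h w w' ww' /allP Qw'; apply/allP => i il; exact: h (Qw' i il).
Qed.

End events.

Section expectation.
Context {R : realType} {E : countType} (p : E -> R).
Hypothesis p01 : forall e, 0 <= p e <= 1.
Implicit Types (w : E -> bool) (D : pred E) (s : seq E) (f g : (E -> bool) -> R).

(** For [s] without repetition, the conditional expectation of [f] given the edges outside [s],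
    whose states are read in [w]. Keeping [w] as an argument allows inductions on [s] that average
    one edge at a time. *)
Fixpoint expect s f w : R :=
  if s is e :: s' then
    p e * expect s' f (upd w e true) + (1 - p e) * expect s' f (upd w e false)
  else f w.

Lemma eq_expect s f g : f =1 g -> expect s f =1 expect s g.
Proof. by move=> fg; elim: s => [|e s IH] w /=; rewrite ?fg ?IH. Qed.

Lemma expect_cst s c w : expect s (fun=> c) w = c.
Proof. by elim: s w => [|e s IH] w //=; rewrite !IH; ring. Qed.

Lemma expectD s f g w :
  expect s (fun w => f w + g w) w = expect s f w + expect s g w.
Proof. by elim: s w => [|e s IH] w //=; rewrite !IH; ring. Qed.

Lemma expectZ s c f w : expect s (fun w => c * f w) w = c * expect s f w.
Proof. by elim: s w => [|e s IH] w //=; rewrite !IH; ring. Qed.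

Lemma ler_expect s f g w : (forall w, f w <= g w) -> expect s f w <= expect s g w.
Proof.
move=> fg; elim: s w => [|e s IH] w //=; have /andP[? ?] := p01 e.
by rewrite lerD// ler_wpM2l// subr_ge0.
Qed.

Lemma depends_expect D s f : depends D f -> depends D (expect s f).
Proof.
move=> h; elim: s => [|e s IH] w w' ww' /=; first exact: h.
by congr (_ * _ + _ * _); apply: IH => e' De'; rewrite /upd; case: eqP => // _;
  exact: ww'.
Qed.

Lemma expect_mono s f : (forall w w', (forall e, w e -> w' e) -> f w <= f w') ->
  forall w w', (forall e, w e -> w' e) -> expect s f w <= expect s f w'.
Proof.
move=> h; elim: s => [|e s IH] w w' ww' /=; first exact: h.
have /andP[? ?] := p01 e.
by rewrite lerD// ler_wpM2l// ?subr_ge0//; apply: IH => e'; rewrite /upd;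
  case: eqP => // _; exact: ww'.
Qed.

(** Induction on the edges. For one edge this is Chebyshev's sum inequality, with defect
    [p e * (1 - p e) * (f1 - f0) * (g1 - g0)]; averaging an edge keeps the functions increasing. *)
Lemma harris s f g :
  (forall w w', (forall e, w e -> w' e) -> f w <= f w') ->
  (forall w w', (forall e, w e -> w' e) -> g w <= g w') ->
  forall w, expect s f w * expect s g w <= expect s (fun w => f w * g w) w.
Proof.
move=> hf hg; elim: s => [|e s IH] w //=; have /andP[p0 p1] := p01 e.
have := IH (upd w e true); have := IH (upd w e false).
have ww' : forall e', upd w e false e' -> upd w e true e'.
  by move=> e'; rewrite /upd; case: eqP.
have := expect_mono s hf ww'; have := expect_mono s hg ww'.
move: (expect s (fun w => f w * g w) _) (expect s (fun w => f w * g w) _).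
move: (expect s f (upd w e true)) (expect s g (upd w e true)).
move: (expect s f (upd w e false)) (expect s g (upd w e false)).
move=> f0 g0 f1 g1 fg1 fg0 g01 f01 h0 h1.
apply: (@le_trans _ _ (p e * (f1 * g1) + (1 - p e) * (f0 * g0))).
  rewrite -subr_ge0.
  rewrite (_ : _ - _ = p e * (1 - p e) * (f1 - f0) * (g1 - g0)); last by ring.
  by rewrite !mulr_ge0// subr_ge0.
by rewrite lerD// ler_wpM2l// ?subr_ge0.
Qed.

(** Each edge is seen by at most one factor, so its average can be taken in that factor alone. *)
Lemma expect_indep D s f g w : depends D f -> depends (predC D) g ->
  expect s (fun w => f w * g w) w = expect s f w * expect s g w.
Proof.
move=> hf hg; elim: s w => [|e s IH] w //=; rewrite !IH.
have [De|De] := boolP (D e).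
  have hg' b : expect s g (upd w e b) = expect s g w.
    by apply: depends_upd; [exact: depends_expect hg | rewrite /= De].
  by rewrite !hg'; ring.
have hf' b : expect s f (upd w e b) = expect s f w.
  by apply: depends_upd De; exact: depends_expect.
by rewrite !hf'; ring.
Qed.

Lemma expect_edge s e w : e \in s -> uniq s -> expect s (fun w => (w e)%:R) w = p e.
Proof.
elim: s w => // e' s IH w /=; rewrite inE => /predU1P[<-|es] /andP[e's us].
  have h b : expect s (fun w => (w e)%:R) (upd w e b) = b%:R.
    have -> : expect s (fun w => (w e)%:R) (upd w e b) =
        expect s (fun=> b%:R) (upd w e b); last exact: expect_cst.
    have : upd w e b e = b by rewrite /upd eqxx.
    move: (upd w e b) => w'; clear -e's; elim: s w' e's => [|e' s IH] w' /=.
      by move=> _ ->.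
    rewrite inE negb_or => /andP[ee' es] w'e.
    by rewrite !IH// /upd (negbTE ee').
  by rewrite !h mulr1 mulr0 addr0.
by rewrite !IH//; ring.
Qed.

(** Given the states outside [X], the values of [f] and of all [h e] are fixed. The product is then
    affine in each [w e], which can be replaced by its mean [p e], one edge at a time. *)
Lemma expect_closed_edges s X f (h : E -> (E -> bool) -> bool) w :
  uniq s -> uniq X -> {subset X <= s} ->
  depends (fun e => e \notin X) f ->
  (forall e, e \in X -> depends (fun e => e \notin X) (h e)) ->
  expect s (fun w => f w * \prod_(e <- X) (1 - (w e)%:R * (h e w)%:R)) w =
  expect s (fun w => f w * \prod_(e <- X) (1 - p e * (h e w)%:R)) w.
Proof.
move=> us; elim: X f => [|e X IH] f /=.
  by move=> *; apply: eq_expect => w'; rewrite !big_nil.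
move=> /andP[eX uX] Xs hf hh.
have es : e \in s by apply: Xs; rewrite inE eqxx.
pose g w := f w * \prod_(e <- X) (1 - (w e)%:R * (h e w)%:R).
have sub1 e' : e' \notin e :: X -> e' != e by rewrite inE negb_or => /andP[].
have sub2 e' : e' \notin e :: X -> e' \notin X by rewrite inE negb_or => /andP[].
have hg : depends (predC (pred1 e)) (fun w => (h e w)%:R * g w).
  move=> w1 w2 ww'; rewrite /g; have -> : h e w1 = h e w2.
    by apply: (hh e); rewrite ?inE ?eqxx// => e' /sub1; exact: ww'.
  congr (_ * (_ * _)).
  - by apply: hf => e' /sub1; exact: ww'.
  - rewrite big_seq [RHS]big_seq; apply: eq_bigr => e' e'X.
    have -> : h e' w1 = h e' w2.
      by apply: (hh e'); rewrite ?inE ?e'X ?orbT// => ? /sub1; exact: ww'.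
    rewrite (ww' e')//=; apply/eqP => /= ee'.
    by move: eX; rewrite -ee' e'X.
transitivity (expect s (fun w => g w + - 1 * ((w e)%:R * ((h e w)%:R * g w))) w).
  by apply: eq_expect => w'; rewrite big_cons /g; ring.
rewrite expectD expectZ (@expect_indep (pred1 e))//; last first.
  by move=> w1 w2 ww'; rewrite (ww' e)//= eqxx.
rewrite expect_edge// -expectZ -expectZ -expectD.
rewrite [RHS](eq_expect s (g := fun w => (f w * (1 - p e * (h e w)%:R)) *
  \prod_(e <- X) (1 - p e * (h e w)%:R))); last first.
  by move=> w'; rewrite big_cons mulrA.
rewrite -IH//.
- by apply: eq_expect => w'; rewrite /g; ring.
- by move=> e' e'X; apply: Xs; rewrite inE e'X orbT.
- apply: (depends2 (fun a b => a * b)); first exact: depends_sub hf.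
  apply: (depends1 (fun b : bool => 1 - p e * b%:R)).
  by apply: depends_sub (hh e _); rewrite ?inE ?eqxx.
- move=> e' e'X; apply: depends_sub (hh e' _); rewrite ?inE ?e'X ?orbT//.
Qed.

End expectation.

(** * Probabilities of events that depend on finitely many edges *)

Section probability.
Context {R : realType} {E : countType} (p : E -> R) (P : probability (config E) R).
Hypothesis p01 : forall e, 0 <= p e <= 1.
Hypothesis lawP : is_bernoulli_product p P.
Implicit Types (w : E -> bool) (s : seq E) (Q : (E -> bool) -> bool).

Definition pr Q : R := fine (P [set w | Q w]).

Let indicator Q w : R := (Q w)%:R.

Lemma measurable_local Q : local Q -> measurable [set w : config E | Q w].
Proof.
move=> [s hs].
have -> : [set w : config E | Q w] = \bigcup_(t : (size s).-tuple bool)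
    (let b e := nth false t (index e s) in
     if Q b then cylinder [fset x in s]%fset b else set0).
  apply/seteqP; split => w /=.
    move=> Qw; exists (map_tuple w (in_tuple s)) => //=.
    have bw e : e \in s -> nth false (map w s) (index e s) = w e.
      by move=> es; rewrite (nth_map e) ?index_mem// nth_index.
    have -> : Q (fun e => nth false (map w s) (index e s)) by rewrite (hs _ w).
    by move=> e; rewrite in_fset => es; rewrite bw.
  move=> [t _]; case: ifPn => // Qt wt; move: Qt; congr (is_true _).
  by apply: hs => e es; rewrite wt// in_fset.
apply: bigcup_countable_measurable => t /=; case: ifPn => _.
  exact: measurable_cylinder.
exact: measurable0.
Qed.

(** The cylinder is split by the state of the next edge of [s], which moves into [F]. Once [s] is
    exhausted, [Q] is constant on the cylinder. *)
Lemma cylinder_expect s (F : {fset E}) Q b : uniq s ->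
  (forall e, e \in s -> e \notin F) ->
  depends (fun e => (e \in F) || (e \in s)) Q ->
  P (cylinder F b `&` [set w | Q w]) =
  ((\prod_(e <- F) (if b e then p e else 1 - p e)) * expect p s (indicator Q) b)%:E.
Proof.
elim: s F b => [|e s IH] F b /=.
  move=> _ _ hQ; have Qb w : cylinder F b w -> Q w = Q b.
    by move=> wF; apply: hQ => e /orP[/wF//|]; rewrite in_nil.
  rewrite /indicator; have [Qbt|/negbTE Qbf] := boolP (Q b).
    rewrite mulr1 -lawP; congr (P _); apply/seteqP; split => w /=; first by case.
    by move=> wF; rewrite Qb.
  rewrite mulr0 (_ : _ `&` _ = set0) ?measure0//.
  by apply/seteqP; split => w //= -[/Qb ->]; rewrite Qbf.
move=> /andP[es us] hF hQ.
have eF : e \notin F by apply: hF; rewrite mem_head.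
have updF c e' : e' \in F -> upd b e c e' = b e'.
  by rewrite /upd; case: eqP => // ->; rewrite (negbTE eF).
have cylE c : cylinder (e |` F)%fset (upd b e c) =
    cylinder F b `&` [set w | w e = c].
  apply/seteqP; split => w /=.
    move=> h; split; last by rewrite h ?fset1U1// /upd eqxx.
    by move=> e' e'F; rewrite h ?in_fset1U ?e'F ?orbT// updF.
  move=> [h we] e'; rewrite in_fset1U => /predU1P[->|e'F].
    by rewrite we /upd eqxx.
  by rewrite updF//; exact: h.
have PE c : P (cylinder F b `&` [set w | w e = c] `&` [set w | Q w]) =
    ((\prod_(e <- F) (if b e then p e else 1 - p e)) *
     ((if c then p e else 1 - p e) * expect p s (indicator Q) (upd b e c)))%:E.
  rewrite -cylE IH//.
  - rewrite big_fsetU1//= {1}/upd eqxx mulrCA mulrA; congr (_ * _)%:E.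
    congr (_ * _); rewrite big_seq [RHS]big_seq; apply: eq_bigr => e' e'F.
    by rewrite updF.
  - move=> e' e's; rewrite in_fset1U negb_or hF ?inE ?e's ?orbT// andbT.
    by apply: contraNneq es => <-.
  - apply: depends_sub hQ => e' /=; rewrite inE in_fset1U.
    rewrite -orbA orbCA; by [].
have mQ c : measurable (cylinder F b `&` [set w | w e = c] `&` [set w | Q w]).
  rewrite -cylE; apply: measurableI; first exact: measurable_cylinder.
  apply: measurable_local; exists (F ++ e :: s) => w w' ww'; apply: hQ => e' h.
  by apply: ww' => /=; rewrite mem_cat inE.
have -> : cylinder F b `&` [set w | Q w] =
    (cylinder F b `&` [set w | w e = true] `&` [set w | Q w]) `|`
    (cylinder F b `&` [set w | w e = false] `&` [set w | Q w]).
  apply/seteqP; split => w /=; last by case=> -[[]].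
  by move=> [? ?]; case: (w e); [left|right].
rewrite measureU//; last first.
  by apply/seteqP; split => w //= -[[[_ ->]]] _ [[_]].
apply: (etrans (congr2 adde (PE true) (PE false))).
apply: (congr1 (@EFin R) (x := _ + _)).
by rewrite -mulrDr.
Qed.

Lemma pr_expect s Q w0 : uniq s -> depends (mem s) Q ->
  pr Q = expect p s (fun w => (Q w)%:R) w0.
Proof.
move=> us hQ; rewrite /pr.
have -> : [set w : config E | Q w] = cylinder fset0 w0 `&` [set w | Q w].
  by apply/seteqP; split => w //= -[].
rewrite (cylinder_expect (s := s))//; by rewrite big_seq_fset0 mul1r.
Qed.

Lemma local_uniq T (f : (E -> bool) -> T) : local f ->
  exists2 s, uniq s & depends (mem s) f.
Proof.
move=> [s hs]; exists (undup s); first exact: undup_uniq.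
by apply: depends_sub hs => e /=; rewrite mem_undup.
Qed.

Lemma local_pair T1 T2 (f1 : (E -> bool) -> T1) (f2 : (E -> bool) -> T2) :
  local f1 -> local f2 ->
  exists s, [/\ uniq s, depends (mem s) f1 & depends (mem s) f2].
Proof.
move=> h1 h2; have [s us hs] := local_uniq (local2 pair h1 h2).
by exists s; split => // w w' ww'; have [] := hs w w' ww'.
Qed.

Let w0 : E -> bool := fun=> false.

Lemma pr_ge0 Q : 0 <= pr Q. Proof. exact: fine_ge0. Qed.

Lemma EFin_pr Q : local Q -> (pr Q)%:E = P [set w | Q w].
Proof. by move=> /measurable_local mQ; rewrite /pr fineK// fin_num_measure. Qed.

Lemma pr_le1 Q : local Q -> pr Q <= 1.
Proof.
by move=> lQ; rewrite -lee_fin EFin_pr// probability_le1//; exact: measurable_local.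
Qed.

Lemma pr_le Q Q' : local Q -> local Q' -> (forall w, Q w -> Q' w) -> pr Q <= pr Q'.
Proof.
move=> lQ lQ' QQ'; rewrite -lee_fin !EFin_pr//.
by rewrite le_measure// inE; exact: measurable_local.
Qed.

Lemma prN Q : local Q -> pr (fun w => ~~ Q w) = 1 - pr Q.
Proof.
move=> /local_uniq[s us hs]; rewrite !(pr_expect w0 us)//; last exact: depends1.
rewrite -[X in X - _](expect_cst p s 1 w0) -mulN1r -expectZ -expectD.
by apply: eq_expect => w; case: (Q w) => /=; ring.
Qed.

Lemma prU Q Q' : local Q -> local Q' -> pr (fun w => Q w || Q' w) <= pr Q + pr Q'.
Proof.
move=> lQ lQ'; have [s [us hs hs']] := local_pair lQ lQ'.
rewrite !(pr_expect w0 us)//; last exact: depends2.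
by rewrite -expectD; apply: ler_expect => // w; case: (Q w); case: (Q' w) => /=; lra.
Qed.

Lemma pr_has (I : eqType) (l : seq I) (Q : I -> (E -> bool) -> bool) :
  (forall i, i \in l -> local (Q i)) ->
  pr (fun w => has (Q^~ w) l) <= \sum_(i <- l) pr (Q i).
Proof.
elim: l => [|i l IH] h.
  by rewrite big_nil /pr (_ : [set w | _] = set0) ?measure0//; apply/seteqP; split.
have hl j : j \in l -> local (Q j) by move=> jl; apply: h; rewrite inE jl orbT.
rewrite big_cons /=; apply: (le_trans (prU _ _)).
- by apply: h; exact: mem_head.
- exact: local_has.
- by rewrite lerD2l IH.
Qed.

Lemma pr_edge e : pr (fun w => w e) = p e.
Proof.
have us : uniq [:: e] by [].
rewrite (pr_expect w0 us); first by rewrite expect_edge ?inE.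
by move=> w w' ww'; apply: ww' => /=; rewrite inE.
Qed.

Lemma pr_indep D Q Q' : local Q -> local Q' -> depends D Q -> depends (predC D) Q' ->
  pr (fun w => Q w && Q' w) = pr Q * pr Q'.
Proof.
move=> lQ lQ' dQ dQ'; have [s [us hs hs']] := local_pair lQ lQ'.
rewrite !(pr_expect w0 us)//; last exact: depends2.
rewrite -(@expect_indep _ _ p D).
- by apply: eq_expect => w; case: (Q w); case: (Q' w) => /=; ring.
- exact: (depends1 (fun b : bool => b%:R)).
- exact: (depends1 (fun b : bool => b%:R)).
Qed.

Lemma pr_harris Q Q' : local Q -> local Q' -> decreasing Q -> decreasing Q' ->
  pr Q * pr Q' <= pr (fun w => Q w && Q' w).
Proof.
move=> lQ lQ' dQ dQ'; have [s [us hs hs']] := local_pair lQ lQ'.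
rewrite !(pr_expect w0 us)//; last exact: depends2.
(* Minus the indicator of a decreasing event is increasing, and the two signs cancel in the
   products. *)
pose f Q w : R := - (Q w : bool)%:R.
have hf Q0 : decreasing Q0 -> forall w w', (forall e, w e -> w' e) -> f Q0 w <= f Q0 w'.
  move=> dQ0 w w' ww'; rewrite /f lerN2.
  have := dQ0 w w' ww'; case: (Q0 w'); case: (Q0 w) => //= h; rewrite ?ler01//.
  by have := h isT.
have := harris p01 s (hf _ dQ) (hf _ dQ') w0.
have fE Q0 : expect p s (f Q0) w0 = - expect p s (fun w => (Q0 w)%:R) w0.
  by rewrite -mulN1r -expectZ; apply: eq_expect => w; rewrite /f mulN1r.
rewrite !fE mulrNN => /le_trans; apply.
by apply: ler_expect => // w; rewrite /f; case: (Q w); case: (Q' w) => /=; lra.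
Qed.

Lemma pr_true : pr (fun=> true) = 1.
Proof. by rewrite /pr (_ : [set _ | _] = setT) ?probability_setT//; apply/seteqP; split. Qed.

Lemma pr_harris_all (I : eqType) (l : seq I) (Q : I -> (E -> bool) -> bool) :
  (forall i, i \in l -> local (Q i)) -> (forall i, i \in l -> decreasing (Q i)) ->
  \prod_(i <- l) pr (Q i) <= pr (fun w => all (Q^~ w) l).
Proof.
elim: l => [|i l IH] h d; first by rewrite big_nil pr_true.
have [hl dl] : (forall j, j \in l -> local (Q j)) /\
    (forall j, j \in l -> decreasing (Q j)).
  by split => j jl; [apply: h|apply: d]; rewrite inE jl orbT.
rewrite big_cons; apply: le_trans (pr_harris _ _ _ _).
- by rewrite ler_wpM2l ?pr_ge0// IH.
- by apply: h; exact: mem_head.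
- exact: local_all.
- by apply: d; exact: mem_head.
- exact: decreasing_all.
Qed.

(** The edges outside [X] reveal [Q] and all [h e]. Given them, the edges of [X] with [h e] are
    closed independently, so [c] bounds the conditional probability. *)
Lemma pr_closed_edges X Q (h : E -> (E -> bool) -> bool) (c : R) :
  uniq X -> local Q -> (forall e, e \in X -> local (h e)) ->
  depends (fun e => e \notin X) Q ->
  (forall e, e \in X -> depends (fun e => e \notin X) (h e)) ->
  (forall w, Q w -> \prod_(e <- X) (1 - p e * (h e w)%:R) <= c) ->
  pr (fun w => Q w && all (fun e => ~~ (w e && h e w)) X) <= c * pr Q.
Proof.
move=> uX lQ lh dQ dh hc.
have lX e : e \in X -> local (fun w => ~~ (w e && h e w)).
  by move=> eX; apply/local1/local2; [exact: local_edge | exact: lh].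
have [s1 hs1] := local2 andb lQ (local_all lX).
have [s2 hs2] := lQ; pose s := undup (s1 ++ s2 ++ X).
have us : uniq s by exact: undup_uniq.
rewrite (pr_expect w0 us); last first.
  by apply: depends_sub hs1 => e /= es; rewrite mem_undup mem_cat es.
rewrite (pr_expect w0 us (Q := Q)); last first.
  by apply: depends_sub hs2 => e /= es; rewrite mem_undup !mem_cat es orbT.
rewrite -expectZ; set f := (X in expect _ _ X _ <= _).
have -> : f = fun w => (Q w)%:R * \prod_(e <- X) (1 - (w e)%:R * (h e w)%:R).
  apply: funext => w; rewrite /f -mulnb natrM; congr (_ * _).
  elim: (X) => [|e X' IH]; first by rewrite big_nil.
  rewrite big_cons -IH /= -mulnb natrM; congr (_ * _).
  by case: (w e); case: (h e w) => /=; ring.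
rewrite expect_closed_edges//.
- apply: ler_expect => // w; have [Qw|_] := boolP (Q w); last by rewrite mul0r mulr0.
  by rewrite mul1r mulr1 hc.
- by move=> e eX; rewrite mem_undup !mem_cat eX !orbT.
- exact: (depends1 (fun b : bool => b%:R)).
Qed.

Lemma pr_image (T : E -> E) Q : injective T -> (forall e, p (T e) = p e) ->
  local Q -> pr (fun w => Q (w \o T)) = pr Q.
Proof.
move=> injT pT /local_uniq[s us hs].
have us' : uniq (map T s) by rewrite map_inj_uniq.
rewrite (pr_expect w0 us') ?(pr_expect (w0 \o T) us)//; last first.
  by move=> w w' ww'; apply: hs => e es; apply: ww'; exact: map_f.
clear us us' hs; move: w0; elim: s => [|e s IH] w //=.
rewrite !IH pT; have updT b : upd w (T e) b \o T = upd (w \o T) e b.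
  by apply: funext => e' /=; rewrite /upd (inj_eq injT).
by rewrite !updT.
Qed.
End probability.

(** * Connectivity in the random graph *)

Section graph.
Implicit Types (w : edge -> bool) (i j a : int) (D : rel int) (r : rel int).

Definition edge01 : edge := Sub (0, 1) (erefl true).
(** The order of [i] and [j] is irrelevant. For [i = j] the value is the arbitrary [edge01], hence
    the condition [i != j] in [adjacentE]. *)
Definition edge_of i j : edge := insubd edge01 (if i < j then (i, j) else (j, i)).

Lemma val_edge_of i j : i < j -> val (edge_of i j) = (i, j).
Proof. by move=> ij; rewrite /edge_of ij val_insubd/= ij. Qed.

Lemma edge_ofC i j : edge_of i j = edge_of j i.
Proof. by rewrite /edge_of; case: (ltgtP i j) => // ->. Qed.

Lemma edge_ofK (e : edge) : edge_of (val e).1 (val e).2 = e.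
Proof. by apply: val_inj; rewrite val_edge_of ?(valP e)//; case: (val e). Qed.

Lemma adjacentE w i j : adjacent w i j = (i != j) && w (edge_of i j).
Proof.
apply/asboolP/idP.
  case=> e we ije; have eij := valP e.
  have <- : e = edge_of i j.
    by case: ije => eE; rewrite -[LHS]edge_ofK eE// edge_ofC.
  by rewrite we andbT; case: ije eij => -> /= ij; rewrite neq_lt ij ?orbT.
case/andP; rewrite neq_lt => /orP[ij|ij] we; exists (edge_of i j) => //.
  by left; exact: val_edge_of.
by right; rewrite edge_ofC val_edge_of.
Qed.

Lemma adjacentC w i j : adjacent w i j = adjacent w j i.
Proof. by rewrite !adjacentE eq_sym edge_ofC. Qed.

Lemma adjacent_mono w w' i j : (forall e, w e -> w' e) ->
  adjacent w i j -> adjacent w' i j.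
Proof. by move=> ww'; rewrite !adjacentE => /andP[-> /ww']. Qed.

(** [D] is only tested on the endpoints in increasing order, so it need not be symmetric. *)
Definition dep (T : Type) D (f : (edge -> bool) -> T) :=
  depends (fun e : edge => D (val e).1 (val e).2) f.

Lemma dep_adjacent D i j : D i j || ~~ (i < j) -> D j i || ~~ (j < i) ->
  dep D (fun w => adjacent w i j).
Proof.
move=> Dij Dji w w' ww'; rewrite !adjacentE; case: eqP => //= /eqP.
rewrite neq_lt => /orP[ij|ji]; last rewrite edge_ofC.
  by apply: ww'; rewrite val_edge_of//; move: Dij; rewrite ij orbF.
by apply: ww'; rewrite val_edge_of//; move: Dji; rewrite ji orbF.
Qed.

Lemma dep_local T D (f : (edge -> bool) -> T) (n : nat) : dep D f ->
  (forall i j, i < j -> D i j -> (`|i| <= n)%N && (`|j| <= n)%N) -> local f.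
Proof.
move=> hf Dn; pose rg := [seq k%:Z - n%:Z | k <- iota 0 (n + n).+1].
have rgE i : (`|i| <= n)%N -> i \in rg.
  move=> i_n; apply/mapP; exists (absz (i + n%:Z)); rewrite ?mem_iota; lia.
exists [seq edge_of i j | i <- rg, j <- rg]; apply: depends_sub hf => e De.
have /andP[e1 e2] := Dn _ _ (valP e) De.
have : e \in [seq edge_of i j | i <- rg, j <- rg].
  by apply/allpairsP; exists (val e); rewrite edge_ofK !rgE.
by [].
Qed.

Definition conn r i j : bool := `[< exists2 s, path r i s & last i s = j >].

Lemma connP r i j : reflect (exists2 s, path r i s & last i s = j) (conn r i j).
Proof. exact: asboolP. Qed.

Lemma conn0 r i : conn r i i. Proof. by apply/connP; exists [::]. Qed.

Lemma conn_trans r j i k : conn r i j -> conn r j k -> conn r i k.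
Proof.
move=> /connP[s1 p1 <-] /connP[s2 p2 <-]; apply/connP; exists (s1 ++ s2).
  by rewrite cat_path p1.
by rewrite last_cat.
Qed.

Lemma conn1 (r : rel int) i j : r i j -> conn r i j.
Proof. by move=> rij; apply/connP; exists [:: j] => //=; rewrite rij. Qed.

Lemma conn_sub r r' i j : subrel r r' -> conn r i j -> conn r' i j.
Proof.
by move=> rr' /connP[s ps <-]; apply/connP; exists s => //; exact: sub_path ps.
Qed.

Lemma connC r i j : symmetric r -> conn r i j = conn r j i.
Proof.
move=> rC; suff h i' j' : conn r i' j' -> conn r j' i' by apply/idP/idP; exact: h.
move=> /connP[s ps <-]; apply/connP; exists (rev (belast i' s)).
  by rewrite rev_path; under eq_path => ? ? do rewrite rC.
by case: s ps => //= k s _; rewrite rev_cons last_rcons.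
Qed.

Lemma conn_shift r a i j :
  conn r (i + a) (j + a) = conn (fun i j => r (i + a) (j + a)) i j.
Proof.
apply/idP/idP.
  move=> /connP[s ps sj]; apply/connP; exists [seq k - a | k <- s].
    elim: s i ps {sj} => //= k s IH i /andP[rk ps]; rewrite subrK rk IH//.
    by rewrite subrK.
  by rewrite -{1}[i](addrK a) (last_map (fun k => k - a)) sj addrK.
move=> /connP[s ps <-]; apply/connP; exists [seq k + a | k <- s].
  by elim: s i ps => //= k s IH i /andP[-> /IH].
by rewrite (last_map (fun k => k + a)).
Qed.

(** The path is stopped at its first vertex outside [I]; all its steps up to there start in [I]. *)
Lemma conn_exit r (I : pred int) i z : conn r i z -> I i -> ~~ I z ->
  exists2 z', ~~ I z' & conn (fun i j => r i j && I i) i z'.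
Proof.
move=> /connP[s ps <-]; elim: s i ps => [|k s IH] i /=; first by move=> _ ->.
move=> /andP[rik ps] Ii Iz; have [Ik|nIk] := boolP (I k); last first.
  by exists k => //; apply: conn1; rewrite rik.
have [z' nIz' cz'] := IH _ ps Ik Iz; exists z' => //.
by apply: conn_trans cz'; apply: conn1; rewrite rik.
Qed.

Definition open_conn (ok : rel int) i j w : bool :=
  conn (fun i j => adjacent w i j && ok i j) i j.

Lemma open_conn_mono ok i j w w' : (forall e, w e -> w' e) ->
  open_conn ok i j w -> open_conn ok i j w'.
Proof.
move=> ww'; apply: conn_sub => k l /andP[kl ->].
by rewrite andbT; exact: adjacent_mono kl.
Qed.

Lemma open_conn_sub (ok ok' : rel int) i j w : subrel ok ok' ->
  open_conn ok i j w -> open_conn ok' i j w.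
Proof. by move=> h; apply: conn_sub => k l /andP[-> /h]. Qed.

Lemma open_connC ok i j w : symmetric ok -> open_conn ok i j w = open_conn ok j i w.
Proof. by move=> h; apply: connC => k l; rewrite adjacentC h. Qed.

Lemma dep_open_conn D (ok : rel int) i j :
  (forall i j, i < j -> ok i j || ok j i -> D i j) -> dep D (open_conn ok i j).
Proof.
move=> okD w w' ww'; rewrite /open_conn; congr (conn _ i j).
apply: funext => k; apply: funext => l; have [okkl|_] := boolP (ok k l); last first.
  by rewrite !andbF.
congr (_ && _); apply: (@dep_adjacent D) ww'; rewrite orbC -implybE;
  by apply/implyP => /okD; apply; rewrite okkl ?orbT.
Qed.

Definition shift_edge a (e : edge) : edge := edge_of ((val e).1 + a) ((val e).2 + a).

Lemma val_shift_edge a e : val (shift_edge a e) = ((val e).1 + a, (val e).2 + a).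
Proof. by rewrite /shift_edge val_edge_of// ltrD2r; exact: valP e. Qed.

Lemma shift_edge_inj a : injective (shift_edge a).
Proof.
move=> e e' /(congr1 val); rewrite !val_shift_edge => -[/addIr h1 /addIr h2].
by apply: val_inj; rewrite [LHS]surjective_pairing h1 h2 -surjective_pairing.
Qed.

Lemma adjacent_shift w a i j :
  adjacent (w \o shift_edge a) i j = adjacent w (i + a) (j + a).
Proof.
rewrite !adjacentE (inj_eq (addIr a)); case: eqP => //= /eqP.
rewrite neq_lt => /orP[ij|ij]; last rewrite edge_ofC [in RHS]edge_ofC.
  by congr w; apply: val_inj; rewrite val_shift_edge !val_edge_of ?ltrD2r.
by congr w; apply: val_inj; rewrite val_shift_edge !val_edge_of ?ltrD2r.
Qed.

Lemma open_conn_shift (ok ok' : rel int) w a i j :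
  (forall i j, ok i j = ok' (i + a) (j + a)) ->
  open_conn ok i j (w \o shift_edge a) = open_conn ok' (i + a) (j + a) w.
Proof.
move=> okE; rewrite /open_conn conn_shift; congr (conn _ i j).
by apply: funext => k; apply: funext => l; rewrite adjacent_shift okE.
Qed.

End graph.

Section escape.
Implicit Types (w : edge -> bool) (ok : rel int) (x : int) (m : nat).

(** Steps have to start in the ball of radius [m] around [x]. Nothing is lost, by stopping at the
    first exit, and the event only depends on edges that touch the ball. For [m = 0] it always
    holds. *)
Definition escape ok m x w : bool :=
  `[< exists2 z, ~~ (`|z - x| < m%:Z) &
      open_conn (fun i j => ok i j && (`|i - x| < m%:Z)) x z w >].

Lemma escape_conn ok m x z w : open_conn ok x z w -> ~~ (`|z - x| < m%:Z) ->
  escape ok m x w.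
Proof.
move=> cz zx; apply/asboolP; have [m0|m0] := posnP m.
  by exists x; [rewrite subrr m0 | exact: conn0].
have xx : `|x - x| < m%:Z by rewrite subrr normr0.
have [z' z'x cz'] := conn_exit (I := fun i => `|i - x| < m%:Z) cz xx zx.
by exists z' => //; apply: conn_sub cz' => k l /andP[/andP[-> ->] ->].
Qed.

Lemma escape_mono ok m x w w' : (forall e, w e -> w' e) ->
  escape ok m x w -> escape ok m x w'.
Proof.
by move=> ww' /asboolP[z zx cz]; apply/asboolP; exists z => //;
  exact: open_conn_mono cz.
Qed.

Lemma dep_escape (D : rel int) ok m x :
  (forall i j, i < j -> ok i j && (`|i - x| < m%:Z) || ok j i && (`|j - x| < m%:Z) ->
     D i j) ->
  dep D (escape ok m x).
Proof.
move=> okD w w' ww'; congr (`[< _ >]); apply: propext.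
have h z := dep_open_conn x z okD ww'.
by split=> -[z zx cz]; exists z => //; rewrite ?h// -h.
Qed.

Lemma escape_shift (ok : rel int) m x w : (forall i j, ok i j = ok (i + x) (j + x)) ->
  escape ok m 0 (w \o shift_edge x) = escape ok m x w.
Proof.
move=> okx; have h z : open_conn (fun i j => ok i j && (`|i - 0| < m%:Z)) 0 z
    (w \o shift_edge x) = open_conn (fun i j => ok i j && (`|i - x| < m%:Z)) x (z + x) w.
  rewrite -[X in open_conn _ X _ w]add0r; apply: open_conn_shift => i j.
  by rewrite okx subr0 addrK.
congr (`[< _ >]); apply: propext; split => -[z zx cz].
  by exists (z + x); [rewrite addrK; rewrite subr0 in zx | rewrite -h].
by exists (z - x); [rewrite subr0 | rewrite h subrK].
Qed.

(** A bound on the lengths makes [escape] local, and makes the escapes from two points at distance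
    at least [l + 2 m] independent: no edge shorter than [l] touches both balls. *)
Definition shorter (l : nat) : rel int := fun i j => `|i - j| < l%:Z.

End escape.

(** * Translation invariance and approximation of theta by one-arm probabilities *)

Section percolation.
Context {R : realType} (beta lambda : {posnum R}).
Local Notation P := (percolation_law beta lambda).
Local Notation p := (edge_prob beta%:num lambda%:num).
Local Notation Pr := (pr P).
Implicit Types (w : edge -> bool).

Lemma edge_prob01 e : 0 <= p e <= 1.
Proof. by have /andP[/ltW-> /ltW->] := edge_prob_itv beta lambda e. Qed.

Lemma edge_prob_shift a e : p (shift_edge a e) = p e.
Proof.
rewrite /edge_prob val_shift_edge [val e]surjective_pairing /=.
by rewrite /coupling opprD addrACA subrr addr0.
Qed.

Lemma pr_shift a Q : local Q -> Pr (fun w => Q (w \o shift_edge a)) = Pr Q.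
Proof.
move=> lQ; exact: (pr_image (percolation_lawP _ _) (@shift_edge_inj a)
  (edge_prob_shift a) lQ).
Qed.

Lemma edge_prob_dist i j (d : nat) : (1 < d)%N -> j - i = d%:Z ->
  p (edge_of i j) = 1 - expR (- (beta%:num / d%:R ^+ 2)).
Proof.
move=> d1 ijd; have ij : i < j by lia.
have nij : `|i - j| = d%:Z by lia.
rewrite /edge_prob val_edge_of// nij /coupling nij div1r.
by have /negbTE -> : d%:Z != 1 by lia.
Qed.

Lemma edge_prob_le i j (d : nat) : (1 < d)%N -> d%:Z <= j - i ->
  p (edge_of i j) <= beta%:num / d%:R ^+ 2.
Proof.
move=> d1 dij; rewrite (@edge_prob_dist _ _ `|j - i|); [|lia..].
rewrite lerBlDr; have := expR_ge1Dx (- (beta%:num / `|j - i|%N%:R ^+ 2)).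
have : beta%:num / `|j - i|%N%:R ^+ 2 <= beta%:num / d%:R ^+ 2.
  rewrite ler_wpM2l// lef_pV2 ?posrE ?exprn_gt0 ?ltr0n; [|lia..].
  by rewrite lerXn2r ?nnegrE ?ler0n// ler_nat; lia.
lra.
Qed.

Definition far (m : nat) : set (config edge) :=
  [set w | exists2 z : int, (m <= `|z|)%N & cluster w 0 z].

Definition Theta m : R := fine (P (far m)).

Lemma measurable_far m : measurable (far m).
Proof.
have -> : far m = \bigcup_(z : int)
    (if (m <= `|z|)%N then [set w | cluster w 0 z] else set0).
  apply/seteqP; split => w; first by move=> [z mz cz]; exists z => //; rewrite mz.
  by move=> [z _]; case: ifPn => // mz cz; exists z.
apply: bigcup_countable_measurable => z.
by case: ifPn => _; [exact: measurable_cluster | exact: measurable0].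
Qed.

Lemma percolatesE : @percolates = \bigcap_m far m.
Proof.
apply/seteqP; split => w /=.
  move=> iw m _; apply: contrapT => h; apply: iw.
  apply: (@sub_finite_set _ _ [set` [seq k%:Z - m%:Z | k <- iota 0 (m + m)]]).
    move=> z wz /=; apply/mapP; exists (absz (z + m%:Z)); last first.
      have : ~~ (m <= `|z|)%N by apply/negP => mz; apply: h; exists z.
      lia.
    have : ~~ (m <= `|z|)%N by apply/negP => mz; apply: h; exists z.
    rewrite mem_iota; lia.
  exact: finite_seq.
move=> h fw; have [s sE] := (finite_seqP _).1 fw.
have [z mz wz] := h (\max_(z <- s) `|z|%N).+1 I.
have zs : z \in s by have : [set` s] z by rewrite -sE.
by move: mz; rewrite ltnNge (leq_bigmax_seq (F := fun z : int => `|z|%N)).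
Qed.

Lemma far_le m n : (m <= n)%N -> far n `<=` far m.
Proof. by move=> mn w [z nz cz]; exists z => //; exact: leq_trans nz. Qed.

Lemma Theta_cvg : Theta @ \oo --> theta beta lambda.
Proof.
rewrite /theta percolatesE; apply: fine_cvg.
rewrite fineK ?fin_num_measure//; last first.
  by apply: bigcapT_measurable => m; exact: measurable_far.
apply: nonincreasing_cvg_mu.
- by rewrite -ge0_fin_numE ?fin_num_measure//; exact: measurable_far.
- exact: measurable_far.
- by apply: bigcapT_measurable => m; exact: measurable_far.
- by move=> m n mn; apply/subsetPset; exact: far_le.
Qed.

Lemma theta_approx e : 0 < e -> exists2 m : nat, (0 < m)%N & Theta m < theta beta lambda + e.
Proof.
move=> e0; have e1 : theta beta lambda < theta beta lambda + e by rewrite ltrDl.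
have [m _ h] := cvgr_lt _ Theta_cvg _ e1; exists m.+1 => //; exact: h (leqnSn m).
Qed.

Lemma theta_ge t : (forall m, t <= Theta m) -> t <= theta beta lambda.
Proof.
move=> h; rewrite leNgt; apply/negP; rewrite -subr_gt0 => /theta_approx[m _].
by rewrite addrC subrK ltNge h.
Qed.

Lemma local_escape_shorter l m x : local (escape (shorter l) m x).
Proof.
pose D : rel int := fun i j => ((`|i| <= m + l + `|x|) && (`|j| <= m + l + `|x|))%N.
apply: (@dep_local _ D _ (m + l + `|x|)) => //.
by apply: dep_escape => i j ij; rewrite /shorter /D; lia.
Qed.

(** Invariance under translations is established for local events, so the truncated escape is first
    moved to the origin and only then compared with [far m]. *)
Lemma pr_escape_shorter l m x : Pr (escape (shorter l) m x) <= Theta m.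
Proof.
have -> : Pr (escape (shorter l) m x) = Pr (escape (shorter l) m 0).
  rewrite -[RHS](pr_shift x) ?local_escape_shorter//; last exact: local_escape_shorter.
  congr pr; apply: funext => w; rewrite escape_shift// => i j.
  by rewrite /shorter opprD addrACA subrr addr0.
rewrite -lee_fin (EFin_pr _ (local_escape_shorter _ _ _)).
rewrite /Theta fineK ?fin_num_measure//; [|exact: measurable_far..].
apply: le_measure; rewrite ?inE.
- by apply: measurable_local; exact: local_escape_shorter.
- exact: measurable_far.
move=> w /= /asboolP[z]; rewrite subr0 => zm /connP[s ps sz]; exists z; first by lia.
by exists s => //; apply: sub_path ps => i j /andP[].
Qed.

End percolation.

(** * Absence of crossings *)

Section sums.
Context {R : realType}.

(** Comparison with the telescoping sum of [1 / (d - 1) - 1 / d]. *)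
Lemma sum_inv_sqr (A B : nat) : (1 < A)%N ->
  \sum_(A <= d < B) (d%:R ^+ 2)^-1 <= (A.-1%:R)^-1 :> R.
Proof.
move=> A1; have [BA|AB] := leqP B A.
  by rewrite big_geq// invr_ge0.
suff : \sum_(A <= d < B) (d%:R ^+ 2)^-1 <= (A.-1%:R)^-1 - (B.-1%:R)^-1 :> R.
  by move=> /le_trans; apply; rewrite lerBlDr lerDl invr_ge0.
rewrite -(subnKC (ltnW AB)); elim: (B - A)%N => [|k IH].
  by rewrite addn0 big_geq// subrr.
rewrite addnS big_nat_recr ?leq_addr//=; apply: (le_trans (lerD IH (lexx _))).
have n1 : (1 < A + k)%N by lia.
have -> : ((A + k).-1%:R = (A + k)%:R - 1 :> R) by rewrite -subn1 natrB//; lia.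
have : 1 < (A + k)%:R :> R by rewrite ltr1n.
move: (_%:R) => x x1.
have -> : (x ^+ 2)^-1 = (x - 1)^-1 - x^-1 - (x ^+ 2 * (x - 1))^-1.
  by field; rewrite !gt_eqF//; lra.
have : 0 <= (x ^+ 2 * (x - 1))^-1 by rewrite invr_ge0 mulr_ge0 ?sqr_ge0//; lra.
lra.
Qed.

(** Multiply the inequalities [1 - 1 / (N + t) <= exp (- 1 / (N + t))]: the left-hand sides
    telescope. The power of the scale ratio in the probability of separation comes from here. *)
Lemma expR_harmonic (N a : nat) : (1 < N)%N ->
  N.-1%:R / (N + a).-1%:R <= expR (- \sum_(0 <= t < a) ((N + t)%:R)^-1) :> R.
Proof.
move=> N1; elim: a => [|a IH].
  by rewrite big_geq// oppr0 expR0 addn0 divff// pnatr_eq0; lia.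
rewrite big_nat_recr//= opprD expRD addnS /=.
have -> : N.-1%:R / (N + a)%:R = N.-1%:R / (N + a).-1%:R * (1 - ((N + a)%:R)^-1) :> R.
  have -> : ((N + a).-1%:R = (N + a)%:R - 1 :> R) by rewrite -subn1 natrB//; lia.
  have : 1 < (N + a)%:R :> R by rewrite ltr1n; lia.
  move: ((N + a)%:R) => x x1; field; rewrite !gt_eqF//; lra.
have h : ((N + a)%:R)^-1 <= 1 :> R by rewrite invf_le1 ?ltr0n ?ler1n; lia.
apply: ler_pM => //; rewrite ?divr_ge0//; first by lra.
exact: expR_ge1Dx.
Qed.

(** Convexity of [exp] between [- x] and 0. The right-hand side is the probability that an edge,
    open with probability [1 - exp (- x)], is not both open and in an independent event of
    probability [q]. *)
Lemma expR_concave (x q : R) : 0 <= q <= 1 ->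
  expR (- (x * q)) <= 1 - (1 - expR (- x)) * q.
Proof.
move=> q01; pose t : {i01 R} := Itv01 (proj1 (andP q01)) (proj2 (andP q01)).
have := convex_expR t (- x) 0.
rewrite expR0 !convRE /= /unstable.onem mulr0 addr0 mulr1 mulrN [q * x]mulrC.
by move=> /le_trans; apply; rewrite le_eqVlt; apply/orP; left; apply/eqP; ring.
Qed.

End sums.

(** * From a window without crossing to a larger one *)

Section cut.
Implicit Types (w : edge -> bool) (a x y : int) (N m : nat).

Definition inside a (K : nat) : rel int :=
  fun i j => (a <= i < a + K%:Z) && (a <= j < a + K%:Z).

Lemma insideC a K : symmetric (inside a K).
Proof. by move=> i j; rewrite /inside andbC. Qed.

Definition cut N a w : bool :=
  `[< forall x y, a <= x < a + N%:Z -> a + (2 * N)%:Z <= y < a + (3 * N)%:Z ->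
      ~~ open_conn (inside a (3 * N)) x y w >].

Lemma decreasing_cut N a : decreasing (cut N a).
Proof.
move=> w w' ww' /asboolP h; apply/asboolP => x y hx hy; apply/negP => c.
by have /negP := h x y hx hy; apply; exact: open_conn_mono c.
Qed.

Lemma dep_cut N a : dep (inside a (3 * N)) (cut N a).
Proof.
move=> w w' ww'; have h x y : open_conn (inside a (3 * N)) x y w =
    open_conn (inside a (3 * N)) x y w'.
  apply: (dep_open_conn _ _ _ ww') => i j _.
  by rewrite [X in _ || X]insideC orbb.
by congr (`[< _ >]); apply: propext; split => H x y hx hy; [rewrite -h|rewrite h]; exact: H.
Qed.

Lemma local_inside T (f : (edge -> bool) -> T) a K : dep (inside a K) f -> local f.
Proof.
move=> hf; apply: (@dep_local _ _ _ (`|a| + K)%N hf) => i j _.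
by rewrite /inside; lia.
Qed.

Lemma local_cut N a : local (cut N a).
Proof. exact: local_inside (@dep_cut N a). Qed.

Lemma cut_shift N a w : cut N 0 (w \o shift_edge a) = cut N a w.
Proof.
have h x y : open_conn (inside 0 (3 * N)) x y (w \o shift_edge a) =
    open_conn (inside a (3 * N)) (x + a) (y + a) w.
  by apply: open_conn_shift => i j; rewrite /inside; lia.
congr (`[< _ >]); apply: propext; split => H x y hx hy.
  by rewrite -(subrK a x) -(subrK a y) -h; apply: H; lia.
by rewrite h; apply: H; lia.
Qed.

(* A path made of such steps cannot pass the window [a, a + 3N[ without
   crossing it from its left third to its right third by edges inside it. *)
Definition stay N a : rel int := fun i j =>
  [|| (i < a + N%:Z) && (j < a + N%:Z), inside a (3 * N) i j |
      (a + (2 * N)%:Z <= i) && (a + (2 * N)%:Z <= j)].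

(** Walk back from the first vertex beyond the middle third. As long as a vertex is joined to the
    right third inside the window, it is not in the left third, since that would be a crossing; and
    a [stay] step into the middle or right third from before it starts inside the window. So the
    walk never reaches the left third. *)
Lemma cut_crossing N a w (ok : rel int) x y : cut N a w -> subrel ok (stay N a) ->
  x < a + N%:Z -> a + (2 * N)%:Z <= y -> ~~ open_conn ok x y w.
Proof.
move=> /asboolP cutw okS xN yN; apply/negP => /connP[s ps sy].
pose W u v := open_conn (inside a (3 * N)) u v w.
have noW u v : a <= u < a + N%:Z -> a + (2 * N)%:Z <= v < a + (3 * N)%:Z -> ~ W u v.
  by move=> hu hv; apply/negP; exact: cutw.
suff : exists2 v, a <= x & a + (2 * N)%:Z <= v < a + (3 * N)%:Z /\ W x v.
  by move=> [v ax [hv]]; apply: noW => //; rewrite ax.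
(* The bound is weakened to the end of the middle third, which is the form that the induction along
   the path needs. *)
have : x < a + (2 * N)%:Z by lia.
elim: s x ps sy {xN} => [|k s IH] x /=; first lia.
move=> /andP[/andP[xk okxk] ps] sy x2N; have := okS _ _ okxk.
have W1 : inside a (3 * N) x k -> W x k.
  by move=> h; apply: conn1; rewrite xk.
have [k2N|k2N] := ltP k (a + (2 * N)%:Z); last first.
  rewrite /stay => st; have xkW : inside a (3 * N) x k by move: st; lia.
  exists k; first by move: xkW; rewrite /inside; lia.
  split; last exact: W1.
  by move: xkW; rewrite /inside; lia.
have [v ak [hv Wkv]] := IH k ps sy k2N.
have kN : a + N%:Z <= k by rewrite leNgt; apply/negP => kN; apply: (noW k v) Wkv => //; lia.
rewrite /stay => st; have xkW : inside a (3 * N) x k by move: st; lia.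
exists v; first by move: xkW; rewrite /inside; lia.
by split => //; apply: conn_trans Wkv; exact: W1.
Qed.

Lemma path_or_split (T : Type) (r r' : rel T) (x : T) (s : seq T) : path r x s ->
  path (fun u v => r u v && r' u v) x s \/
  exists s1 v s2, s = s1 ++ v :: s2 /\ ~~ r' (last x s1) v.
Proof.
elim: s x => [|v s IH] x /=; first by left.
move=> /andP[rxv /IH{}IH]; have [r'xv|r'xv] := boolP (r' x v); last first.
  by right; exists [::], v, s.
case: IH => [->|[s1 [u [s2 [-> h]]]]]; first by left; rewrite rxv.
by right; exists (v :: s1), u, s2.
Qed.

(** The relation [r] without the edge between [i] and [j] in either direction: an escape along it
    does not depend on the state of this edge. *)
Definition avoid (r : rel int) i j : rel int :=
  fun k l => [&& r k l, (k != i) || (l != j) & (k != j) || (l != i)].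

Lemma avoid_sym r i j : symmetric r -> symmetric (avoid r i j).
Proof.
move=> rC k l; rewrite /avoid rC; congr (_ && _).
by rewrite andbC orbC [X in _ && X]orbC.
Qed.

Lemma path_avoid (r : rel int) w x s i j :
  (i \notin x :: s) || (j \notin x :: s) ->
  path (fun k l => adjacent w k l && r k l) x s ->
  path (fun k l => adjacent w k l && avoid r i j k l) x s.
Proof.
elim: s x => [|v s IH] x //= ij /andP[/andP[axv rxv] ps].
rewrite axv /avoid rxv /= IH ?andbT//.
  move: ij; rewrite !inE !negb_or ![_ == x]eq_sym ![_ == v]eq_sym.
  by move=> /orP[|] /and3P[-> -> _]; rewrite ?orbT.
by move: ij; rewrite [i \in _]inE [j \in _]inE !negb_or => /orP[|] /andP[_ ->];
  rewrite ?orbT.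
Qed.

(* An open edge across the window matters for the crossing of [0, 3M[ only if
   both its endpoints are connected to distance [m] without it, or if it ends
   within distance [m] of [0, M[ or of [2M, 3M[. *)
Definition danger M m i j w : bool :=
  [|| i < M%:Z + m%:Z, (2 * M)%:Z - m%:Z <= j |
      escape (avoid (inside 0 (3 * M)) i j) m i w &&
      escape (avoid (inside 0 (3 * M)) i j) m j w].

Definition harmless M m i j w : bool := ~~ (adjacent w i j && danger M m i j w).

Lemma decreasing_harmless M m i j : decreasing (harmless M m i j).
Proof.
move=> w w' ww'; apply: contraNN => /andP[/(adjacent_mono ww') -> /=].
rewrite /danger => /or3P[->|->|/andP[h1 h2]]; rewrite ?orbT//.
by rewrite (escape_mono ww' h1) (escape_mono ww' h2) !orbT.
Qed.

(** A crossing of the large window must contain a step that is not in [stay], by [cut_crossing]. The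
    pieces of the path before and after this step join its endpoints to the outer thirds without
    using the edge. Unless the edge ends near these thirds, both endpoints therefore escape to
    distance [m], so the edge is open and dangerous. *)
Lemma cut_up M N m a w : (0 < m)%N -> M%:Z <= a + N%:Z -> a + (2 * N)%:Z <= (2 * M)%:Z ->
  cut N a w ->
  (forall i j, 0 <= i < j -> j < (3 * M)%:Z -> ~~ stay N a i j -> harmless M m i j w) ->
  cut M 0 w.
Proof.
move=> m0 Ma aM cutw hw; apply/asboolP => x y hx hy.
apply/negP => /connP[s0 ps0].
(* On a simple path, neither piece around the edge can contain both of its endpoints. *)
case: (shortenP ps0) => s ps us _ sy {s0 ps0}.
have [ps'|[s1 [l [s2 [sE]]]]] := path_or_split (stay N a) ps.
  have : open_conn (stay N a) x y w.
    apply/connP; exists s => //; apply: sub_path ps' => k l.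
    by move=> /andP[/andP[-> _] ->].
  by apply/negP; apply: (cut_crossing cutw); [move=> ? ?|lia|lia].
move: ps us sy; rewrite sE cat_path last_cat /= mem_cat cat_uniq.
set k := last x s1 => /and3P[ps1 rkl ps2] /and4P[xs us1 nhas us2] sy nst.
have ks1 : k \in x :: s1 by exact: mem_last.
have /andP[ls2 us2'] := us2.
have lx : l \notin x :: s1.
  rewrite inE negb_or; apply/andP; split.
    by apply: contraNneq xs => <-; rewrite mem_head orbT.
  by apply/negP => ls1; move/hasPn: nhas => /(_ l (mem_head _ _)); rewrite /= ls1.
have kl2 : k \notin l :: s2.
  apply/negP => kls; move: ks1; rewrite inE => /predU1P[kx|ks1].
    by move: xs; rewrite -kx kls orbT.
  by move/hasPn: nhas => /(_ k kls); rewrite /= ks1.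
have av i j : (i = k /\ j = l) \/ (i = l /\ j = k) ->
    open_conn (avoid (inside 0 (3 * M)) i j) k x w /\
    open_conn (avoid (inside 0 (3 * M)) i j) l y w.
  move=> ij; split.
    rewrite open_connC; last by apply: avoid_sym; exact: insideC.
    apply/connP; exists s1 => //; apply: path_avoid ps1.
    by case: ij => -[-> ->]; rewrite lx ?orbT.
  apply/connP; exists s2 => //; apply: path_avoid ps2.
  by case: ij => -[-> ->]; rewrite kl2 ?orbT.
move: rkl => /andP[kl /andP[hk hl]].
have esc i j z : (i = k /\ j = l) \/ (i = l /\ j = k) -> M%:Z + m%:Z <= i ->
   j < (2 * M)%:Z - m%:Z -> i < j -> z = i \/ z = j ->
   escape (avoid (inside 0 (3 * M)) i j) m z w.
  move=> ij iM jM ltij; have [ck cl] := av _ _ ij.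
  move=> zij; have : z = k \/ z = l by case: ij => -[? ?]; subst; tauto.
  have [kb lb] : M%:Z + m%:Z <= k < (2 * M)%:Z - m%:Z /\
      M%:Z + m%:Z <= l < (2 * M)%:Z - m%:Z.
    by clear -ij iM jM ltij; case: ij => -[? ?]; subst i j; split; lia.
  case=> ->; [apply: escape_conn ck _; clear -hx kb|apply: escape_conn cl _; clear -hy lb].
    by lia.
  by lia.
have hkl i j : (i = k /\ j = l) \/ (i = l /\ j = k) -> i < j -> False.
  move=> ij ltij; have : harmless M m i j w.
    apply: hw; [clear -ij ltij hk hl; case: ij => -[? ?]; subst i j; lia..|].
    move: nst; case: ij => -[-> ->] //; apply: contraNN.
    by rewrite /stay insideC andbC [X in _ || (_ || X)]andbC.
  rewrite /harmless; have -> : adjacent w i j.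
    by case: ij => -[-> ->]//; rewrite adjacentC.
  rewrite /danger; case: ltP => //= iM; case: leP => //= jM.
  by rewrite !(esc i j)//; [right|left].
have : k != l by move: kl; rewrite adjacentE => /andP[].
rewrite neq_lt => /orP[]; first by apply: hkl; left.
by apply: hkl; right.
Qed.

End cut.

(** * Probability that an edge is harmless *)

Section cut_probability.
Context {R : realType} (beta lambda : {posnum R}).
Local Notation P := (percolation_law beta lambda).
Local Notation p := (edge_prob beta%:num lambda%:num).
Local Notation Pr := (pr P).
Local Notation lawP := (percolation_lawP beta lambda).
Local Notation p01 := (@edge_prob01 R beta lambda).
Local Notation Theta := (Theta beta lambda).
Implicit Types (w : edge -> bool).

Lemma local_adjacent i j : local (fun w => adjacent w i j).
Proof.
rewrite (_ : (fun w => _) = fun w => (i != j) && w (edge_of i j)); last first.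
  by apply: funext => w; rewrite adjacentE.
by apply: local1; exact: local_edge.
Qed.

Lemma pr_adjacent i j : i != j -> Pr (fun w => adjacent w i j) = p (edge_of i j).
Proof.
move=> ij; rewrite -(pr_edge lawP); congr pr; apply: funext => w.
by rewrite adjacentE ij.
Qed.

Lemma pr_adjacent_le i j (d : nat) : (1 < d)%N -> d%:Z <= `|i - j| ->
  Pr (fun w => adjacent w i j) <= beta%:num / d%:R ^+ 2.
Proof.
move=> d1 dij; rewrite pr_adjacent; last by lia.
have [ij|ji] := leP i j; last rewrite edge_ofC; apply: edge_prob_le => //; lia.
Qed.

Lemma pr_nonadjacent i j (d : nat) : (1 < d)%N -> d%:Z = `|i - j| ->
  Pr (fun w => ~~ adjacent w i j) = expR (- (beta%:num / d%:R ^+ 2)).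
Proof.
move=> d1 dij; rewrite (prN lawP) ?pr_adjacent; [|lia|exact: local_adjacent].
have [ij|ji] := leP i j; last rewrite edge_ofC;
  rewrite (@edge_prob_dist _ _ _ _ _ d)//; lia || ring.
Qed.

Lemma decreasing_nonadjacent i j : decreasing (fun w => ~~ adjacent w i j).
Proof. by move=> w w' ww'; apply: contraNN; exact: adjacent_mono. Qed.

Lemma pr_cut N a : Pr (cut N a) = Pr (cut N 0).
Proof.
rewrite -[RHS](pr_shift _ _ a (local_cut N 0)); congr pr.
by apply: funext => w; rewrite cut_shift.
Qed.

Lemma pr_cut_gt0 N : (0 < N)%N -> 0 < Pr (cut N 0).
Proof.
move=> N0; pose V := index_iota 0 (3 * N); pose L := [seq (i, j) | i <- V, j <- V].
pose Q (z : nat * nat) w := (z.1 != z.2) ==> ~~ adjacent w z.1 z.2.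
have lQ z : local (Q z) by apply: local1; apply: local1; exact: local_adjacent.
(* With positive probability all edges inside the window are closed. Each pair is listed in both
   orders, so the events are not independent, but Harris' inequality suffices. *)
apply: (@lt_le_trans _ _ (\prod_(z <- L) Pr (Q z))).
  apply: prodr_gt0 => -[i j] _; rewrite /Q /=; case: eqP => [_|/eqP ij].
    by rewrite /= pr_true.
  rewrite /= (prN lawP) ?pr_adjacent//; last exact: local_adjacent.
  by rewrite subr_gt0; have /andP[] := edge_prob_itv beta lambda (edge_of i j).
apply: (le_trans (pr_harris_all p01 lawP _ _)) => [z _|z _|].
- exact: lQ.
- move=> w w' ww'; rewrite /Q; case: (_ != _) => //=.
  exact: decreasing_nonadjacent.
apply: pr_le; [exact: local_all|exact: local_cut|].
move=> w /allP h; apply/asboolP => x y hx hy; apply/negP => /connP[s ps sy].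
case: s ps sy => [|k s] /=; first by lia.
move=> /andP[/andP[xk /andP[xin kin]] _] _.
have /h : (`|x|%N, `|k|%N) \in L.
  by apply: allpairs_f; rewrite mem_index_iota; lia.
have [x0 k0] : x = `|x|%N%:Z /\ k = `|k|%N%:Z by split; lia.
rewrite /Q /= -x0 -k0 xk implybF negbK => /eqP xk0.
by move: xk; rewrite adjacentE x0 k0 xk0 eqxx.
Qed.

Lemma depends_danger M m i j : i < j ->
  depends (predC (pred1 (edge_of i j))) (danger M m i j).
Proof.
move=> ij w w' ww'.
have h x : escape (avoid (inside 0 (3 * M)) i j) m x w =
    escape (avoid (inside 0 (3 * M)) i j) m x w'.
  apply: (@dep_escape (avoid (inside 0 (3 * M)) i j)) => [k l _|].
    move=> /orP[/andP[//]|/andP[+ _]].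
    by rewrite avoid_sym//; exact: insideC.
  move=> e; rewrite /avoid => De; apply: ww' => /=; apply: contraTneq De => ->.
  by rewrite val_edge_of//= !eqxx andbF.
by rewrite /danger !h.
Qed.

Lemma local_danger M m i j : local (danger M m i j).
Proof.
have h x : dep (inside 0 (3 * M)) (escape (avoid (inside 0 (3 * M)) i j) m x).
  apply: dep_escape => k l _; rewrite /avoid.
  by move=> /orP[/andP[/andP[//]]|/andP[/andP[+ _] _]]; rewrite insideC.
apply: local1; apply: local1; apply: local2; apply: local_inside; exact: h.
Qed.

Lemma local_harmless M m i j : local (harmless M m i j).
Proof. by apply/local1/local2; [exact: local_adjacent|exact: local_danger]. Qed.

(** The error event when an escape inside [[0, 3M[] is replaced by one along edges shorter than [l];
    there are [2 m * 3 M] possible edges. *)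
Definition long_near M m l x w : bool :=
  has (fun t => has (fun u : nat => (l%:Z <= `|x - m%:Z + t%:Z - u%:Z|) &&
    adjacent w (x - m%:Z + t%:Z) u) (index_iota 0 (3 * M))) (index_iota 0 (2 * m)).

Lemma local_long_near M m l x : local (long_near M m l x).
Proof.
apply: local_has => t _; apply: local_has => u _; apply: local1.
exact: local_adjacent.
Qed.

Lemma pr_long_near M m l x : (1 < l)%N ->
  Pr (long_near M m l x) <= (6 * m * M)%:R * (beta%:num / l%:R ^+ 2).
Proof.
move=> l1; pose Q t (u : nat) w := (l%:Z <= `|x - m%:Z + t%:Z - u%:Z|) &&
  adjacent w (x - m%:Z + t%:Z) u.
have lQ t u : local (Q t u) by apply: local1; exact: local_adjacent.
apply: (@le_trans _ _ (\sum_(t <- index_iota 0 (2 * m))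
    \sum_(u <- index_iota 0 (3 * M)) beta%:num / l%:R ^+ 2)).
  apply: (le_trans (pr_has p01 lawP (Q :=
    fun t w => has (Q t ^~ w) (index_iota 0 (3 * M))) _)) => [t _|].
    exact: local_has.
  apply: ler_sum => t _; apply: (le_trans (pr_has p01 lawP (Q := Q t) _)) => //.
  apply: ler_sum => u _; rewrite /Q; have [lx|_] := boolP (l%:Z <= _) => /=.
    exact: pr_adjacent_le.
  rewrite /pr (_ : [set w | _] = set0) ?measure0 ?divr_ge0 ?exprn_ge0//.
  by apply/seteqP; split.
rewrite !big_const_nat !subn0 !iter_addr_0 -mulrnA -[X in X <= _]mulr_natl.
by rewrite ler_wpM2r ?divr_ge0 ?exprn_ge0// ler_nat; lia.
Qed.

Lemma escape_long_near M m l x w i j : escape (avoid (inside 0 (3 * M)) i j) m x w ->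
  long_near M m l x w || escape (shorter l) m x w.
Proof.
move=> /asboolP[z zx cz]; have [//|nl] := boolP (long_near M m l x w).
apply/asboolP; exists z => //; apply: conn_sub cz => k u.
move=> /andP[aku /andP[/and3P[ku _ _] kx]]; rewrite aku kx andbT /=.
rewrite /shorter ltNge; apply: contra nl => lku.
move: ku; rewrite /inside => ku.
apply/hasP; exists (absz (k - x + m%:Z)); first by rewrite mem_index_iota; lia.
apply/hasP; exists (absz u); first by rewrite mem_index_iota; lia.
have -> : x - m%:Z + (absz (k - x + m%:Z))%:Z = k by lia.
have -> : (absz u)%:Z = u by lia.
by rewrite lku aku.
Qed.

(** The endpoints are so far apart that their escapes along edges shorter than [l] are independent,
    whence the square. The other term accounts for a long edge near one of them. *)
Lemma pr_danger M m l i j : (1 < l)%N -> l%:Z + (2 * m)%:Z <= j - i ->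
  M%:Z + m%:Z <= i -> j < (2 * M)%:Z - m%:Z ->
  Pr (danger M m i j) <= Theta m ^+ 2 + 2 * ((6 * m * M)%:R * (beta%:num / l%:R ^+ 2)).
Proof.
move=> l1 lij iM jM.
pose S x := escape (shorter l) m x; pose L x := long_near M m l x.
have lS x : local (S x) by exact: local_escape_shorter.
have lL x : local (L x) by exact: local_long_near.
apply: (@le_trans _ _ (Pr (fun w => (S i w && S j w) || (L i w || L j w)))).
  apply: pr_le; [exact: local_danger| |].
    by apply: local2; apply: local2.
  move=> w; rewrite /danger => /or3P[|/=|/andP[hi hj]]; [lia|lia|].
  have := escape_long_near l hi; have := escape_long_near l hj.
  by rewrite -/(S _ _) -/(S _ _) -/(L _ _) -/(L _ _);
    move=> /orP[->|->] /orP[->|->]; rewrite ?orbT.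
apply: (le_trans (prU p01 lawP _ _)); [by apply: local2..|apply: lerD].
  pose D x : rel int := fun k u => (`|k - u| < l%:Z) &&
    ((`|k - x| < m%:Z) || (`|u - x| < m%:Z)).
  have dS x : dep (D x) (S x).
    by apply: dep_escape => k u _; rewrite /D /shorter; lia.
  rewrite (pr_indep lawP (lS i) (lS j) (dS i)).
    by rewrite expr2 ler_pM ?pr_ge0//; exact: pr_escape_shorter.
  apply: depends_sub (dS j) => e; rewrite /D /=; lia.
apply: (le_trans (prU p01 lawP (lL i) (lL j))).
by rewrite mulrDl mul1r lerD//; exact: pr_long_near.
Qed.

Lemma pr_harmless M m i j (d : nat) q : (1 < d)%N -> j - i = d%:Z ->
  Pr (danger M m i j) <= q <= 1 ->
  expR (- (beta%:num * (q / d%:R ^+ 2))) <= Pr (harmless M m i j).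
Proof.
move=> d1 ijd /andP[hq q1]; have ij : i < j by lia.
have q0 : 0 <= q by apply: le_trans hq; exact: pr_ge0.
rewrite (prN lawP); last by apply: local2; [exact: local_adjacent|exact: local_danger].
rewrite (@pr_indep _ _ _ _ lawP (pred1 (edge_of i j))).
- rewrite pr_adjacent ?lt_eqF// (edge_prob_dist _ _ d1 ijd).
  have -> : beta%:num * (q / d%:R ^+ 2) = beta%:num / d%:R ^+ 2 * q by ring.
  apply: (le_trans (expR_concave _ _)); first by rewrite q0.
  rewrite lerD2l lerN2 ler_wpM2l// subr_ge0 -[leRHS]expR0 ler_expR oppr_le0.
- exact: local_adjacent.
- exact: local_danger.
- by move=> w w' ww'; rewrite !adjacentE (ww' (edge_of i j))//= eqxx.
- exact: depends_danger.
Qed.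

End cut_probability.

(** * Total coupling of the edges that bypass a window *)

Section jumps.
Context {R : realType}.
Implicit Types (N M m a i j K A : nat).

Lemma sum_inv_sqr_from K i A (Q : pred nat) : (1 < A)%N ->
  (forall j, Q j -> (i + A <= j)%N) ->
  \sum_(0 <= j < K | Q j) ((j - i)%:R ^+ 2)^-1 <= (A.-1%:R)^-1 :> R.
Proof.
move=> A1 QA; apply: (le_trans _ (@sum_inv_sqr R A (K - i) A1)).
have -> : \sum_(A <= d < K - i) (d%:R ^+ 2)^-1 =
    \sum_(A + i <= j < K) ((j - i)%:R ^+ 2)^-1 :> R.
  by rewrite big_addn; apply: eq_bigr => d _; rewrite addnK.
rewrite (@big_nat_widenl _ _ _ (A + i) 0)//= big_mkcond [leRHS]big_mkcond.
apply: ler_sum => j _; case: ifPn => [/QA|_]; first by rewrite addnC => ->.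
by case: ifP => // _; rewrite invr_ge0 exprn_ge0.
Qed.

Definition jump N a (z : nat * nat) : bool :=
  (z.1 < z.2)%N && ~~ stay N a%:Z z.1%:Z z.2%:Z.

Definition jumps N a K : seq (nat * nat) :=
  [seq z <- [seq (i, j) | i <- index_iota 0 K, j <- index_iota 0 K] | jump N a z].

Lemma jumpP N a i j : jump N a (i, j) ->
  [/\ (i < j)%N, (a + N <= j)%N, (i < a + 2 * N)%N & (i < a)%N || (a + 3 * N <= j)%N].
Proof. by rewrite /jump /stay /inside /=; split; lia. Qed.

(** The main term comes from the jumps over the left end of the small window: those from [a - 1 - t]
    have total coupling at most [1 / (N + t)]. The constant is 144 for the pairs near the outer
    thirds, plus 2 for the [2 N] starting points inside the window, each of which contributes at
    most [1 / N]. *)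
Lemma sum_jumps N M m a (q : R) : (1 < N)%N -> (0 < M)%N -> 0 <= q <= 1 ->
  (a + 2 * N <= 3 * M)%N ->
  (M + 4 * (M + m) <= 4 * (a + N))%N -> (M + 4 * (a + 2 * N + m) <= 8 * M)%N ->
  \sum_(z <- jumps N a (3 * M))
    (if (z.1 < M + m)%N || (2 * M <= z.2 + m)%N then 1 else q) /
    (z.2 - z.1)%:R ^+ 2 <= q * \sum_(0 <= t < a) ((N + t)%:R)^-1 + 146.
Proof.
move=> N1 M0 /andP[q0 q1] aM h1 h2.
(* By [h1] and [h2], a jump that starts before [M + m] or ends after [2 M - m] has length at least
   [M / 4], hence coupling at most [B]. There are at most [(3 M) ^ 2] such pairs, which gives
   144. *)
pose B : R := 16 / M%:R ^+ 2.
have M0' : 0 < M%:R :> R by rewrite ltr0n.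
have B0 : 0 <= B by rewrite divr_ge0// exprn_ge0.
pose c i : R := if (i < a)%N then q else 1.
rewrite /jumps big_filter big_mkcond big_allpairs_dep /=.
apply: (@le_trans _ _ (\sum_(0 <= i < 3 * M) \sum_(0 <= j < 3 * M)
   ((if jump N a (i, j) then c i * ((j - i)%:R ^+ 2)^-1 else 0) + B))).
  apply: ler_sum => i _; apply: ler_sum => j _.
  case: ifPn => [/jumpP[ij aj ia iaj]|_]; last by rewrite add0r.
  have d0 : 0 < (j - i)%:R :> R by rewrite ltr0n subn_gt0.
  have dV : 0 <= ((j - i)%:R ^+ 2)^-1 :> R by rewrite invr_ge0 exprn_ge0// ltW.
  have ci : q <= c i by rewrite /c; case: ifP.
  have ci0 : 0 <= c i by exact: le_trans ci.
  case: ifPn => [ex|_]; last first.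
    by apply: (@le_trans _ _ (c i * ((j - i)%:R ^+ 2)^-1)); rewrite ?lerDl// ler_wpM2r.
  apply: (@le_trans _ _ B); last by rewrite lerDr mulr_ge0.
  rewrite div1r /B ler_pdivlMr ?exprn_gt0// mulrC ler_pdivrMr ?exprn_gt0//.
  have : (M%:R <= 4 * (j - i)%:R :> R) by rewrite -natrM ler_nat; lia.
  move: M0' d0; move: (M%:R) ((j - i)%:R) => x y x0 y0 xy.
  have -> : 16 * y ^+ 2 = (4 * y) ^+ 2 by ring.
  by rewrite lerXn2r ?nnegrE; lra.
pose r i : R := if (i < a)%N then ((a + N - i).-1%:R)^-1 else
  if (i < a + 2 * N)%N then (N%:R)^-1 else 0.
apply: (@le_trans _ _ (\sum_(0 <= i < 3 * M) (c i * r i + (3 * M)%:R * B))).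
  apply: ler_sum => i _; rewrite big_split /=; apply: lerD; last first.
    by rewrite big_const_nat iter_addr_0 subn0 mulr_natl.
  rewrite -big_mkcond /= -mulr_sumr; apply: ler_wpM2l.
    by rewrite /c; case: ifP.
  rewrite /r; case: ifPn => [ia|]; last rewrite -leqNgt => ai.
    by apply: sum_inv_sqr_from => [|j /jumpP[]]; lia.
  case: ifPn => [iaN|]; last rewrite -leqNgt => aNi.
    have -> : N = N.+1.-1 by [].
    by apply: sum_inv_sqr_from => [|j /jumpP[]]; lia.
  by rewrite big1// => j /jumpP[]; lia.
rewrite big_split /= big_const_nat iter_addr_0 subn0.
have -> : ((3 * M)%:R * B) *+ (3 * M) = 144 :> R.
  by rewrite -[LHS]mulr_natl /B natrM; field; rewrite gt_eqF.
suff h : \sum_(0 <= i < 3 * M) c i * r i <= q * \sum_(0 <= t < a) ((N + t)%:R)^-1 + 2.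
  by move: h; lra.
rewrite (@big_cat_nat _ _ _ a)//=; last by lia.
apply: lerD.
  rewrite big_nat_rev /= mulr_sumr big_seq [leRHS]big_seq; apply: ler_sum => t.
  rewrite mem_index_iota => /andP[_ ta].
  rewrite /c /r; have -> : (0 + a - t.+1 < a)%N by lia.
  by have -> : ((a + N - (0 + a - t.+1)).-1 = N + t)%N by lia.
rewrite (@big_cat_nat _ _ _ (a + 2 * N))//=; last by lia.
rewrite [X in _ + X]big_seq [X in _ + X]big1 ?addr0; last first.
  move=> i; rewrite mem_index_iota /c /r => ai.
  have -> : (i < a)%N = false by lia.
  have -> : (i < a + 2 * N)%N = false by lia.
  by rewrite mulr0.
apply: (@le_trans _ _ (\sum_(a <= i < a + 2 * N) (N%:R)^-1)).
  rewrite big_seq [leRHS]big_seq; apply: ler_sum => i.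
  rewrite mem_index_iota /c /r => ai.
  have -> : (i < a)%N = false by lia.
  have -> : (i < a + 2 * N)%N by lia.
  by rewrite mul1r.
rewrite big_const_nat iter_addr_0 addKn -[leLHS]mulr_natl natrM mulfK// pnatr_eq0; lia.
Qed.

End jumps.

Section recursion.
Context {R : realType} (beta lambda : {posnum R}).
Local Notation P := (percolation_law beta lambda).
Local Notation Pr := (pr P).
Local Notation lawP := (percolation_lawP beta lambda).
Local Notation p01 := (@edge_prob01 R beta lambda).
Local Notation Theta := (Theta beta lambda).
Implicit Types (w : edge -> bool) (N M m a l : nat).

(** [cut N a] and the harmlessness of every jump are decreasing events that together imply
    [cut M 0], so Harris' inequality bounds the probability below by a product. Jumps are longer
    than [N >= l + 2 m], as [pr_danger] requires. *)
Lemma pr_cut_up N M m a l (q : R) : (1 < N)%N -> (0 < m)%N -> (1 < l)%N ->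
  (l + 2 * m <= N)%N -> (M <= a + N)%N -> (a + 2 * N <= 2 * M)%N ->
  (M + 4 * (M + m) <= 4 * (a + N))%N -> (M + 4 * (a + 2 * N + m) <= 8 * M)%N ->
  Theta m ^+ 2 + 2 * ((6 * m * M)%:R * (beta%:num / l%:R ^+ 2)) <= q ->
  Pr (cut N 0) * expR (- (beta%:num * (q * \sum_(0 <= t < a) ((N + t)%:R)^-1 + 146))) <=
  Pr (fun w => cut N a w && cut M 0 w).
Proof.
move=> N1 m0 l1 lN Ma aM h1 h2 hq.
have q0 : 0 <= q.
  apply: le_trans hq; rewrite addr_ge0 ?sqr_ge0// !mulr_ge0//.
(* [q] bounds a probability from above but may exceed 1, while [sum_jumps] and [pr_harmless] need a
   weight in [[0, 1]]. *)
pose q' := Num.min q 1.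
have [q'0 q'1 q'q] : [/\ 0 <= q', q' <= 1 & q' <= q].
  by rewrite /q'; split; [rewrite le_min q0 ler01|rewrite ge_min lexx orbT|
    rewrite ge_min lexx].
pose Q (z : nat * nat) := harmless M m z.1%:Z z.2%:Z.
have lQ z : local (Q z) by exact: local_harmless.
have dQ z : decreasing (Q z) by exact: decreasing_harmless.
pose L := jumps N a (3 * M).
apply: (@le_trans _ _ (Pr (cut N a) * Pr (fun w => all (Q^~ w) L))); last first.
  apply: (le_trans (pr_harris p01 lawP _ _ _ _)).
  - exact: local_cut.
  - exact: local_all.
  - exact: decreasing_cut.
  - exact: decreasing_all.
  apply: pr_le.
  - by apply: (local2 andb); [exact: local_cut|exact: local_all].
  - by apply: (local2 andb); exact: local_cut.
  move=> w /andP[cutw /allP Qw]; rewrite cutw /=.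
  apply: (@cut_up M N m a) => // i j ij jM st.
  have /Qw : (absz i, absz j) \in L.
    rewrite mem_filter /jump /=; have -> : (absz i)%:Z = i by lia.
    have -> : (absz j)%:Z = j by lia.
    rewrite st andbT; apply/andP; split; first lia.
    by apply: allpairs_f; rewrite mem_index_iota; lia.
  rewrite /Q /=; have -> : (absz i)%:Z = i by lia.
  by have -> : (absz j)%:Z = j by lia.
rewrite pr_cut ler_wpM2l ?pr_ge0//.
apply: (le_trans _ (pr_harris_all p01 lawP _ _)) => //.
pose qz (z : nat * nat) : R :=
  if (z.1 < M + m)%N || (2 * M <= z.2 + m)%N then 1 else q'.
apply: (@le_trans _ _ (expR (- (beta%:num * \sum_(z <- L) qz z / (z.2 - z.1)%:R ^+ 2)))).
  rewrite ler_expR lerN2 ler_wpM2l//.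
  apply: (@le_trans _ _ (q' * \sum_(0 <= t < a) ((N + t)%:R)^-1 + 146)); last first.
    by rewrite lerD2r ler_wpM2r// sumr_ge0.
  by apply: sum_jumps => //; [lia|rewrite q'0|lia].
rewrite mulr_sumr -sumrN expR_sum [leLHS]big_seq [leRHS]big_seq; apply: ler_prod => -[i j].
rewrite expR_ge0 /= mem_filter => /andP[/jumpP[/= ij aj ia iaj] _].
apply: pr_harmless => /=; [lia|lia|].
rewrite /qz /=; case: ifPn => [_|ex].
  by rewrite lexx andbT; apply: pr_le1; exact: local_danger.
have h : Pr (danger M m i%:Z j%:Z) <= 1 by apply: pr_le1; exact: local_danger.
rewrite q'1 andbT /q' le_min h andbT; apply: le_trans hq; apply: pr_danger => //; lia.
Qed.

End recursion.

(** * Growth of the probability of no crossing *)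

Section bonferroni.
Context {R : realType} {E : countType} (p : E -> R) (P : probability (config E) R).
Hypothesis p01 : forall e, 0 <= p e <= 1.
Hypothesis lawP : is_bernoulli_product p P.
Local Notation Pr := (pr P).

Lemma prUI Q Q' : local Q -> local Q' ->
  Pr (fun w => Q w || Q' w) = Pr Q + Pr Q' - Pr (fun w => Q w && Q' w).
Proof.
move=> lQ lQ'; have [s [us hs hs']] := local_pair lQ lQ'.
pose w0 := fun _ : E => false.
rewrite !(pr_expect lawP w0 us)//; [|exact: depends2..].
rewrite -mulN1r -expectZ -!expectD; apply: eq_expect => w.
by case: (Q w); case: (Q' w) => /=; ring.
Qed.

(** Bonferroni's inequality, with the number of pairs bounded by the square of the size. *)
Lemma pr_has_ge (I : eqType) (l : seq I) (Q : I -> (E -> bool) -> bool) (x y : R) :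
  0 <= y -> uniq l -> (forall i, i \in l -> local (Q i)) ->
  (forall i, i \in l -> x <= Pr (Q i)) ->
  {in l &, forall i j, i != j -> Pr (fun w => Q i w && Q j w) <= y} ->
  (size l)%:R * x - (size l)%:R ^+ 2 * y <= Pr (fun w => has (Q^~ w) l).
Proof.
move=> y0; elim: l => [|i l IH] /=.
  by move=> *; rewrite mul0r expr0n mul0r subrr pr_ge0.
move=> /andP[il ul] lQ xQ Qy.
have sub j : j \in l -> j \in i :: l by move=> jl; rewrite inE jl orbT.
have lQi : local (Q i) by apply: lQ; rewrite mem_head.
have lQh : local (fun w => has (Q^~ w) l) by apply: local_has => j /sub; exact: lQ.
rewrite prUI//.
have IHl : (size l)%:R * x - (size l)%:R ^+ 2 * y <= Pr (fun w => has (Q^~ w) l).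
  apply: IH => //; first by move=> j /sub; exact: lQ.
    by move=> j /sub; exact: xQ.
  by move=> j k /sub jl /sub kl; exact: Qy.
have h1 : Pr (fun w => Q i w && has (Q^~ w) l) <= (size l)%:R * y.
  have -> : (fun w => Q i w && has (Q^~ w) l) =
      (fun w => has (fun j => Q i w && Q j w) l).
    apply: funext => w; elim: (l) => [|j l' IHl'] /=; first by rewrite andbF.
    by rewrite andb_orr IHl'.
  apply: (le_trans (pr_has p01 lawP (Q := fun j w => Q i w && Q j w) _)).
    by move=> j jl; apply: (local2 andb) => //; apply: lQ; exact: sub.
  rewrite mulr_natl; apply: (@le_trans _ _ (\sum_(j <- l) y)); last first.
    by rewrite big_const_seq count_predT iter_addr_0.
  rewrite big_seq [leRHS]big_seq; apply: ler_sum => j jl.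
  apply: Qy; rewrite ?mem_head ?sub//.
  by apply: contraNneq il => ->.
have h2 := xQ i (mem_head _ _).
rewrite -natr1; move: (size l)%:R (ler0n R (size l)) h1 h2 IHl => n n0.
move: (Pr _) (Pr _) (Pr _) => a b c h1 h2 h3.
have ny : 0 <= n * y by exact: mulr_ge0.
nra.
Qed.

End bonferroni.

Lemma exists_natr_gt (R : realType) (x : R) : exists n : nat, x < n%:R.
Proof.
by exists (Num.truncn x).+1; exact: truncnS_gt.
Qed.

Section growth.
Context {R : realType} (beta lambda : {posnum R}).
Local Notation P := (percolation_law beta lambda).
Local Notation Pr := (pr P).
Local Notation lawP := (percolation_lawP beta lambda).
Local Notation p01 := (@edge_prob01 R beta lambda).
Local Notation Theta := (Theta beta lambda).
Implicit Types (N M m : nat).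

Lemma pr_cut_cut N (a b : int) : a + (3 * N)%:Z <= b \/ b + (3 * N)%:Z <= a ->
  Pr (fun w => cut N a w && cut N b w) = Pr (cut N 0) ^+ 2.
Proof.
move=> ab; rewrite (pr_indep lawP (local_cut N a) (local_cut N b) (@dep_cut N a)).
  by rewrite !(pr_cut _ _ _ (_ : int)).
apply: depends_sub (@dep_cut N b) => e; rewrite /inside /=; lia.
Qed.

(** [D ^ (1 - s)] exceeds any constant for large [D]. The 146 is that of [sum_jumps], and [44 D]
    bounds [(N + a - 1) / (N - 1)] for the windows chosen below. *)
Lemma cut_growth_rate (s : R) : s < 1 -> exists D : nat, (0 < D)%N /\
  2 <= D%:R * expR (- (s * ln (44 * D%:R) + beta%:num * 146)).
Proof.
move=> s1; have [D hD] := exists_natr_gt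
  (expR ((ln 2 + s * ln 44 + beta%:num * 146) / (1 - s))).
have D0 : 0 < D%:R :> R by apply: lt_trans hD; exact: expR_gt0.
exists D; split; first by rewrite -(ltr0n R).
have : (ln 2 + s * ln 44 + beta%:num * 146) / (1 - s) < ln (D%:R : R).
  by rewrite -ltr_expR lnK.
rewrite ltr_pdivrMr ?subr_gt0// => h.
rewrite -{1}(@lnK _ (2 : R)) ?posrE// -{1}(@lnK _ (D%:R : R)) ?posrE// -expRD.
by rewrite ler_expR lnM ?posrE//; lra.
Qed.

(** The [2 D] windows of length [3 N] tile [[15 D N, 21 D N[], that is [[5 M / 4, 7 M / 4[]: a
    margin [M / 4] is left on each side of the middle third [[M, 2 M[]. As [N + a <= 22 D N] and
    [N <= 2 (N - 1)], the ratio is at most [44 D]. *)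
Lemma subwindow_arith N m D k : (0 < m)%N -> (4 * m + 2 <= N)%N -> (k < 2 * D)%N ->
  let M := (12 * D * N)%N in let a := ((15 * D + 3 * k) * N)%N in
  [/\ [/\ (1 < N - 2 * m)%N, (N - 2 * m + 2 * m <= N)%N & (N <= 2 * (N - 2 * m))%N],
      [/\ (M <= a + N)%N, (a + 2 * N <= 2 * M)%N & (M + 4 * (M + m) <= 4 * (a + N))%N],
      (M + 4 * (a + 2 * N + m) <= 8 * M)%N &
      ((N + a).-1 <= 44 * D * N.-1)%N].
Proof.
move=> m0 mN kD M a; have : (k * N + N <= 2 * (D * N))%N.
  by rewrite -mulSnr mulnA leq_mul2r kD orbT.
have : (6 * D <= D * N)%N by rewrite mulnC leq_mul2l; lia.
have -> : (44 * D * N.-1 = 44 * (D * N) - 44 * D)%N.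
  by rewrite -subn1 mulnBr muln1 mulnA.
have -> : M = (12 * (D * N))%N by rewrite /M mulnA.
have -> : a = (15 * (D * N) + 3 * (k * N))%N by rewrite /a mulnDl !mulnA.
clear M a; move: (D * N)%N (k * N)%N => x y h1 h2.
by split; [split; lia|split; lia|lia|lia].
Qed.

(** Each of the [2 D] windows is cut together with the large one with probability at least [f * c],
    where [D * c >= 2]. Distinct windows are disjoint, so a pair is cut with probability [f ^ 2].
    Bonferroni's inequality gives [4 f - 4 D ^ 2 f ^ 2]. *)
Lemma cut_growth m (q : R) : (0 < m)%N -> Theta m ^+ 2 < q ->
  beta%:num * q < 1 ->
  exists D N0 : nat, [/\ (0 < D)%N, (1 < N0)%N & forall N, (N0 <= N)%N ->
    Pr (cut N 0) <= (4 * D%:R ^+ 2)^-1 ->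
    3 * Pr (cut N 0) <= Pr (cut (12 * D * N) 0)].
Proof.
move=> m0 hq s1; have [D [D0 hD]] := cut_growth_rate s1.
(* With [M = 12 D N] and [l >= N / 2], the long-edge error is at most [2 * 6 m * 12 D N * 4 beta / N
   ^ 2 = 576 m D beta / N], which has to fit below [q - Theta m ^ 2]. *)
have [n0 hn0] := exists_natr_gt (576 * m%:R * D%:R * beta%:num / (q - Theta m ^+ 2)).
exists D, (n0 + 4 * m).+2; split => // N NN f_small.
have mN : (4 * m + 2 <= N)%N by lia.
have n0N : (n0 <= N)%N by lia.
have ar k := @subwindow_arith N m D k m0 mN.
have N1 : (1 < N)%N by lia.
have kD0 : (0 < 2 * D)%N by lia.
have [[l1 lN Nl] _ _ _] := ar 0%N kD0.
clear NN mN kD0.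
set f := Pr (cut N 0) in f_small *.
have [M ME] : exists M, M = (12 * D * N)%N by exists (12 * D * N)%N.
rewrite -ME in ar *.
move: (N - 2 * m)%N l1 lN Nl ar => l l1 lN Nl ar.
have N0 : 0 < N%:R :> R by rewrite ltr0n ltnW.
have l0 : 0 < l%:R :> R by rewrite ltr0n ltnW.
have q0 : 0 <= q by apply: ltW; apply: le_lt_trans hq; exact: sqr_ge0.
have hl : Theta m ^+ 2 + 2 * ((6 * m * M)%:R * (beta%:num / l%:R ^+ 2)) <= q.
  rewrite -lerBrDl; have : 576 * m%:R * D%:R * beta%:num / N%:R <= q - Theta m ^+ 2.
    rewrite ler_pdivrMr// -ler_pdivrMl ?subr_gt0// mulrC.
    by apply: le_trans (ltW hn0) _; rewrite ler_nat.
  apply: le_trans; rewrite ME !natrM.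
  have lN' : N%:R <= 2 * l%:R :> R by rewrite -natrM ler_nat.
  have -> : 576 * m%:R * D%:R * beta%:num / N%:R =
      2 * (6 * m%:R * (12 * D%:R * N%:R) * (beta%:num / (N%:R / 2) ^+ 2)) :> R.
    by field; rewrite gt_eqF.
  rewrite ler_wpM2l// ler_wpM2l// ?mulr_ge0// ler_wpM2l// lef_pV2 ?posrE ?exprn_gt0//.
    by rewrite lerXn2r ?nnegrE ?divr_ge0// ler_pdivrMr// mulrC.
  by rewrite divr_gt0.
pose a k := ((15 * D + 3 * k) * N)%N.
pose c : R := expR (- (beta%:num * q * ln (44 * D%:R) + beta%:num * 146)).
have growth k : (k < 2 * D)%N -> f * c <= Pr (fun w => cut N (a k)%:Z w && cut M 0 w).
  move=> kD; have [_ [h1 h2 h3] h4 h5] := ar k kD.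
  apply: (le_trans _ (@pr_cut_up _ beta lambda N M m (a k) l q _ _ _ _ _ _ _ _ _));
    rewrite ?hl //.
  rewrite ler_wpM2l ?pr_ge0// ler_expR lerN2 mulrDr lerD2r -mulrA.
  rewrite ler_wpM2l// ler_wpM2l//.
  have Na : (0 < (N + a k).-1)%N by rewrite -subn1 subn_gt0 ltn_addr.
  have N1' : (0 < N.-1)%N by rewrite -subn1 subn_gt0.
  have := @expR_harmonic R N (a k) N1.
  rewrite -(@ler_ln R) ?posrE ?expR_gt0 ?divr_gt0 ?ltr0n//.
  rewrite expRK lerNr => /le_trans; apply.
  rewrite -lnV ?posrE ?divr_gt0 ?ltr0n//.
  rewrite ler_ln ?posrE ?invr_gt0 ?divr_gt0 ?mulr_gt0 ?ltr0n//.
  by rewrite invf_div ler_pdivrMr ?ltr0n// -!natrM ler_nat.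
pose H k w := cut N (a k)%:Z w && cut M 0 w.
have lH k : local (H k) by apply: (local2 andb); exact: local_cut.
have Ha k k' : (k < k')%N -> ((a k)%:Z + (3 * N)%:Z <= (a k')%:Z).
  rewrite /a => kk'; have : (k * N + N <= k' * N)%N by rewrite -mulSnr leq_mul2r kk' orbT.
  have e j : ((15 * D + 3 * j) * N = 15 * (D * N) + 3 * (j * N))%N.
    by rewrite mulnDl !mulnA.
  by rewrite !e; move: (k * N)%N (k' * N)%N (D * N)%N; clear; lia.
have hH := @pr_has_ge _ _ _ _ p01 lawP _ (index_iota 0 (2 * D)) H (f * c) (f ^+ 2)
  (sqr_ge0 _) (iota_uniq _ _) (fun k _ => lH k) _ _.
have : Pr (fun w => has (H^~ w) (index_iota 0 (2 * D))) <= Pr (cut M 0).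
  apply: pr_le; [exact: local_has|exact: local_cut|].
  by move=> w /hasP[k _ /andP[]].
apply: le_trans; apply: le_trans (hH _ _); last 2 first.
- by move=> k; rewrite mem_index_iota; exact: growth.
- move=> k k'; rewrite !mem_index_iota => kD k'D kk'.
  rewrite -(@pr_cut_cut N (a k)%:Z (a k')%:Z); last first.
    by case: (ltngtP k k') kk' => // kk' _; [left|right]; exact: Ha.
  apply: pr_le; [by apply: (local2 andb)| |].
    by apply: (local2 andb); exact: local_cut.
  by move=> w /andP[/andP[-> _] /andP[->]].
rewrite size_iota subn0; move: hD f_small; rewrite -/c; set d : R := D%:R => hD f_small.
have f0 : 0 <= f by exact: pr_ge0.
have d0 : 0 < d by rewrite ltr0n.
have fd : 4 * d ^+ 2 * f <= 1.
  by rewrite -ler_pdivlMl ?mulr1 ?mulr_gt0 ?exprn_gt0.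
rewrite natrM -/d; have h1 : f * 2 <= f * (d * c) by rewrite ler_wpM2l.
have h2 : f * (4 * d ^+ 2 * f) <= f * 1 by rewrite ler_wpM2l.
clear -h1 h2; lra.
Qed.

(** Otherwise [cut_growth] would apply at all scales from some point on. The probability, positive
    at the start, would grow without bound along them. *)
Lemma cut_often m (q : R) : (0 < m)%N -> Theta m ^+ 2 < q ->
  beta%:num * q < 1 ->
  exists2 c : R, 0 < c & forall n, exists2 N, (n <= N)%N & c <= Pr (cut N 0).
Proof.
move=> m0 hq s1; have [D [N0 [D0 N01 grow]]] := cut_growth m0 hq s1.
exists (4 * D%:R ^+ 2)^-1; first by rewrite invr_gt0 mulr_gt0 ?exprn_gt0 ?ltr0n.
move=> n; apply: contrapT => hn.
pose N k := iter k (fun x => 12 * D * x)%N (n + N0)%N.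
have Nn k : (n + N0 <= N k)%N.
  by elim: k => //= k IH; apply: (leq_trans IH); rewrite -/(N k); nia.
have small k : Pr (cut (N k) 0) <= (4 * D%:R ^+ 2)^-1.
  apply: ltW; rewrite ltNge; apply/negP => h; apply: hn; exists (N k) => //.
  by have := Nn k; lia.
(* Linear growth is enough to exceed 1. *)
have big k : k.+1%:R * Pr (cut (N 0) 0) <= Pr (cut (N k) 0).
  have f0 := pr_ge0 P (cut (N 0) 0).
  elim: k => [|k IH]; first by rewrite mul1r.
  have NS : N k.+1 = (12 * D * N k)%N by [].
  have Nk : (N0 <= N k)%N by apply: leq_trans (Nn k); exact: leq_addl.
  rewrite NS; apply: le_trans (grow (N k) Nk (small k)).
  move: IH; rewrite -!natr1; have : 0 <= k%:R :> R by [].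
  clear -f0; move: (Pr _) (Pr _) f0 => x y x0 k0; nra.
have f0 : 0 < Pr (cut (N 0) 0) by apply: pr_cut_gt0; rewrite /= addn_gt0 (ltnW N01) orbT.
have [k hk] := exists_natr_gt (Pr (cut (N 0) 0))^-1.
have : 1 < Pr (cut (N k) 0).
  apply: lt_le_trans (big k).
  rewrite -ltr_pdivrMr// div1r; apply: (lt_trans hk); by rewrite ltr_nat.
by rewrite ltNge pr_le1//; exact: local_cut.
Qed.

End growth.

(** * Discontinuity *)

Section quiet.
Context {R : realType} (beta lambda : {posnum R}).
Local Notation P := (percolation_law beta lambda).
Local Notation Pr := (pr P).
Local Notation lawP := (percolation_lawP beta lambda).
Local Notation p01 := (@edge_prob01 R beta lambda).
Implicit Types (w : edge -> bool) (g : rel int) (src : seq int) (A B N M : nat).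

Definition closed g i j w : bool := g i j ==> ~~ adjacent w i j.

(** The upper cutoff [B] on the lengths makes the event local; [g] selects the edges on which it may
    depend. *)
Definition quiet g src A B w : bool :=
  all (fun z : int * nat => closed g z.1 (z.1 + z.2%:Z) w && closed g z.1 (z.1 - z.2%:Z) w)
    [seq (i, d) | i <- src, d <- index_iota A B].

Lemma local_closed g i j : local (closed g i j).
Proof. by apply: local1; apply: local1; exact: local_adjacent. Qed.

Lemma decreasing_closed g i j : decreasing (closed g i j).
Proof.
by move=> w w' ww'; rewrite /closed; case: (g i j) => //=; exact: decreasing_nonadjacent.
Qed.

Lemma local_quiet g src A B : local (quiet g src A B).
Proof.
by apply: local_all => z _; apply: (local2 andb); exact: local_closed.
Qed.

Lemma decreasing_quiet g src A B : decreasing (quiet g src A B).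
Proof.
by apply: decreasing_all => z _; apply: decreasing_and; exact: decreasing_closed.
Qed.

Lemma quietP g src A B w i j : quiet g src A B w -> i \in src ->
  A%:Z <= `|i - j| < B%:Z -> g i j -> ~~ adjacent w i j.
Proof.
move=> /allP h isrc ijAB gij; have d_in : `|i - j|%N \in index_iota A B.
  by rewrite mem_index_iota; lia.
have /= := h _ (allpairs_f (fun i d => (i, d)) isrc d_in).
move=> /andP[]; rewrite /closed; have [ij|ji] := leP i j.
  have -> : i + (absz (i - j))%:Z = j by lia.
  by rewrite gij /= => ->.
have -> : i - (absz (i - j))%:Z = j by lia.
by rewrite gij /= => _ ->.
Qed.

Lemma dep_quiet g src A B D : (forall i j, g i j -> D i j && D j i) ->
  dep D (quiet g src A B).
Proof.
move=> gD; apply: depends_all => z _; apply: (depends2 andb);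
  move=> w w' ww'; rewrite /closed; case gij : (g _ _) => //=; congr (~~ _);
  apply: (@dep_adjacent D) ww'; have /andP[h1 h2] := gD _ _ gij; by rewrite ?h1 ?h2.
Qed.

Lemma pr_closed g i j d : (1 < d)%N -> d%:Z = `|i - j| ->
  expR (- (beta%:num / d%:R ^+ 2)) <= Pr (closed g i j).
Proof.
move=> d1 dij; rewrite -(pr_nonadjacent _ lambda d1 dij); apply: pr_le.
- by apply: local1; exact: local_adjacent.
- exact: local_closed.
- by move=> w nij; rewrite /closed nij implybT.
Qed.

(** A point has two edges of each length [d], each closed with probability [exp (- beta / d ^ 2)].
    An edge may be listed from both endpoints, hence Harris' inequality instead of independence. *)
Lemma pr_quiet g src A B : (1 < A)%N ->
  expR (- (2 * beta%:num * (size src)%:R / A.-1%:R)) <= Pr (quiet g src A B).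
Proof.
move=> A1; have b0 : 0 < beta%:num by [].
apply: (le_trans _ (pr_harris_all p01 lawP _ _)); last 2 first.
- by move=> z _; apply: (local2 andb); exact: local_closed.
- by move=> z _; apply: decreasing_and; exact: decreasing_closed.
apply: (@le_trans _ _ (\prod_(z <- [seq (i, d) | i <- src, d <- index_iota A B])
    expR (- (2 * beta%:num * (z.2%:R ^+ 2)^-1)))); last first.
  rewrite [leLHS]big_seq [leRHS]big_seq; apply: ler_prod => -[i d].
  move=> /allpairsP[[i' d'] /= [_ + [_ ->]]]; rewrite mem_index_iota => /andP[Ad _].
  rewrite expR_ge0 /= -mulrA mulrDl mul1r opprD expRD.
  have d1 : (1 < d')%N by exact: leq_trans Ad.
  apply: le_trans (pr_harris p01 lawP _ _ _ _);
    [|exact: local_closed|exact: local_closed|exact: decreasing_closed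
    |exact: decreasing_closed].
  by apply: ler_pM; rewrite ?expR_ge0//; apply: pr_closed => //; lia.
rewrite -expR_sum ler_expR sumrN lerN2 big_allpairs_dep /=.
apply: (@le_trans _ _ (\sum_(i <- src) 2 * beta%:num * (A.-1%:R)^-1)).
  by apply: ler_sum => i _; rewrite -mulr_sumr ler_wpM2l// sum_inv_sqr.
rewrite big_const_seq count_predT iter_addr_0 -[leLHS]mulr_natl.
by rewrite le_eqVlt; apply/orP; left; apply/eqP; ring.
Qed.

Lemma pr_not_quiet g src A B : (1 < A)%N ->
  Pr (fun w => ~~ quiet g src A B w) <= 2 * beta%:num * (size src)%:R / A.-1%:R.
Proof.
move=> A1; rewrite (prN lawP); last exact: local_quiet.
rewrite lerBlDr; apply: (@le_trans _ _ (2 * beta%:num * (size src)%:R / A.-1%:R +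
  expR (- (2 * beta%:num * (size src)%:R / A.-1%:R)))).
  have := expR_ge1Dx (- (2 * beta%:num * (size src)%:R / A.-1%:R)); lra.
by rewrite lerD2l pr_quiet.
Qed.

Definition ball_seq N : seq int := [seq t%:Z - N%:Z | t <- iota 1 (2 * N).-1].

Lemma mem_ball_seq N i : (i \in ball_seq N) = (`|i| < N%:Z).
Proof.
apply/mapP/idP => [[t]|iN]; first by rewrite mem_iota => ? ->; lia.
by exists (absz (i + N%:Z)); rewrite ?mem_iota; lia.
Qed.

Lemma size_ball_seq N : (size (ball_seq N))%:R <= 2 * N%:R :> R.
Proof. by rewrite size_map size_iota -natrM ler_nat leq_pred. Qed.

Definition touch M : rel int := fun i j => (`|i| < M%:Z) || (`|j| < M%:Z).

Local Notation anyedge := (fun _ _ : int => true).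

(** Windows without crossing on both sides of the origin, and no edge of length in [[N, T[] to jump
    over them. Only edges that do not touch []-M, M[] are involved, for independence from what
    happens there. *)
Definition barrier M N T w : bool :=
  [&& cut N N%:Z w, cut N (- (4 * N)%:Z) w & quiet (fun i j => ~~ touch M i j) (ball_seq (4 * N)) N T w].

Lemma local_barrier M N T : local (barrier M N T).
Proof.
apply: (local2 andb); first exact: local_cut.
by apply: (local2 andb); [exact: local_cut|exact: local_quiet].
Qed.

Lemma dep_barrier M N T : (M <= N)%N -> dep (fun i j => ~~ touch M i j) (barrier M N T).
Proof.
move=> MN; apply: (depends2 andb).
  by apply: depends_sub (@dep_cut N _) => e; rewrite /inside /touch /=; lia.
apply: (depends2 andb).
  by apply: depends_sub (@dep_cut N _) => e; rewrite /inside /touch /=; lia.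
by apply: (@dep_quiet _ _ _ _ (fun i j => ~~ touch M i j)) => i j; rewrite /touch; lia.
Qed.

(** The ball of radius [4 N] has fewer than [8 N] points and [N <= 2 (N - 1)], so the exponent in
    [pr_quiet] is at most [32 beta]. Its boundedness at all scales is what matters. *)
Lemma pr_barrier M N T : (1 < N)%N ->
  Pr (cut N 0) ^+ 2 * expR (- (32 * beta%:num)) <= Pr (barrier M N T).
Proof.
move=> N1; rewrite expr2 -mulrA.
apply: le_trans (pr_harris p01 lawP _ _ _ _).
- rewrite pr_cut ler_wpM2l ?pr_ge0//.
  apply: le_trans (pr_harris p01 lawP _ _ _ _).
  + rewrite pr_cut ler_wpM2l ?pr_ge0//; apply: le_trans (pr_quiet _ _ _ N1).
    rewrite ler_expR lerN2 ler_pdivrMr ?ltr0n; last by lia.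
    have := size_ball_seq (4 * N); rewrite natrM.
    have : N%:R <= 2 * N.-1%:R :> R by rewrite -natrM ler_nat; lia.
    have : 0 < beta%:num by [].
    move: (N.-1%:R) (N%:R) (size _)%:R (beta%:num) => x y z b b0 xy zy.
    have -> : 2 * b * z = b * (2 * z) by ring.
    have -> : 32 * b * x = b * (32 * x) by ring.
    by rewrite ler_wpM2l; lra.
  + exact: local_cut.
  + exact: local_quiet.
  + exact: decreasing_cut.
  + exact: decreasing_quiet.
- exact: local_cut.
- by apply: (local2 andb); [exact: local_cut|exact: local_quiet].
- exact: decreasing_cut.
- by apply: decreasing_and; [exact: decreasing_cut|exact: decreasing_quiet].
Qed.

Lemma quiet_short M N T w i j : (M <= 4 * N)%N ->
  quiet anyedge (ball_seq M) N T w ->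
  (forall T', quiet anyedge (ball_seq (4 * N)) T T' w) ->
  adjacent w i j ->
  touch M i j \/ (`|i| < (4 * N)%:Z) && quiet (fun i j => ~~ touch M i j) (ball_seq (4 * N)) N T w ->
  `|i| < (4 * N)%:Z -> shorter N i j.
Proof.
move=> MN q1 q2 aij tij iN; rewrite /shorter ltNge; apply/negP => Nij.
move: aij; apply/negP; have [ijT|Tij] := ltP `|i - j| T%:Z; last first.
  apply: (quietP (q2 (absz (i - j)).+1)) => //; first by rewrite mem_ball_seq.
  by lia.
have NijT : N%:Z <= `|i - j| < T%:Z by rewrite Nij.
have [tM|tM] := boolP (touch M i j); last first.
  case: tij => [tM'|/andP[_ q3]]; first by rewrite tM' in tM.
  by apply: (quietP q3) => //; rewrite mem_ball_seq.
have [iM|iM] := ltP `|i| M%:Z.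
  by apply: (quietP q1) => //; rewrite mem_ball_seq.
rewrite adjacentC; apply: (quietP q1) => //; last by rewrite distrC.
by rewrite mem_ball_seq; move: tM; rewrite /touch; lia.
Qed.

(** If the barrier held too, then every open edge from the ball of radius [4 N] would be shorter
    than [N]: the barrier handles lengths below [T] away from []-M, M[], and the two hypotheses
    handle the other edges. Such edges cannot bypass the windows, so the cluster of 0 would stay in
    that ball. *)
Lemma percolates_barrier M N T w : (0 < N)%N -> (M <= N)%N -> percolates w ->
  quiet anyedge (ball_seq M) N T w ->
  (forall T', quiet anyedge (ball_seq (4 * N)) T T' w) ->
  escape (shorter N) M 0 w && ~~ barrier M N T w.
Proof.
move=> N0 MN perc q1 q2; have M4N : (M <= 4 * N)%N by lia.
have farw m : far m w by move: perc; rewrite percolatesE; apply.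
apply/andP; split.
  have [z Mz /connP cz] := farw M.
  have cz' : open_conn (fun i j => true) 0 z w.
    by apply: conn_sub cz => i j ->.
  have : escape (fun i j => true) M 0 w by apply: escape_conn cz' _; lia.
  move=> /asboolP[z' Mz' cz'']; apply/asboolP; exists z' => //.
  apply: conn_sub cz'' => i j /andP[aij /andP[_ iM]]; rewrite aij iM andbT /=.
  apply: (quiet_short M4N q1 q2 aij); last by lia.
  by left; rewrite /touch; lia.
apply/negP => /and3P[cutR cutL q3].
have [z Nz /connP cz] := farw (4 * N)%N.
have cz' : open_conn (fun i j => true) 0 z w.
  by apply: conn_sub cz => i j ->.
have : escape (fun i j => true) (4 * N) 0 w by apply: escape_conn cz' _; lia.
move=> /asboolP[z' zN cz''].
have short : open_conn (shorter N) 0 z' w.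
  apply: conn_sub cz'' => i j /andP[aij /andP[_ iN]]; rewrite aij /=.
  have iN' : `|i| < (4 * N)%:Z by lia.
  by apply: (quiet_short M4N q1 q2 aij) => //; right; rewrite iN' q3.
have [z0|z0] := leP 0 z'.
  move: short; apply/negP; apply: (cut_crossing cutR); [|lia|lia].
  by move=> i j; rewrite /shorter /stay /inside; lia.
move: short; rewrite open_connC; last by move=> i j; rewrite /shorter distrC.
apply/negP; apply: (cut_crossing cutL); [|lia|lia].
by move=> i j; rewrite /shorter /stay /inside; lia.
Qed.


End quiet.

(** * Upper bound on theta and the contradiction *)

Section discontinuity.
Context {R : realType} (beta lambda : {posnum R}).
Local Notation P := (percolation_law beta lambda).
Local Notation Pr := (pr P).
Local Notation lawP := (percolation_lawP beta lambda).
Local Notation anyedge := (fun _ _ : int => true).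
Implicit Types (w : edge -> bool) (src : seq int) (A N M T : nat).

Lemma measurable_pr_le (A B C : set (config edge)) (a b c : R) :
  measurable A -> measurable B -> measurable C ->
  (P A <= a%:E)%E -> (P B <= b%:E)%E -> (P C <= c%:E)%E ->
  (P (A `|` B `|` C) <= (a + b + c)%:E)%E.
Proof.
move=> mA mB mC hA hB hC; rewrite !EFinD.
apply: (le_trans (measureU2 _ _ _)) => //; first exact: measurableU.
apply: leeD => //; apply: (le_trans (measureU2 _ _ _)) => //; exact: leeD.
Qed.

(** The bound of [pr_not_quiet] does not depend on the upper cutoff, so it survives the increasing
    union. *)
Lemma pr_ever_loud src A (x : R) : (1 < A)%N ->
  2 * beta%:num * (size src)%:R / A.-1%:R <= x ->
  (P (\bigcup_B [set w | ~~ quiet anyedge src A B w]) <= x%:E)%E.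
Proof.
move=> A1 hx; pose F B := [set w : config edge | ~~ quiet anyedge src A B w].
have mF B : measurable (F B).
  by apply: (@measurable_local _ (fun w => ~~ quiet anyedge src A B w));
    apply: local1; exact: local_quiet.
have : P (F B) @[B --> \oo] --> P (\bigcup_B F B).
  apply: nondecreasing_cvg_mu => //; first exact: bigcup_measurable.
  move=> B B' BB'; apply/subsetPset => w; apply: contraNN => /allP q.
  apply/allP => -[i d] /allpairsP[[i' d'] /= [isrc + [-> ->]]].
  rewrite mem_index_iota => /andP[Ad dB].
  by apply: (q (i', d')); apply: allpairs_f => //; rewrite mem_index_iota Ad (leq_trans dB).
move=> cv; rewrite -(cvg_lim _ cv)//; apply: lime_le; first by apply/cvg_ex; eexists; exact: cv.
apply: nearW => B; rewrite -EFin_pr; last by apply: local1; exact: local_quiet.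
by rewrite lee_fin; apply: le_trans hx; exact: pr_not_quiet.
Qed.

(** [x] and [y] pay for long edges at []-M, M[] and for edges longer than [T]. Otherwise the cluster
    of 0 reaches distance [M] and there is no barrier. The former depends on edges that touch []-M,
    M[], the latter on the others, so the probabilities multiply. *)
Lemma theta_le M N T (x y : R) : (0 < M)%N -> (1 < N)%N -> (M <= N)%N -> (1 < T)%N ->
  4 * beta%:num * M%:R / N.-1%:R <= x -> 16 * beta%:num * N%:R / T.-1%:R <= y ->
  theta beta lambda <= x + y +
    Theta beta lambda M * (1 - Pr (cut N 0) ^+ 2 * expR (- (32 * beta%:num))).
Proof.
move=> M0 N1 MN T1 hx hy.
have N0 : (0 < N)%N by exact: ltnW.
pose A1 := [set w : config edge | ~~ quiet anyedge (ball_seq M) N T w].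
pose A2 : set (config edge) :=
  \bigcup_T' [set w | ~~ quiet anyedge (ball_seq (4 * N)) T T' w].
pose Q w := escape (shorter N) M 0 w && ~~ barrier M N T w.
have lQ : local Q.
  apply: (local2 (fun a b => a && ~~ b)); first exact: local_escape_shorter.
  exact: local_barrier.
have lq src A B : local (fun w => ~~ quiet anyedge src A B w).
  by apply: local1; exact: local_quiet.
have mA1 : measurable A1 by exact: measurable_local (lq _ _ _).
have mA2 : measurable A2.
  by apply: bigcup_measurable => T' _; exact: measurable_local (lq _ _ _).
have mQ : measurable [set w : config edge | Q w] by exact: measurable_local.
rewrite -lee_fin /theta fineK ?fin_num_measure//; last exact: measurable_percolates.
apply: (@le_trans _ _ (P (A1 `|` A2 `|` [set w | Q w]))).
  apply: le_measure; rewrite ?inE.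
  - exact: measurable_percolates.
  - by apply: measurableU => //; exact: measurableU.
  move=> w perc; have [q1|q1] := boolP (quiet anyedge (ball_seq M) N T w); last first.
    by left; left.
  have [q2|nq2] := pselect (forall T', quiet anyedge (ball_seq (4 * N)) T T' w).
    by right; exact: percolates_barrier.
  left; right; apply: contrapT => h; apply: nq2 => T'; apply: contrapT => /negP hT'.
  by apply: h; exists T'.
apply: measurable_pr_le => //.
- rewrite -(EFin_pr _ (lq _ _ _)) lee_fin; apply: le_trans hx.
  apply: (le_trans (pr_not_quiet _ _ _ _ _ N1)); rewrite ler_wpM2r ?invr_ge0//.
  have -> : 4 * beta%:num * M%:R = 2 * beta%:num * (2 * M%:R) :> R by ring.
  by rewrite ler_wpM2l// size_ball_seq.
- apply: pr_ever_loud => //; apply: le_trans hy; rewrite ler_wpM2r ?invr_ge0//.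
  have -> : 16 * beta%:num * N%:R = 2 * beta%:num * (2 * (4 * N)%:R) :> R.
    by rewrite natrM; ring.
  by rewrite ler_wpM2l// size_ball_seq.
rewrite -(EFin_pr _ lQ) lee_fin /Q.
rewrite (@pr_indep _ _ _ _ lawP (fun e => touch M (val e).1 (val e).2)).
- rewrite (prN lawP); last exact: local_barrier.
  have h1 := pr_escape_shorter beta lambda N M 0.
  have h2 := pr_barrier beta lambda M T N1.
  have h3 : Pr (barrier M N T) <= 1 by apply: pr_le1; exact: local_barrier.
  apply: ler_pM => //; rewrite ?pr_ge0//; lra.
- exact: local_escape_shorter.
- by apply: local1; exact: local_barrier.
- apply: (@dep_escape (touch M)) => i j _; rewrite /touch; lia.
- by apply: depends1; exact: dep_barrier.
Qed.

Theorem beta_theta_sqr_ge1 : 0 < theta beta lambda ->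
  1 <= beta%:num * theta beta lambda ^+ 2.
Proof.
set t := theta beta lambda => t0; rewrite leNgt; apply/negP => bt.
have b0 : 0 < beta%:num by [].
have t_sqrt : t < Num.sqrt (beta%:num^-1).
  rewrite -(@ger0_norm _ t) ?ltW// -sqrtr_sqr ltr_sqrt ?invr_gt0//.
  by rewrite -[X in _ < X]mul1r ltr_pdivlMr// mulrC.
have [m m0] : exists2 m : nat, (0 < m)%N &
    Theta beta lambda m < t + (Num.sqrt (beta%:num^-1) - t).
  by apply: theta_approx; rewrite subr_gt0.
rewrite addrC subrK => Tm.
have T0 : 0 <= Theta beta lambda m by exact: fine_ge0.
have Tb : Theta beta lambda m ^+ 2 < beta%:num^-1.
  rewrite -[ltRHS]sqr_sqrtr ?invr_ge0 ?ltW//.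
  by rewrite ltrXn2r ?nnegrE// ?sqrtr_ge0//.
pose q : R := (Theta beta lambda m ^+ 2 + beta%:num^-1) / 2.
have [q1 q2] : Theta beta lambda m ^+ 2 < q /\ q < beta%:num^-1 by rewrite /q; lra.
have bq : beta%:num * q < 1 by rewrite mulrC -ltr_pdivlMr// div1r.
have [c c0 hc] := cut_often m0 q1 bq.
pose d := c ^+ 2 * expR (- (32 * beta%:num)).
have d0 : 0 < d by rewrite mulr_gt0 ?exprn_gt0 ?expR_gt0.
(* With [4 e = t d], the final bound [2 e + (t + e) (1 - d)] equals [t - e - e d], which is less
   than [t]. *)
pose e := t * d / 4.
have e0 : 0 < e by rewrite divr_gt0 ?mulr_gt0.
have [M M0 hM] := theta_approx beta lambda e0.
have [n hn] := exists_natr_gt (4 * beta%:num * M%:R / e).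
(* The order of the choices matters: [M] for [Theta M], then [N] large with respect to [M] at a
   scale where cuts are likely, then the length cutoff [k.+2] large with respect to [N]. *)
have [N Nn cN] := hc (n + M + 2)%N.
have [[nN NN0] [MN N1]] :
    ((n <= N.-1)%N /\ (0 < N.-1)%N) /\ ((M <= N)%N /\ (1 < N)%N).
  by clear -Nn; split; split; lia.
have [k hk] := exists_natr_gt (16 * beta%:num * N%:R / e).
have hx : 4 * beta%:num * M%:R / N.-1%:R <= e.
  rewrite ler_pdivrMr ?ltr0n// -ler_pdivrMl// mulrC.
  by apply: le_trans (ltW hn) _; rewrite ler_nat.
have hy : 16 * beta%:num * N%:R / k.+2.-1%:R <= e.
  rewrite ler_pdivrMr ?ltr0n// -ler_pdivrMl// mulrC.
  by apply: le_trans (ltW hk) _; rewrite ler_nat.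
have := theta_le M0 N1 MN (isT : (1 < k.+2)%N) hx hy.
rewrite -/t; set f := Pr (cut N 0) in cN *.
have f1 : f <= 1 by apply: pr_le1; exact: local_cut.
have fd : d <= f ^+ 2 * expR (- (32 * beta%:num)).
  by rewrite /d ler_wpM2r ?expR_ge0// lerXn2r ?nnegrE ?(ltW c0)// (le_trans (ltW c0)).
have fd1 : f ^+ 2 * expR (- (32 * beta%:num)) <= 1.
  have f0 : 0 <= f by exact: pr_ge0.
  apply: mulr_ile1; rewrite ?expR_ge0 ?exprn_ge0 ?exprn_ile1//.
have TM0 : 0 <= Theta beta lambda M by exact: fine_ge0.
have ed : 4 * e = t * d by rewrite /e; field.
move: hM fd fd1 TM0; rewrite -/t; move: (_ * expR _) (Theta _ _ _) => g T hT dg g1 T00.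
have h1 : T * (1 - g) <= (t + e) * (1 - d).
  by apply: ler_pM => //; lra.
nra.
Qed.

End discontinuity.

(** * Renormalization *)

Section blocks.
Context {R : realType}.
Implicit Types (w : edge -> bool) (V : rel int) (a c x y : int) (h i j k n : nat) (t : R).

Definition cnt V c n x w : nat :=
  count (fun j => open_conn V x (c + j%:Z) w) (iota 0 n).

Lemma cntD V c m n x w : cnt V c (m + n) x w = (cnt V c m x w + cnt V (c + m%:Z) n x w)%N.
Proof.
rewrite /cnt iotaD count_cat add0n; congr addn.
rewrite -[X in iota X _]addn0 iotaDl count_map; apply: eq_count => j /=.
by rewrite PoszD addrA.
Qed.

Lemma cnt_sub V c m x w c' n : c' <= c -> c + m%:Z <= c' + n%:Z ->
  (cnt V c m x w <= cnt V c' n x w)%N.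
Proof.
move=> c'c mn; pose d := absz (c - c')%R.
pose d' := absz (c' + n%:Z - (c + m%:Z))%R.
have -> : n = (d + (m + d'))%N by rewrite /d /d'; lia.
rewrite !cntD; have -> : c' + d%:Z = c by rewrite /d; lia.
by rewrite addnCA leq_addr.
Qed.

Lemma cnt_le V c n x w : (cnt V c n x w <= n)%N.
Proof. by rewrite /cnt -[leqRHS](size_iota 0) count_size. Qed.

Lemma cnt_conn (V V' : rel int) c n x y w : subrel V V' ->
  open_conn V' y x w -> (cnt V c n x w <= cnt V' c n y w)%N.
Proof.
move=> VV' yx; apply: sub_count => j xj; apply: conn_trans yx _.
exact: open_conn_sub xj.
Qed.

Lemma cnt_mul V c h u x w (T : R) :
  (forall a : nat, (a < u)%N -> T <= (cnt V (c + (a * h)%:Z) h x w)%:R) ->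
  u%:R * T <= (cnt V c (u * h) x w)%:R.
Proof.
elim: u => [|u IH] hT; first by rewrite mul0r.
rewrite mulSnr cntD natrD -natr1 mulrDl mul1r lerD ?hT ?ltnSn//.
by apply: IH => a au; apply: hT; exact: ltnW.
Qed.

Lemma cnt_meet V c n x y w : symmetric V -> (n < cnt V c n x w + cnt V c n y w)%N ->
  open_conn V x y w.
Proof.
move=> VC; set p := (fun j : nat => open_conn V x (c + j%:Z) w).
set q := (fun j : nat => open_conn V y (c + j%:Z) w).
rewrite /cnt -/p -/q -count_predUI => big.
have : has (predI p q) (iota 0 n).
  rewrite has_count; have := count_size (predU p q) (iota 0 n).
  rewrite size_iota; move: big; move: (count _ _) (count _ _) => k l; lia.
move=> /hasP[j _ /andP[xj yj]]; apply: conn_trans xj _.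
by move: yj; rewrite /q open_connC.
Qed.

Definition good t a h w : bool :=
  `[< exists2 x, a <= x < a + h%:Z & t * h%:R <= (cnt (inside a h) a h x w)%:R >].

Lemma dep_cnt a h c n x : dep (inside a h) (cnt (inside a h) c n x).
Proof.
move=> w w' ww'; apply: eq_count => j.
apply: (dep_open_conn _ _ _ ww') => k l _.
by rewrite [X in _ || X]insideC orbb.
Qed.

Lemma dep_good t a h : dep (inside a h) (good t a h).
Proof.
move=> w w' ww'; congr (`[< _ >]); apply: propext.
have h' x := @dep_cnt a h a h x _ _ ww'.
by split => -[x xa hx]; exists x => //; move: hx; rewrite h'.
Qed.

Lemma good_shift t a h w : good t 0 h (w \o shift_edge a) = good t a h w.
Proof.
have hc x c : cnt (inside 0 h) c h x (w \o shift_edge a) =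
    cnt (inside a h) (c + a) h (x + a) w.
  apply: eq_count => j; rewrite addrAC; apply: open_conn_shift => k l.
  by rewrite /inside; lia.
congr (`[< _ >]); apply: propext; split => -[x xa hx].
  by exists (x + a); [lia|move: hx; rewrite hc add0r].
by exists (x - a); [lia|rewrite hc add0r subrK].
Qed.

(* In the run of [n] overlapping blocks of length [2h] starting at [o], the
   cluster of [x] is dense in every block. *)
Definition rich t o n h x w : bool :=
  [forall j : 'I_n, t * (2 * h)%:R <=
    (cnt (inside o (n.+1 * h)) (o + (j * h)%:Z) (2 * h) x w)%:R].

Lemma richP t o n h x w : reflect
  (forall j, (j < n)%N ->
    t * (2 * h)%:R <= (cnt (inside o (n.+1 * h)) (o + (j * h)%:Z) (2 * h) x w)%:R)
  (rich t o n h x w).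
Proof.
apply: (iffP forallP) => H j; last exact: H.
by move=> jn; exact: (H (Ordinal jn)).
Qed.

Lemma dep_rich t o n h x : dep (inside o (n.+1 * h)) (rich t o n h x).
Proof.
move=> w w' ww'; apply: eq_forallb => j.
by rewrite (@dep_cnt _ _ _ _ _ w w' ww').
Qed.

Lemma sub_inside a h c n : c <= a -> a + h%:Z <= c + n%:Z -> subrel (inside a h) (inside c n).
Proof. by move=> ca hn k l; rewrite /inside; lia. Qed.

Lemma rich_conn t o n h x y w : open_conn (inside o (n.+1 * h)) y x w ->
  rich t o n h x w -> rich t o n h y w.
Proof.
move=> yx /richP H; apply/richP => j jn; apply: le_trans (H j jn) _.
by rewrite ler_nat; apply: cnt_conn yx.
Qed.

(** A cluster with at least [2 t h] points in a block has more than [h / 2] of them in each half, as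
    [t > 3 / 4]. Dense clusters of consecutive blocks thus meet in the common half, and one cluster
    spreads over the run. *)
Lemma good_merge t o n h w : 3 / 4 < t -> (0 < h)%N -> (0 < n)%N ->
  (forall j, (j < n)%N -> good t (o + (j * h)%:Z) (2 * h) w) ->
  exists2 x, o <= x < o + (n.+1 * h)%:Z & rich t o n h x w.
Proof.
move=> t34 h0 n0 gd; set V := inside o (n.+1 * h).
have subV j : (j < n)%N -> subrel (inside (o + (j * h)%:Z) (2 * h)) V.
  move=> jn; have : (j * h + 2 * h <= n.+1 * h)%N by rewrite -mulnDl leq_mul2r; lia.
  by move=> ?; apply: sub_inside; lia.
have dense j : (j < n)%N -> exists2 x, o <= x < o + (n.+1 * h)%:Z &
    t * (2 * h)%:R <= (cnt V (o + (j * h)%:Z) (2 * h) x w)%:R.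
  move=> jn; have /asboolP[x xj hx] := gd j jn; exists x.
    have : (j * h + 2 * h <= n.+1 * h)%N by rewrite -mulnDl leq_mul2r; lia.
    by move=> ?; lia.
  apply: le_trans hx _; rewrite ler_nat; apply: cnt_conn; first exact: subV.
  exact: conn0.
have [x0 x0V hx0] := dense 0%N n0.
exists x0 => //; apply/richP => j.
elim: j => [|j IH] jn; first exact: hx0.
have [y _ hy] := dense j.+1 jn; apply: (le_trans hy); rewrite ler_nat.
apply: cnt_conn => //; apply: (@cnt_meet _ (o + (j.+1 * h)%:Z) h).
  exact: insideC.
rewrite -(ltr_nat R) natrD.
have {}IH := IH (ltnW jn); move: IH hy; rewrite !mul2n -addnn !cntD.
have -> : o + (j * h)%:Z + h%:Z = o + (j.+1 * h)%:Z by rewrite mulSnr PoszD addrA.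
have : (cnt V (o + (j * h)%:Z) h x0 w)%:R <= h%:R :> R by rewrite ler_nat cnt_le.
have : (cnt V (o + (j.+1 * h)%:Z + h%:Z) h y w)%:R <= h%:R :> R by rewrite ler_nat cnt_le.
have : 3 / 4 * (h + h)%:R < t * (h + h)%:R by rewrite ltr_pM2r// ltr0n; lia.
rewrite !natrD; lra.
Qed.

End blocks.

(** * Why a block is bad *)

Section renormalization.
Context {R : realType}.
Implicit Types (w : edge -> bool) (x y : int) (h i j n u v C r : nat) (t : R).

(** Both sides of a gap of length [H] are cut into slabs of length [H], numbered from the gap. Slabs
    [a] and [b] contain at least [(t H) ^ 2] relevant pairs, at distance at most [H (a + b + 3)];
    the powers of [H] cancel, so the bound does not depend on the scale. *)
Lemma sum_dense u v H (p q : nat -> bool) t : 0 <= t -> (0 < H)%N ->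
  (forall a : nat, (a < u)%N -> t * H%:R <= \sum_(a * H <= x < a.+1 * H) (p x)%:R) ->
  (forall b : nat, (b < v)%N -> t * H%:R <= \sum_(b * H <= y < b.+1 * H) (q y)%:R) ->
  t ^+ 2 * \sum_(0 <= a < u) \sum_(0 <= b < v) ((a + b + 3)%:R ^+ 2)^-1 <=
  \sum_(0 <= x < u * H) \sum_(0 <= y < v * H)
    (p x && q y)%:R / (H.+1 + x + y)%:R ^+ 2.
Proof.
move=> t0 H0 hp hq; rewrite big_nat_mul mulr_sumr big_seq [leRHS]big_seq.
apply: ler_sum => a; rewrite mem_index_iota => /andP[_ au].
under [leRHS]eq_bigr do rewrite big_nat_mul.
rewrite exchange_big /= mulr_sumr big_seq [leRHS]big_seq.
apply: ler_sum => b; rewrite mem_index_iota => /andP[_ bv].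
pose D : R := (H%:R * (a + b + 3)%:R) ^+ 2.
have D0 : 0 < D by rewrite exprn_gt0// mulr_gt0 ?ltr0n// addn3.
apply: (@le_trans _ _ (\sum_(a * H <= x < a.+1 * H) \sum_(b * H <= y < b.+1 * H)
   (p x)%:R * (q y)%:R / D)); last first.
  rewrite big_seq [leRHS]big_seq; apply: ler_sum => x; rewrite mem_index_iota => hx.
  rewrite big_seq [leRHS]big_seq; apply: ler_sum => y; rewrite mem_index_iota => hy.
  rewrite -natrM mulnb ler_wpM2l// lef_pV2 ?posrE ?D0 ?exprn_gt0 ?ltr0n// /D -natrM.
  rewrite lerXn2r ?nnegrE// ler_nat.
  have [xa yb] : (x < a * H + H)%N /\ (y < b * H + H)%N by rewrite -!mulSnr; lia.
  have -> : (H * (a + b + 3) = a * H + b * H + 3 * H)%N by ring.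
  lia.
have -> : \sum_(a * H <= x < a.+1 * H) \sum_(b * H <= y < b.+1 * H)
    (p x)%:R * (q y)%:R / D = (\sum_(a * H <= x < a.+1 * H) (p x)%:R) *
    (\sum_(b * H <= y < b.+1 * H) (q y)%:R) / D.
  rewrite big_distrl big_distrl; apply: eq_bigr => x _ /=.
  by rewrite big_distrr big_distrl.
have -> : t ^+ 2 * ((a + b + 3)%:R ^+ 2)^-1 = (t * H%:R) * (t * H%:R) / D.
  have : (a + b + 3)%:R != 0 :> R by rewrite pnatr_eq0 addn3.
  have : H%:R != 0 :> R by rewrite pnatr_eq0 -lt0n.
  rewrite /D; move: ((a + b + 3)%:R : R) (H%:R : R) => z z' z0 z'0.
  by field; rewrite z0 z'0.
rewrite ler_wpM2r ?invr_ge0 ?(ltW D0)//.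
by apply: ler_pM; rewrite ?mulr_ge0//; [exact: hp|exact: hq].
Qed.

(* Pairs of points on the two sides of the block [ih, (i + 2)h[, indexed by
   their distances to it. *)
Definition cross h i i' : seq edge :=
  [seq edge_of ((i * h)%:Z - 1 - k%:Z) (((i + 2) * h)%:Z + j%:Z) |
    k <- index_iota 0 (i./2 * (2 * h)), j <- index_iota 0 (i'./2 * (2 * h))].

Definition rich_ends t h i i' (e : edge) w : bool :=
  rich t 0 i.-1 h (val e).1 w && rich t ((i + 2) * h)%:Z i'.-1 h (val e).2 w.

Definition separated t h i i' w : bool :=
  [&& `[< exists x, rich t 0 i.-1 h x w >],
      `[< exists y, rich t ((i + 2) * h)%:Z i'.-1 h y w >] &
      all (fun e => ~~ (w e && rich_ends t h i i' e w)) (cross h i i')].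

Lemma rich_cnt t (o : int) n h x w u (V : rel int) :
  rich t o n h x w -> (u + u <= n.+1)%N ->
  subrel (inside o (n.+1 * h)) V ->
  u%:R * (t * (2 * h)%:R) <= (cnt V o (u * (2 * h)) x w)%:R.
Proof.
(* Only every other block of the run is used, so that the counted blocks are disjoint. *)
move=> /richP rx un sV; apply: cnt_mul => a au; have an : (a + a < n)%N by lia.
apply: le_trans (rx _ an) _; rewrite ler_nat.
have -> : (a * (2 * h) = (a + a) * h)%N by ring.
by apply: cnt_conn => //; exact: conn0.
Qed.

(** Without two disjoint bad sub-blocks, all sub-blocks disjoint from the first bad one are good and
    merge on either side of it. If one side is shorter than [r] half-blocks, it is dropped; if an
    open edge joins the two rich clusters, they are counted together. Either way at most [r + 2] of
    the [C] units of length [2 h] are lost. *)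
Lemma bad_cases t h C r w : (0 < h)%N -> 3 / 4 < t -> t <= 1 -> (0 < C)%N -> (1 < r)%N ->
  ~~ good (t - (r + 2)%:R / C%:R) 0 (C * (2 * h)) w ->
  (exists i j, [/\ (i + 2 <= j)%N, (j < 2 * C - 1)%N,
     ~~ good t (i * h)%:Z (2 * h) w & ~~ good t (j * h)%:Z (2 * h) w]) \/
  (exists i, [/\ (r <= i)%N, (r + i <= 2 * C - 2)%N,
     ~~ good t (i * h)%:Z (2 * h) w & separated t h i (2 * C - 2 - i) w]).
Proof.
move=> h0 t34 t1 C0 r1 bad; apply: contrapT => /not_orP[nopair nosep].
move: bad; apply/negP; rewrite negbK; set V := inside 0 (C * (2 * h)).
have enough x u : 0 <= x < 0 + (C * (2 * h))%:Z -> (C <= u + r + 2)%N ->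
    u%:R * (t * (2 * h)%:R) <= (cnt V 0 (C * (2 * h)) x w)%:R ->
    good (t - (r + 2)%:R / C%:R) 0 (C * (2 * h)) w.
  move=> xV uC hx; apply/asboolP; exists x => //; apply: le_trans hx.
  rewrite natrM mulrA mulrA ler_wpM2r//.
  have -> : (t - (r + 2)%:R / C%:R) * C%:R = t * C%:R - (r + 2)%:R.
    by field; rewrite pnatr_eq0; lia.
  have : C%:R <= u%:R + (r + 2)%:R :> R by rewrite -natrD ler_nat; lia.
  have : 0 <= (r + 2)%:R :> R by [].
  move: ((r + 2)%:R) (C%:R) (u%:R) => a b c a0 bc; nra.
have C2 : (C * (2 * h) = 2 * C * h)%N by ring.
have [allgood|] := pselect (forall j, (j < 2 * C - 1)%N -> good t (j * h)%:Z (2 * h) w).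
  have n0 : (0 < 2 * C - 1)%N by lia.
  have nS : ((2 * C - 1).+1 = 2 * C)%N by lia.
  have [|x xV rx] := @good_merge R t 0 _ h w t34 h0 n0.
    by move=> j jn; rewrite add0r; exact: allgood.
  apply: (enough x C); [by rewrite C2 -nS|lia|].
  apply: rich_cnt rx _ _; first by lia.
  by rewrite nS -C2.
move=> /existsNP[i0 /not_implyP[i0C /negP badi0]].
have exbad : exists i, (i < 2 * C - 1)%N && ~~ good t (i * h)%:Z (2 * h) w.
  by exists i0; rewrite i0C.
(* The first bad sub-block: everything to its left is good by minimality, everything to its right by
   the absence of a disjoint bad one. *)
case: (ex_minnP exbad) => i /andP[iC badi] imin {i0 i0C badi0 exbad}.
(* The number of half-blocks to the right of the bad sub-block, which itself takes two of the
   [2 C]. *)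
pose i' := (2 * C - 2 - i)%N.
have goodL j : (j < i.-1)%N -> good t (0 + (j * h)%:Z) (2 * h) w.
  move=> ji; rewrite add0r; apply: contrapT => /negP badj.
  have := imin j; rewrite badj andbT; have -> : (j < 2 * C - 1)%N by lia.
  by move=> /(_ isT); lia.
have goodR j : (j < i'.-1)%N -> good t (((i + 2) * h)%:Z + (j * h)%:Z) (2 * h) w.
  move=> ji; apply: contrapT => /negP badj; apply: nopair; exists i, (i + 2 + j)%N.
  split => //; [lia|by rewrite /i' in ji; lia|].
  by rewrite mulnDl PoszD.
have VL : (1 < i)%N -> subrel (inside 0 (i.-1.+1 * h)) V.
  move=> i1; have : (i * h <= 2 * C * h)%N by rewrite leq_mul2r; lia.
  have -> : (i.-1.+1 = i)%N by lia.
  by move=> ?; apply: sub_inside => //; rewrite C2; lia.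
have R2 : (1 < i')%N -> ((i + 2) * h + i'.-1.+1 * h = C * (2 * h))%N.
  move=> i1; rewrite -mulnDl C2; congr (_ * _)%N; rewrite /i' in i1 *; lia.
have VR : (1 < i')%N -> subrel (inside ((i + 2) * h)%:Z (i'.-1.+1 * h)) V.
  by move=> /R2 i1; apply: sub_inside => //; lia.
have halfi : (i./2 + i./2 <= i)%N by lia.
have halfi' : (i'./2 + i'./2 <= i')%N by lia.
have i'E : (i + i' = 2 * C - 2)%N by rewrite /i'; lia.
have cntL x : (1 < i)%N -> rich t 0 i.-1 h x w ->
    (i./2)%:R * (t * (2 * h)%:R) <= (cnt V 0 (i * h) x w)%:R.
  move=> i1 rx; apply: (le_trans (@rich_cnt t 0 i.-1 h x w i./2 V rx _ (VL i1))); first lia.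
  rewrite ler_nat; apply: cnt_sub => //.
  have : ((i./2 + i./2) * h <= i * h)%N by rewrite leq_mul2r halfi orbT.
  have -> : (i./2 * (2 * h) = (i./2 + i./2) * h)%N by ring.
  lia.
have cntR x : (1 < i')%N -> rich t ((i + 2) * h)%:Z i'.-1 h x w ->
    (i'./2)%:R * (t * (2 * h)%:R) <= (cnt V ((i + 2) * h)%:Z (i' * h) x w)%:R.
  move=> i1 rx; apply: (le_trans (@rich_cnt t _ i'.-1 h x w i'./2 V rx _ (VR i1))); first lia.
  rewrite ler_nat; apply: cnt_sub => //.
  have : ((i'./2 + i'./2) * h <= i' * h)%N by rewrite leq_mul2r halfi' orbT.
  have -> : (i'./2 * (2 * h) = (i'./2 + i'./2) * h)%N by ring.
  lia.
have winL : ((i * h) + i' * h + 2 * h = C * (2 * h))%N.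
  by rewrite -!mulnDl C2; congr (_ * _)%N; lia.
have leftx : (1 < i)%N -> exists2 x, 0 <= x < 0 + (C * (2 * h))%:Z & rich t 0 i.-1 h x w.
  move=> i1; have n0 : (0 < i.-1)%N by lia.
  have [x xV rx] := good_merge t34 h0 n0 goodL; exists x => //.
  by move: xV; rewrite (ltn_predK i1); lia.
have rightx : (1 < i')%N -> exists2 x, 0 <= x < 0 + (C * (2 * h))%:Z &
    rich t ((i + 2) * h)%:Z i'.-1 h x w.
  move=> i1; have n0 : (0 < i'.-1)%N by lia.
  have [x xV rx] := good_merge t34 h0 n0 goodR; exists x => //.
  by have := R2 i1; lia.
have [ir|ri] := ltnP i r.
  have [i1|i1] := ltnP 1 i'; last first.
    apply: (enough 0 0%N); [|lia|by rewrite mul0r].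
    by have : (0 < C * (2 * h))%N by rewrite !muln_gt0 C0; lia.
  have [x xV rx] := rightx i1; apply: (enough x i'./2) => //; first by lia.
  apply: le_trans (cntR x i1 rx) _; rewrite ler_nat; apply: cnt_sub => //.
  by rewrite mulnDl; lia.
have [i'r|ri'] := ltnP i' r.
  have i1 : (1 < i)%N by lia.
  have [x xV rx] := leftx i1; apply: (enough x i./2) => //; first by lia.
  apply: le_trans (cntL x i1 rx) _; rewrite ler_nat; apply: cnt_sub => //; lia.
have [i1 i'1] : (1 < i)%N /\ (1 < i')%N by split; lia.
have [x xV rx] := leftx i1; have [y yV ry] := rightx i'1.
have [sep|] := boolP (separated t h i i' w).
  by exfalso; apply: nosep; exists i; split => //; lia.
rewrite /separated; have -> : `[< exists x, rich t 0 i.-1 h x w >].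
  by apply/asboolP; exists x.
have -> : `[< exists y, rich t ((i + 2) * h)%:Z i'.-1 h y w >].
  by apply/asboolP; exists y.
rewrite /= -has_predC => /hasP[e /allpairsP[[x' y'] /= [hx' hy' eE]]].
rewrite negbK /rich_ends => /and3P[we].
set X := (i * h)%:Z - 1 - x'%:Z in eE; set Y := ((i + 2) * h)%:Z + y'%:Z in eE.
have xw : (x' < i * h)%N.
  move: hx'; rewrite mem_index_iota.
  have : ((i./2 + i./2) * h <= i * h)%N by rewrite leq_mul2r halfi orbT.
  have -> : (i./2 * (2 * h) = (i./2 + i./2) * h)%N by ring.
  by move=> H1 /andP[_ H2]; exact: leq_trans H1.
have yw : (y' < i' * h)%N.
  move: hy'; rewrite mem_index_iota.
  have : ((i'./2 + i'./2) * h <= i' * h)%N by rewrite leq_mul2r halfi' orbT.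
  have -> : (i'./2 * (2 * h) = (i'./2 + i'./2) * h)%N by ring.
  by move=> H1 /andP[_ H2]; exact: leq_trans H1.
have h2 : ((i + 2) * h = i * h + 2 * h)%N by rewrite mulnDl.
have [XY XV YV] : [/\ X < Y, 0 <= X < 0 + (C * (2 * h))%:Z &
    0 <= Y < 0 + (C * (2 * h))%:Z].
  rewrite /X /Y h2 -winL; clear -xw yw.
  by move: (i * h)%N (i' * h)%N (2 * h)%N xw yw => a b c xa yb; split; lia.
rewrite eE val_edge_of//= => rX rY.
have cXY : open_conn V X Y w.
  apply: conn1; rewrite adjacentE lt_eqF//= -eE we /V /inside XV; exact: YV.
have Cii' : (C <= i./2 + i'./2 + r + 2)%N by clear -i'E r1; lia.
apply: (enough X (i./2 + i'./2)%N) => //.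
rewrite natrD mulrDl; apply: le_trans (lerD (cntL X i1 rX) (cntR Y i'1 rY)) _.
rewrite -natrD ler_nat.
have cR : (cnt V ((i + 2) * h)%:Z (i' * h) Y w <= cnt V (i * h)%:Z (2 * h + i' * h) X w)%N.
  apply: (leq_trans (@cnt_conn V V _ _ Y X w _ cXY)) => //.
  by apply: cnt_sub; rewrite h2; clear; lia.
apply: (leq_trans (leq_add (leqnn _) cR)); rewrite -[X in cnt V X (2 * h + _)]add0r -cntD.
by apply: cnt_sub => //; rewrite -winL; clear; lia.
Qed.

End renormalization.

(** * Decay and summability of the probability of separation *)

Section tails.
Context {R : realType}.

Lemma ler_sum_nat (F : nat -> R) m n : (m <= n)%N -> (forall i, 0 <= F i) ->
  \sum_(0 <= i < m) F i <= \sum_(0 <= i < n) F i.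
Proof.
by move=> mn F0; rewrite (@big_cat_nat _ _ _ m 0 n)//= lerDl sumr_ge0.
Qed.

Lemma sum_inv_sqr_ge (c n : nat) : (0 < c)%N ->
  (c%:R)^-1 - ((c + n)%:R)^-1 <= \sum_(0 <= b < n) ((c + b)%:R ^+ 2)^-1 :> R.
Proof.
move=> c0; elim: n => [|n IH]; first by rewrite big_geq// addn0 subrr.
rewrite big_nat_recr//= addnS -natr1; have : 0 < (c + n)%:R :> R by rewrite ltr0n addn_gt0 c0.
move: IH; move: (\sum_(_ <= _ < _) _) ((c + n)%:R) => S x IH x0.
have -> : (x ^+ 2)^-1 = x^-1 - (x + 1)^-1 + (x ^+ 2 * (x + 1))^-1.
  by field; rewrite !gt_eqF//; lra.
have : 0 <= (x ^+ 2 * (x + 1))^-1 by rewrite invr_ge0 mulr_ge0 ?sqr_ge0//; lra.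
lra.
Qed.

(** The inner sum is at least [1 / (a + 3) - 1 / (a + n + 3)]. Summed over [a], the first terms
    yield the factor [3 / (n + 3)], and the second ones, at most 1 in total, the factor [exp 1]. *)
Lemma expR_double_sum (n : nat) :
  expR (- \sum_(0 <= a < n) \sum_(0 <= b < n) ((a + b + 3)%:R ^+ 2)^-1) <=
  3 * expR 1 / (n + 3)%:R :> R.
Proof.
have h1 : expR (- \sum_(0 <= a < n) ((a + 3)%:R)^-1) <= 3 / (n + 3)%:R :> R.
  elim: (n) => [|k IH]; first by rewrite big_geq// oppr0 expR0 divff.
  rewrite big_nat_recr//= opprD expRD addSn -natr1.
  have x0 : 0 < (k + 3)%:R :> R by rewrite ltr0n addn3.
  apply: (@le_trans _ _ (3 / (k + 3)%:R * ((k + 3)%:R / ((k + 3)%:R + 1)))); last first.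
    rewrite le_eqVlt; apply/orP; left; apply/eqP.
    by field; rewrite !gt_eqF//; lra.
  apply: ler_pM; rewrite ?expR_ge0//.
  rewrite expRN -[X in _ <= X]invf_div lef_pV2 ?posrE ?expR_gt0 ?divr_gt0 ?addr_gt0//.
  rewrite mulrDl mul1r divff ?gt_eqF//; exact: expR_ge1Dx.
have h2 : \sum_(0 <= a < n) ((a + n + 3)%:R)^-1 <= 1 :> R.
  apply: (@le_trans _ _ (\sum_(0 <= a < n) (n%:R)^-1)).
    rewrite big_seq [leRHS]big_seq; apply: ler_sum => a.
    rewrite mem_index_iota => an; rewrite lef_pV2 ?posrE ?ltr0n ?ler_nat; lia.
  rewrite big_const_nat iter_addr_0 subn0 -[leLHS]mulr_natl.
  by case: (n) => [|k]; rewrite ?mul0r ?divff.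
apply: (@le_trans _ _ (expR (- \sum_(0 <= a < n) ((a + 3)%:R)^-1) * expR 1)); last first.
  rewrite -mulrA [expR 1 * _]mulrC mulrA; apply: ler_wpM2r => //; exact: expR_ge0.
rewrite -expRD ler_expR.
suff : \sum_(0 <= a < n) ((a + 3)%:R)^-1 - \sum_(0 <= a < n) ((a + n + 3)%:R)^-1 <=
  \sum_(0 <= a < n) \sum_(0 <= b < n) ((a + b + 3)%:R ^+ 2)^-1 :> R by lra.
rewrite -sumrB; apply: ler_sum => a _.
rewrite -[(a + n + 3)%N]addnAC; apply: (le_trans (@sum_inv_sqr_ge (a + 3) n _)).
  by rewrite addn3.
by apply: ler_sum => b _; rewrite addnAC.
Qed.

(* [(6 e / (i + 5)) ^ s] *)
Definition tail (s : R) (i : nat) : R :=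
  expR (s * (ln (6 * expR 1) - ln (i + 5)%:R)).

(** The double sum is restricted to the square of side [minn u v]. If this is [n], the corresponding
    [k] among [i] and [j] satisfies [k + 5 <= 2 (n + 3)], which turns the 3 into the 6 of [tail]. A
    sum of two tails replaces the larger one, so that each can be summed separately. *)
Lemma expR_double_sum_tail s u v i j (x : R) : 0 <= s -> s <= x ->
  (i <= u + u + 1)%N -> (j <= v + v + 1)%N ->
  expR (- (x * \sum_(0 <= a < u) \sum_(0 <= b < v) ((a + b + 3)%:R ^+ 2)^-1)) <=
  tail s i + tail s j.
Proof.
move=> s0 sx iu jv; pose n := minn u v.
set G := \sum_(_ <= _ < _) _.
have G0 n1 n2 : 0 <= \sum_(0 <= a < n1) \sum_(0 <= b < n2) ((a + b + 3)%:R ^+ 2)^-1 :> R.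
  by apply: sumr_ge0 => a _; apply: sumr_ge0 => b _; rewrite invr_ge0 exprn_ge0.
have GG : \sum_(0 <= a < n) \sum_(0 <= b < n) ((a + b + 3)%:R ^+ 2)^-1 <= G.
  apply: (@le_trans _ _ (\sum_(0 <= a < n) \sum_(0 <= b < v) ((a + b + 3)%:R ^+ 2)^-1)).
    apply: ler_sum => a _; apply: ler_sum_nat; first exact: geq_minr.
    by move=> b; rewrite invr_ge0 exprn_ge0.
  apply: ler_sum_nat; first exact: geq_minl.
  by move=> a; apply: sumr_ge0 => b _; rewrite invr_ge0 exprn_ge0.
have hn : expR (- (x * G)) <= expR (s * (ln (3 * expR 1) - ln (n + 3)%:R)).
  rewrite ler_expR; apply: (@le_trans _ _ (- (s * G))).
    by rewrite lerN2 ler_wpM2r// /G.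
  rewrite -mulrN ler_wpM2l//.
  have := expR_double_sum n.
  rewrite -(@ler_ln R) ?posrE ?divr_gt0 ?mulr_gt0 ?expR_gt0 ?ltr0n ?addn3//.
  rewrite expRK ln_div ?posrE ?mulr_gt0 ?expR_gt0 ?ltr0n ?addn3//.
  by move=> h; apply: le_trans h; rewrite lerN2.
have tailn k : (k <= n + n + 1)%N ->
    expR (s * (ln (3 * expR 1) - ln (n + 3)%:R)) <= tail s k.
  move=> kn; rewrite /tail ler_expR ler_wpM2l//.
  have e0 := @expR_gt0 R 1.
  have -> : 6 * expR 1 = 2 * (3 * expR 1) :> R by ring.
  rewrite [ln (2 * _)]lnM ?posrE ?mulr_gt0//.
  have : ln (k + 5)%:R <= ln (2 * (n + 3)%:R) :> R.
    have k5 : 0 < (k + 5)%:R :> R by rewrite ltr0n; lia.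
    have n6 : 0 < 2 * (n + 3)%:R :> R by rewrite mulr_gt0// ltr0n addn3.
    by rewrite ler_ln// -natrM ler_nat; lia.
  rewrite lnM ?posrE ?ltr0n ?addn3//; lra.
have t0 k : 0 <= tail s k by exact: expR_ge0.
have [uv|vu] := leqP u v.
  have hi : (i <= n + n + 1)%N by rewrite /n (minn_idPl uv).
  by apply: (le_trans hn); apply: (le_trans (tailn _ hi)); rewrite lerDl.
have hj : (j <= n + n + 1)%N by rewrite /n (minn_idPr (ltnW vu)).
by apply: (le_trans hn); apply: (le_trans (tailn _ hj)); rewrite lerDr.
Qed.

Lemma sum_tail (s e : R) : 1 < s -> 0 < e -> exists2 r : nat, (1 < r)%N &
  forall n, \sum_(r <= i < n) tail s i <= e.
Proof.
move=> s1 e0; pose L : R := expR (s * ln (6 * expR 1)).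
have L0 : 0 < L by exact: expR_gt0.
have s0 : 0 < s - 1 by rewrite subr_gt0.
(* An antiderivative: up to the factor [L / (s - 1)], this is [x ^ (1 - s)] at [x = i + 4], so the
   sum telescopes like the integral of [x ^ (- s)]. *)
pose g (i : nat) : R := L / (s - 1) * expR (- ((s - 1) * ln (i + 4)%:R)).
have step i : tail s i <= g i - g i.+1.
  rewrite /g /tail addSnnS.
  have x1 : 1 < (i + 5)%:R :> R by rewrite ltr1n; lia.
  have -> : (i + 4)%:R = (i + 5)%:R - 1 :> R by rewrite !natrD; ring.
  move: ((i + 5)%:R) x1 => x x1; have x0 : 0 < x by lra.
  have -> : expR (s * (ln (6 * expR 1) - ln x)) = L * expR (- ((s - 1) * ln x)) / x.
    rewrite -[x in X in _ = X]lnK ?posrE// -expRN -!expRD; congr expR.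
    by rewrite lnK ?posrE//; ring.
  rewrite -mulrBr.
  have -> : L * expR (- ((s - 1) * ln x)) / x =
    L / (s - 1) * ((s - 1) * expR (- ((s - 1) * ln x)) / x).
    by field; rewrite !gt_eqF.
  apply: ler_wpM2l; first by rewrite divr_ge0 ?ltW.
  rewrite lerBrDl.
  have h : expR (- ((s - 1) * ln x)) * expR ((s - 1) / x) <= expR (- ((s - 1) * ln (x - 1))).
    rewrite -expRD ler_expR.
    have -> : ln (x - 1) = ln x + ln (1 - x^-1).
      by rewrite -lnM ?posrE ?subr_gt0 ?invf_lt1//; congr ln; field; rewrite gt_eqF.
    have := @le_ln1Dx R (- x^-1) _; rewrite ltrN2 invf_lt1// => /(_ x1) hln.
    rewrite mulrDr opprD lerD2l -mulrN ler_wpM2l ?(ltW s0)//; lra.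
  apply: le_trans h; rewrite [leLHS](_ : _ =
    expR (- ((s - 1) * ln x)) * (1 + (s - 1) / x)); last by field; rewrite gt_eqF.
  by rewrite ler_wpM2l ?expR_ge0// expR_ge1Dx.
have [r hr] := exists_natr_gt (expR (- (ln (e * (s - 1) / L) / (s - 1)))).
exists r.+2 => // n.
have sum_le : \sum_(r.+2 <= i < n) tail s i <= g r.+2.
  have [nr|rn] := leqP n r.+2.
    by rewrite big_geq// mulr_ge0 ?expR_ge0// divr_ge0 ?ltW.
  apply: (@le_trans _ _ (\sum_(r.+2 <= i < n) (g i - g i.+1))).
    by apply: ler_sum => i _; exact: step.
  rewrite (telescope_sumr_eq (fun i => - g i)) ?(ltnW rn)//; last first.
    by move=> i _; rewrite opprK addrC.
  rewrite opprK addrC lerBlDr lerDl mulr_ge0 ?expR_ge0// divr_ge0 ?ltW//.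
apply: (le_trans sum_le); rewrite /g.
have er0 : 0 < e * (s - 1) / L by rewrite divr_gt0 ?mulr_gt0.
have -> : L / (s - 1) * expR (- ((s - 1) * ln (r.+2 + 4)%:R)) =
  e * (expR (- ((s - 1) * ln (r.+2 + 4)%:R)) / (e * (s - 1) / L)).
  by field; rewrite !gt_eqF.
rewrite -[leRHS]mulr1 ler_wpM2l ?(ltW e0)// ler_pdivrMr// mul1r.
rewrite -[leRHS]lnK ?posrE// ler_expR lerNl -ler_pdivrMl//.
rewrite mulrC mulNr -(@ler_expR R) lnK ?posrE ?ltr0n//.
apply: (le_trans (ltW hr)); rewrite ler_nat; lia.
Qed.

End tails.

(** * Probability of a bad block at the next scale *)

Section renormalization_step.
Context {R : realType} (beta lambda : {posnum R}).
Local Notation P := (percolation_law beta lambda).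
Local Notation p := (edge_prob beta%:num lambda%:num).
Local Notation Pr := (pr P).
Local Notation lawP := (percolation_lawP beta lambda).
Local Notation p01 := (@edge_prob01 R beta lambda).
Implicit Types (w : edge -> bool) (h i j k n C r : nat) (t s : R).

Lemma local_good t a h : local (good t a h).
Proof. exact: local_inside (@dep_good R t a h). Qed.

Lemma local_bad t a h : local (fun w => ~~ good t a h w).
Proof. by apply: local1; exact: local_good. Qed.

Lemma pr_bad t a h : Pr (fun w => ~~ good t a h w) = Pr (fun w => ~~ good t 0 h w).
Proof.
rewrite -[RHS](pr_shift _ _ a (local_bad t 0 h)); congr pr.
by apply: funext => w; rewrite good_shift.
Qed.

Lemma pr_bad2 t h (a b : int) : a + h%:Z <= b ->
  Pr (fun w => ~~ good t a h w && ~~ good t b h w) =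
  Pr (fun w => ~~ good t 0 h w) ^+ 2.
Proof.
move=> ab; rewrite (pr_indep lawP (local_bad t a h) (local_bad t b h)
  (D := fun e => inside a h (val e).1 (val e).2)).
- by rewrite expr2 pr_bad [X in _ * X]pr_bad.
- by apply: depends1; exact: dep_good.
- apply: depends1; apply: depends_sub (@dep_good R t b h) => e; rewrite /inside /=; lia.
Qed.

Lemma count_le_sum (c f : nat -> bool) n : (forall m : nat, c m -> f m) ->
  (count c (iota 0 n))%:R <= \sum_(0 <= m < n) (f m)%:R :> R.
Proof.
move=> cf; rewrite -sum1_count natr_sum big_mkcond /index_iota subn0.
by apply: ler_sum => m _; case: ifP => // /cf ->.
Qed.

Lemma crossP h i i' e : e \in cross h i i' ->
  (val e).1 < (i * h)%:Z /\ ((i + 2) * h)%:Z <= (val e).2.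
Proof.
move=> /allpairsP[[k j] /= [_ _ ->]]; have hh : (i * h <= (i + 2) * h)%N.
  by rewrite leq_mul2r leq_addr orbT.
by rewrite val_edge_of /=; lia.
Qed.

Lemma cross_uniq h i i' : uniq (cross h i i').
Proof.
apply: allpairs_uniq; rewrite ?iota_uniq// => -[k j] [k' j'] _ _ /= /(congr1 val).
have hh : (i * h <= (i + 2) * h)%N by rewrite leq_mul2r leq_addr orbT.
rewrite !val_edge_of; [|lia..] => -[e1 e2]; congr pair; lia.
Qed.

Lemma rich_left_sum t h i x w a : (a < i./2)%N -> rich t 0 i.-1 h x w ->
  t * (2 * h)%:R <= \sum_(a * (2 * h) <= k < a.+1 * (2 * h))
    (rich t 0 i.-1 h ((i * h)%:Z - 1 - k%:Z) w)%:R.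
Proof.
(* Slabs are numbered leftwards from the gap: slab [a] is block [i - 2 (a + 1)] of the run. Each of
   its points in the rich cluster is itself rich. *)
move=> ai rx; have ji : (i - 2 * a.+1 < i.-1)%N by lia.
apply: (le_trans (richP _ _ _ _ _ _ rx _ ji)).
rewrite -[X in \sum_(X <= _ < _) _]add0n big_addn mulSn addnK big_nat_rev /= add0n.
have e : ((i - 2 * a.+1) * h + a * (2 * h) + 2 * h = i * h)%N.
  have -> : (a * (2 * h) = 2 * a * h)%N by ring.
  by rewrite -!mulnDl; congr (_ * _)%N; lia.
rewrite /cnt; apply: (@le_trans _ _ (\sum_(0 <= m < 2 * h)
    (rich t 0 i.-1 h (0 + ((i - 2 * a.+1) * h)%:Z + m%:Z) w)%:R)).
  apply: count_le_sum => m xm; apply: rich_conn rx.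
  by rewrite open_connC//; exact: insideC.
rewrite big_seq [leRHS]big_seq; apply: ler_sum => m; rewrite mem_index_iota => mh.
by rewrite (_ : _ + m%:Z = (i * h)%:Z - 1 - (2 * h - m.+1 + a * (2 * h))%:Z)//; lia.
Qed.

Lemma rich_right_sum t h (o : int) n x w b : (b + b < n)%N -> rich t o n h x w ->
  t * (2 * h)%:R <= \sum_(b * (2 * h) <= j < b.+1 * (2 * h))
    (rich t o n h (o + j%:Z) w)%:R.
Proof.
move=> bn rx; apply: (le_trans (richP _ _ _ _ _ _ rx _ bn)).
rewrite -[X in \sum_(X <= _ < _) _]add0n big_addn mulSn addnK.
have e : ((b + b) * h = b * (2 * h))%N by ring.
rewrite /cnt; apply: (@le_trans _ _ (\sum_(0 <= m < 2 * h)
    (rich t o n h (o + ((b + b) * h)%:Z + m%:Z) w)%:R)).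
  apply: count_le_sum => m xm; apply: rich_conn rx.
  by rewrite open_connC//; exact: insideC.
apply: ler_sum => m _; rewrite e (_ : _ + m%:Z = o + (m + b * (2 * h))%:Z)//; lia.
Qed.

(** An edge between rich points is closed with probability [exp (- beta / d ^ 2)], where
    [d = 2 h + 1 + k + j] is its exact length. The product is thus the exponential of a sum over
    pairs of rich points, to which [sum_dense] applies with [H = 2 h]. *)
Lemma prod_cross t h i i' w : 0 <= t -> (0 < h)%N -> (1 < i)%N -> (1 < i')%N ->
  (exists x, rich t 0 i.-1 h x w) ->
  (exists y, rich t ((i + 2) * h)%:Z i'.-1 h y w) ->
  \prod_(e <- cross h i i') (1 - p e * (rich_ends t h i i' e w)%:R) <=
  expR (- (beta%:num * t ^+ 2 *
    \sum_(0 <= a < i./2) \sum_(0 <= b < i'./2) ((a + b + 3)%:R ^+ 2)^-1)).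
Proof.
move=> t0 h0 i1 i'1 [x rx] [y ry].
pose pL k := rich t 0 i.-1 h ((i * h)%:Z - 1 - k%:Z) w.
pose pR j := rich t ((i + 2) * h)%:Z i'.-1 h (((i + 2) * h)%:Z + j%:Z) w.
have h2 : ((i + 2) * h = i * h + 2 * h)%N by rewrite mulnDl.
have -> : \prod_(e <- cross h i i') (1 - p e * (rich_ends t h i i' e w)%:R) =
    expR (- (beta%:num * \sum_(0 <= k < i./2 * (2 * h)) \sum_(0 <= j < i'./2 * (2 * h))
      (pL k && pR j)%:R / ((2 * h).+1 + k + j)%:R ^+ 2)).
  rewrite big_allpairs_dep mulr_sumr -sumrN expR_sum; apply: eq_bigr => k _.
  rewrite mulr_sumr -sumrN expR_sum; apply: eq_bigr => j _.
  have d1 : (1 < (2 * h).+1 + k + j)%N by lia.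
  rewrite (edge_prob_dist _ _ d1); last by rewrite h2; lia.
  rewrite /rich_ends val_edge_of /=; last by rewrite h2; lia.
  rewrite -/(pL k) -/(pR j); case: (_ && _); rewrite /= ?mulr1 ?mulr0 ?mul0r ?mulr0.
    by rewrite mul1r; ring.
  by rewrite oppr0 expR0 addr0.
rewrite ler_expR lerN2 -mulrA ler_wpM2l//; apply: sum_dense => //; first by lia.
  by move=> a ai; exact: rich_left_sum rx.
by move=> b bi; apply: rich_right_sum ry; lia.
Qed.

Lemma dep_exists_rich t o n h :
  dep (inside o (n.+1 * h)) (fun w => `[< exists x, rich t o n h x w >]).
Proof.
move=> w w' ww'; congr (`[< _ >]); apply: propext.
by split=> -[x rx]; exists x; move: rx; rewrite (@dep_rich _ _ _ _ _ _ w w' ww').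
Qed.

(** Badness of the middle block and richness on the two sides only involve edges inside these three
    intervals, none of which belongs to [cross]. Given them, [prod_cross] bounds the probability
    that no edge of [cross] joins rich points. *)
Lemma pr_separated t h i i' : 0 <= t -> (0 < h)%N -> (1 < i)%N -> (1 < i')%N ->
  Pr (fun w => ~~ good t (i * h)%:Z (2 * h) w && separated t h i i' w) <=
  expR (- (beta%:num * t ^+ 2 *
    \sum_(0 <= a < i./2) \sum_(0 <= b < i'./2) ((a + b + 3)%:R ^+ 2)^-1)) *
  Pr (fun w => ~~ good t 0 (2 * h) w).
Proof.
move=> t0 h0 i1 i'1; set c := expR _.
pose QL w := `[< exists x, rich t 0 i.-1 h x w >].
pose QR w := `[< exists y, rich t ((i + 2) * h)%:Z i'.-1 h y w >].
pose Q w := ~~ good t (i * h)%:Z (2 * h) w && (QL w && QR w).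
have lL : local QL by exact: local_inside (@dep_exists_rich _ _ _ _).
have lR : local QR by exact: local_inside (@dep_exists_rich _ _ _ _).
have lQ : local Q by apply: (local2 andb); [exact: local_bad|exact: local2].
have h2 : ((i + 2) * h = i * h + 2 * h)%N by rewrite mulnDl.
have iS : (i.-1.+1 = i)%N by lia.
have off (a : int) n e : a + n%:Z <= ((i + 2) * h)%:Z \/ (i * h)%:Z <= a ->
    inside a n (val e).1 (val e).2 -> e \notin cross h i i'.
  move=> ha /andP[/andP[e1 _] /andP[_ e2]]; apply/negP => /crossP[c1 c2].
  case: ha => ha; first by have := lt_le_trans e2 ha; rewrite ltNge c2.
  by have := le_lt_trans (le_trans ha e1) c1; rewrite ltxx.
have offL e : inside 0 (i.-1.+1 * h) (val e).1 (val e).2 -> e \notin cross h i i'.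
  by move=> he; apply: off he; left; rewrite iS h2; lia.
have offR e : inside ((i + 2) * h)%:Z (i'.-1.+1 * h) (val e).1 (val e).2 ->
    e \notin cross h i i'.
  by move=> he; apply: off he; right; rewrite h2; lia.
have offB e : inside (i * h)%:Z (2 * h) (val e).1 (val e).2 -> e \notin cross h i i'.
  by move=> he; apply: off he; left; rewrite h2; lia.
have dQ : depends (fun e => e \notin cross h i i') Q.
  apply: (depends2 andb).
    by apply: depends1; exact: depends_sub offB (@dep_good R t (i * h)%:Z (2 * h)).
  apply: (depends2 andb).
    exact: depends_sub offL (@dep_exists_rich _ _ _ _).
  exact: depends_sub offR (@dep_exists_rich _ _ _ _).
have lh e : local (rich_ends t h i i' e).
  by apply: (local2 andb); apply: local_inside; exact: dep_rich.
have dh e : depends (fun e => e \notin cross h i i') (rich_ends t h i i' e).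
  apply: (depends2 andb).
    exact: depends_sub offL (@dep_rich _ _ _ _ _ _).
  exact: depends_sub offR (@dep_rich _ _ _ _ _ _).
have := pr_closed_edges p01 lawP (cross_uniq h i i') lQ (fun e _ => lh e) dQ
  (fun e _ => dh e) (c := c).
have Qc w : Q w -> \prod_(e <- cross h i i') (1 - p e * (rich_ends t h i i' e w)%:R) <= c.
  by move=> /andP[_ /andP[/asboolP rL /asboolP rR]]; exact: prod_cross.
move=> /(_ Qc) main; apply: (@le_trans _ _ (c * Pr Q)).
  apply: le_trans main; rewrite le_eqVlt; apply/orP; left; apply/eqP; congr pr.
  by apply: funext => w; rewrite /Q /separated -!andbA.
apply: ler_wpM2l; first exact: expR_ge0.
rewrite -(pr_bad t (i * h)%:Z); apply: pr_le => //; first exact: local_bad.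
by move=> w /andP[].
Qed.

(** Union bound over [bad_cases]. The sum of the tails is paid twice, for the distances to the two
    ends; [4 C ^ 2] bounds the number of pairs of sub-blocks, and disjoint ones are independent. *)
Lemma renormalization_step t s eps h C r : 3 / 4 < t -> t <= 1 -> 0 <= s ->
  s <= beta%:num * t ^+ 2 -> (0 < h)%N -> (0 < C)%N -> (1 < r)%N ->
  (forall n, \sum_(r <= i < n) tail s i <= eps) ->
  Pr (fun w => ~~ good (t - (r + 2)%:R / C%:R) 0 (C * (2 * h)) w) <=
  (eps + eps) * Pr (fun w => ~~ good t 0 (2 * h) w) +
  4 * C%:R ^+ 2 * Pr (fun w => ~~ good t 0 (2 * h) w) ^+ 2.
Proof.
move=> t34 t1 s0 st h0 C0 r1 htail; set b := Pr (fun w => ~~ good t 0 (2 * h) w).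
have b0 : 0 <= b by exact: pr_ge0.
have t0 : 0 <= t by lra.
pose B i w := ~~ good t (i * h)%:Z (2 * h) w.
have lB i : local (B i) by exact: local_bad.
pose V := index_iota 0 (2 * C - 1).
pose pairs := [seq (i, j) | i <- V, j <- V].
pose B2 (z : nat * nat) w := (z.1 + 2 <= z.2)%N && (B z.1 w && B z.2 w).
pose S i w := B i w && separated t h i (2 * C - 2 - i) w.
pose mid := index_iota r (2 * C - 1 - r).
have lB2 z : local (B2 z) by apply: local1; exact: local2.
have lS i : local (S i).
  apply: (local2 andb) => //; apply: (local2 andb).
    exact: local_inside (@dep_exists_rich _ _ _ _).
  apply: (local2 andb); first exact: local_inside (@dep_exists_rich _ _ _ _).
  apply: local_all => e _; apply: local1; apply: (local2 andb); first exact: local_edge.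
  by apply: (local2 andb); apply: local_inside; exact: dep_rich.
have lh2 : local (fun w => has (B2^~ w) pairs) by exact: local_has.
have lhS : local (fun w => has (S^~ w) mid) by exact: local_has.
apply: (@le_trans _ _ (Pr (fun w => has (S^~ w) mid || has (B2^~ w) pairs))).
  apply: pr_le; [exact: local_bad|exact: (local2 orb)|].
  move=> w /(bad_cases h0 t34 t1 C0 r1)[[i [j [ij jC bi bj]]]|[i [ri irC bi sep]]].
    apply/orP; right; apply/hasP; exists (i, j); last by rewrite /B2 ij /B bi bj.
    by apply: allpairs_f; rewrite mem_index_iota; lia.
  apply/orP; left; apply/hasP; exists i; last by rewrite /S /B bi.
  by rewrite mem_index_iota; lia.
apply: (le_trans (prU p01 lawP lhS lh2)); apply: lerD.
  apply: (le_trans (pr_has p01 lawP (Q := S) _)) => //.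
  apply: (@le_trans _ _ (\sum_(r <= i < 2 * C - 1 - r)
      (tail s i + tail s (2 * C - 2 - i)%N) * b)).
    rewrite big_seq [leRHS]big_seq; apply: ler_sum => i; rewrite mem_index_iota => hi.
    have [i1 i'1] : (1 < i)%N /\ (1 < 2 * C - 2 - i)%N by clear -hi r1; lia.
    apply: (le_trans (pr_separated t0 h0 i1 i'1)); rewrite ler_wpM2r//.
    by apply: expR_double_sum_tail => //; lia.
  rewrite -mulr_suml ler_wpM2r// big_split /=.
  have half := htail (2 * C - 1 - r)%N.
  have -> : \sum_(r <= i < 2 * C - 1 - r) tail s (2 * C - 2 - i)%N =
      \sum_(r <= i < 2 * C - 1 - r) tail s i.
    rewrite big_nat_rev /= big_seq [RHS]big_seq; apply: eq_bigr => i.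
    by rewrite mem_index_iota => hi; congr tail; lia.
  lra.
apply: (le_trans (pr_has p01 lawP (Q := B2) _)) => //.
apply: (@le_trans _ _ (\sum_(z <- pairs) b ^+ 2)).
  apply: ler_sum => -[i j] _; rewrite /B2 /=.
  have [ij|_] := boolP (i + 2 <= j)%N; last first.
    by rewrite /pr (_ : [set w | _] = set0) ?measure0 ?sqr_ge0//; apply/seteqP; split.
  rewrite /= pr_bad2//; have : ((i + 2) * h <= j * h)%N by rewrite leq_mul2r ij orbT.
  by rewrite mulnDl; lia.
rewrite big_const_seq count_predT iter_addr_0 -[leLHS]mulr_natl.
rewrite ler_wpM2r ?sqr_ge0// size_allpairs !size_iota subn0.
by rewrite -natrX -natrM ler_nat; nia.
Qed.

End renormalization_step.

Section density.
Context {R : realType} {E : countType} (p : E -> R) (P : probability (config E) R).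
Hypothesis p01 : forall e, 0 <= p e <= 1.
Hypothesis lawP : is_bernoulli_product p P.

Lemma pr_sum_ge (I : eqType) (l : seq I) (Q : (E -> bool) -> bool)
    (S : I -> (E -> bool) -> bool) (c : R) :
  local Q -> (forall i, local (S i)) ->
  (forall w, Q w -> c <= \sum_(i <- l) (S i w)%:R) ->
  c * pr P Q <= \sum_(i <- l) pr P (S i).
Proof.
move=> lQ lS hc.
have lSl : local (fun w => [seq S i w | i <- l]).
  elim: (l) => [|i l' IH]; first by exists [::] => w w' _.
  exact: (local2 cons (lS i) IH).
have [s [us hQ hS]] := local_pair lQ lSl.
have hSi i : i \in l -> depends (mem s) (S i).
  by move=> il w w' ww'; have /eq_in_map := hS w w' ww'; exact.
pose w0 := fun _ : E => false.
rewrite (pr_expect lawP w0 us hQ) -expectZ.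
have -> : \sum_(i <- l) pr P (S i) =
    expect p s (fun w => \sum_(i <- l) (S i w)%:R) w0.
  rewrite (eq_big_seq (fun i => expect p s (fun w => (S i w)%:R) w0)); last first.
    by move=> i /hSi; exact: pr_expect.
  elim: (l) => [|i l' IH].
    rewrite big_nil -[LHS](expect_cst p s 0 w0).
    by apply: eq_expect => w; rewrite big_nil.
  by rewrite big_cons IH -expectD; apply: eq_expect => w; rewrite big_cons.
apply: ler_expect => // w; have [/hc|_] := boolP (Q w); first by rewrite mulr1.
by rewrite mulr0 sumr_ge0.
Qed.

End density.

(** * Iteration over the scales and positivity of theta *)

Section percolation_threshold.
Context {R : realType}.
Implicit Types (beta lambda : {posnum R}) (w : edge -> bool) (h m n K : nat) (t : R).

(** More than [2 m] points do not fit within distance less than [m] of [x]. *)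
Lemma cnt_escape t K m (x : nat) w : (2 * m)%:R < t * K%:R ->
  t * K%:R <= (cnt (inside 0 K) 0 K x%:Z w)%:R ->
  escape (shorter K) m x%:Z w.
Proof.
move=> mK hK; have : (2 * m < cnt (inside 0 K) 0 K x%:Z w)%N.
  by rewrite -(ltr_nat R) (lt_le_trans mK).
apply: contraTT => nesc; rewrite -leqNgt /cnt -size_filter.
rewrite -[X in (_ <= X)%N](size_iota (x - m)).
apply: uniq_leq_size; first by rewrite filter_uniq// iota_uniq.
move=> j; rewrite mem_filter mem_iota add0r => /andP[xj _].
have : `|j%:Z - x%:Z| < m%:Z.
  apply/negPn/negP => jm; move: nesc; apply/negP; rewrite negbK.
  apply: escape_conn jm; apply: open_conn_sub xj => k l.
  by rewrite /inside /shorter; lia.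
by rewrite mem_iota; lia.
Qed.

(** The expected number of points of the block with a dense cluster is at least [t K / 2], since a
    good block contains [t K] of them. Each such point escapes to distance [m], which has
    probability at most [Theta m]. *)
Lemma Theta_ge beta lambda t K m : (2 * m)%:R < t * K%:R -> (0 < K)%N ->
  2^-1 <= pr (percolation_law beta lambda) (good t 0 K) ->
  t / 2 <= Theta beta lambda m.
Proof.
move=> mK K0 hgood; pose S (x : nat) := fun w => t * K%:R <= (cnt (inside 0 K) 0 K x%:Z w)%:R.
have lS x : local (S x).
  apply: (local1 (fun n : nat => t * K%:R <= n%:R)).
  by apply: local_inside; exact: dep_cnt.
have := @pr_sum_ge _ _ _ _ (@edge_prob01 R beta lambda) (percolation_lawP beta lambda) _
  (index_iota 0 K) _ _ (t * K%:R) (local_good t 0 K) lS.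
have h w : good t 0 K w -> t * K%:R <= \sum_(0 <= x < K) (S x w)%:R.
  move=> /asboolP[x _ hx]; apply: (le_trans hx); apply: count_le_sum => j xj.
  apply: le_trans hx _; rewrite ler_nat; apply: cnt_conn => //.
  by rewrite open_connC; [move: xj; rewrite add0r|exact: insideC].
move=> /(_ h) sum_ge.
have sum_le : \sum_(0 <= x < K) pr (percolation_law beta lambda) (S x) <=
    K%:R * Theta beta lambda m.
  apply: (@le_trans _ _ (\sum_(0 <= x < K) Theta beta lambda m)).
    apply: ler_sum => x _; apply: (le_trans _ (pr_escape_shorter beta lambda K m x%:Z)).
    apply: pr_le => //; first exact: local_escape_shorter.
    by move=> w; exact: cnt_escape.
  by rewrite big_const_nat iter_addr_0 subn0 mulr_natl.
have K0' : 0 < K%:R :> R by rewrite ltr0n.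
rewrite -(ler_pM2l K0'); apply: le_trans sum_le; apply: le_trans sum_ge.
have -> : K%:R * (t / 2) = t * K%:R * 2^-1 by ring.
by rewrite ler_wpM2l// (le_trans _ (ltW mK)).
Qed.

(** The initial scale. The bounds of the renormalization step do not involve [lambda]; it is made
    large here. *)
Lemma pr_bad_pair beta lambda :
  pr (percolation_law beta lambda) (fun w => ~~ good (1 : R) 0 2 w) <=
  expR (- lambda%:num).
Proof.
have adj01 : pr (percolation_law beta lambda) (fun w => ~~ adjacent w 0 1) =
    expR (- lambda%:num).
  rewrite (prN (percolation_lawP _ _)); last exact: local_adjacent.
  by rewrite pr_adjacent// /edge_prob val_edge_of//=; ring.
rewrite -adj01; apply: pr_le; [exact: local_bad|by apply: local1; exact: local_adjacent|].
move=> w; apply: contraNN => a01; apply/asboolP; exists 0 => //.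
rewrite mul1r ler_nat /cnt.
have : all (fun j : nat => open_conn (inside 0 2) 0 (0 + j%:Z) w) (iota 0 2).
  apply/allP => -[|[|//]] _; first exact: conn0.
  by apply: conn1; rewrite a01.
by rewrite all_count => /eqP ->.
Qed.

Theorem theta_gt0_large_lambda beta : 1 < beta%:num -> exists lambda0 : R,
  forall lambda, lambda0 <= lambda%:num -> 0 < theta beta lambda.
Proof.
(* The invariant [400 C ^ 2 b <= 1] gives [4 C ^ 2 b <= 1 / 100]. With [eps + eps = 1 / 100], one
   step divides [b] by at least 50, while doubling [C] multiplies [C ^ 2] by 4 only. *)
have [K [K0 KE]] : exists K : R, 0 < K /\ K = 400.
  by exists 400; split; [rewrite ltr0n|reflexivity].
have [e [e0 ee]] : exists e : R, 0 < e /\ e + e = 100^-1.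
  by exists (200^-1); split; [rewrite invr_gt0|lra].
move=> b1; have b0 : 0 < beta%:num by [].
(* Any exponent strictly between 1 and [beta] would do: tails are summable for [s > 1], and
   [beta t ^ 2 >= s] leaves room for [t < 1]. *)
pose s := (beta%:num + 1) / 2; have s1 : 1 < s by rewrite /s; lra.
have s0 : 0 <= s by lra.
have [t' [t34 t'1 st']] : exists t' : R, [/\ 3 / 4 < t', t' < 1 & s <= beta%:num * t' ^+ 2].
  pose q := s / beta%:num.
  have q1 : q < 1 by rewrite /q ltr_pdivrMr// /s; lra.
  have q0 : 0 <= q by rewrite /q divr_ge0.
  exists (Num.max (Num.sqrt q) (7 / 8)); split.
  - by rewrite lt_max; apply/orP; right; lra.
  - by rewrite gt_max -{1}sqrtr1 ltr_sqrt// q1; lra.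
  rewrite -ler_pdivrMl// mulrC -/q -{1}(sqr_sqrtr q0).
  by rewrite lerXn2r ?nnegrE ?sqrtr_ge0 ?le_max ?lexx ?sqrtr_ge0.
have [r r1 hr] := sum_tail s1 e0.
have t'1' : 0 < 1 - t' by lra.
(* With the ratio [C = A 2 ^ n] at step [n], the density drops by at most [(1 - t') / 2 ^ (n + 1)],
   so it stays above [t'] forever. *)
have [A hA] := exists_natr_gt (2 * (r + 2)%:R / (1 - t')).
have A0 : 0 < A%:R :> R.
  by apply: le_lt_trans hA; rewrite divr_ge0 ?mulr_ge0 ?ltW.
have A0' : (0 < A)%N by rewrite -(ltr0n R).
have A2 : 2 < A%:R :> R.
  apply: le_lt_trans hA; rewrite ler_pdivlMr// natrD.
  have : 0 <= r%:R :> R by [].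
  lra.
have c0 : 0 < K * A%:R ^+ 2 by rewrite mulr_gt0 ?exprn_gt0.
exists (ln (K * A%:R ^+ 2)) => lambda.
rewrite -ler_expR (lnK c0) => hl.
have {hl}hexp : expR (- lambda%:num) <= (K * A%:R ^+ 2)^-1.
  rewrite expRN lef_pV2 ?posrE; [exact: hl|exact: expR_gt0|exact: c0].
pose b t K := pr (percolation_law beta lambda) (fun w => ~~ good t 0 K w).
(* The lower bound on [t] leaves a margin that halves at each step, and the last condition is the
   invariant for the next ratio [C = A 2 ^ n]. It starts with blocks of two points and density 1. *)
have iter n : exists h t, [/\ (n < h)%N, t' + (1 - t') / 2 ^+ n <= t, t <= 1 &
    K * (A%:R * 2 ^+ n) ^+ 2 * b t (2 * h)%N <= 1].
  elim: n => [|n [h [t [nh tn t1 hb]]]].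
    exists 1%N, 1; split => //; first by rewrite expr0; lra.
    rewrite expr0 mulr1 -ler_pdivlMl; last exact: c0.
    by rewrite mulr1; exact: le_trans (pr_bad_pair beta lambda) hexp.
  pose C := (A * 2 ^ n)%N; have C0 : (0 < C)%N by rewrite muln_gt0 A0' expn_gt0.
  have CE : C%:R = A%:R * 2 ^+ n :> R by rewrite natrM natrX.
  have p2 : 0 < 2 ^+ n :> R by rewrite exprn_gt0.
  have tt' : t' <= t by apply: le_trans tn; rewrite lerDl divr_ge0 ?ltW.
  exists (C * h)%N, (t - (r + 2)%:R / C%:R); split.
  - have : (2 * h <= C * h)%N.
      rewrite leq_mul2r; apply/orP; right; rewrite -(ler_nat R) (ltW (lt_le_trans A2 _))//.
      by rewrite CE ler_peMr ?(ltW A0)// exprn_ege1// ler1n.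
    by clear -nh; lia.
  - have hC : (r + 2)%:R / C%:R <= (1 - t') / 2 ^+ n.+1.
      rewrite ler_pdivrMr ?ltr0n// CE exprS.
      have -> : (1 - t') / (2 * 2 ^+ n) * (A%:R * 2 ^+ n) = A%:R * (1 - t') / 2.
        by field; rewrite gt_eqF.
      by rewrite ler_pdivlMr// -ler_pdivrMr// [_ * 2]mulrC ltW.
    have half : (1 - t') / 2 ^+ n = (1 - t') / 2 ^+ n.+1 + (1 - t') / 2 ^+ n.+1.
      by rewrite exprS; field; rewrite gt_eqF.
    move: tn hC; rewrite half; lra.
  - by apply: le_trans t1; rewrite lerBlDr lerDl divr_ge0.
  have st : s <= beta%:num * t ^+ 2.
    apply: (le_trans st'); rewrite ler_wpM2l// lerXn2r ?nnegrE//; lra.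
  have h0 : (0 < h)%N by exact: leq_ltn_trans nh.
  have t34' : 3 / 4 < t by exact: lt_le_trans tt'.
  have := @renormalization_step _ beta lambda _ _ _ _ _ _ t34' t1 s0 st h0 C0 r1 hr.
  rewrite ee mulnCA -/(b _ _) -/(b _ _) => step.
  clear hexp c0 K0; subst K.
  have b_ge0 : 0 <= b t (2 * h)%N by exact: pr_ge0.
  have CE' : A%:R * 2 ^+ n.+1 = 2 * C%:R :> R by rewrite CE exprS mulrCA.
  rewrite CE'; move: step hb; rewrite -CE.
  move: (b (t - (r + 2)%:R / C%:R) (2 * (C * h))%N) => y.
  move: (b t (2 * h)%N) b_ge0 (C%:R : R) => x x0 c.
  move=> step hb; have : 4 * c ^+ 2 * x ^+ 2 <= 100^-1 * x.
    have -> : 4 * c ^+ 2 * x ^+ 2 = (4 * c ^+ 2 * x) * x by ring.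
    apply: ler_wpM2r => //; clear -hb; lra.
  have -> : 400 * (2 * c) ^+ 2 * y = 1600 * c ^+ 2 * y by ring.
  move=> quad; have yx : y <= 50^-1 * x by lra.
  have cy := ler_wpM2l (sqr_ge0 c) yx; have cx := mulr_ge0 (sqr_ge0 c) x0.
  clear -hb cy cx; lra.
apply: (@lt_le_trans _ _ (t' / 2)); first by lra.
apply: theta_ge => m; have [h [t [mh tn t1 hb]]] := iter (2 * m)%N.
have p2 : 0 < 2 ^+ (2 * m) :> R by rewrite exprn_gt0.
have tt' : t' <= t by apply: le_trans tn; rewrite lerDl divr_ge0 ?ltW.
apply: (@le_trans _ _ (t / 2)); first by lra.
apply: (@Theta_ge _ _ _ (2 * h)).
- have : (2 * m)%:R < h%:R :> R by rewrite ltr_nat.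
  rewrite [(2 * h)%:R]natrM; have : 0 <= h%:R :> R by [].
  move: ((2 * m)%:R) (h%:R : R) => x y y0 xy; nra.
- by clear -mh; lia.
have := prN (percolation_lawP beta lambda) (local_good t 0 (2 * h)).
rewrite -/(b _ _) => bE; have : b t (2 * h)%N <= 2^-1; last by lra.
have b_ge0 : 0 <= b t (2 * h)%N by exact: pr_ge0.
apply: le_trans (_ : K * (A%:R * 2 ^+ (2 * m)) ^+ 2 * b t (2 * h)%N / 2 <= _); last by lra.
have A1 : 1 <= A%:R * 2 ^+ (2 * m) :> R.
  by rewrite -natrX -natrM ler1n muln_gt0 A0' expn_gt0.
have : 1 <= (A%:R * 2 ^+ (2 * m)) ^+ 2 :> R by rewrite exprn_ege1.
clear -b_ge0 KE; subst K; move: (_ ^+ 2) (b _ _) b_ge0 => x y y0 x1; nra.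
Qed.

End percolation_threshold.

Theorem theorem1 (R : realType) :
  (forall beta : {posnum R}, 1 < beta%:num ->
     exists lambda0 : R, forall lambda : {posnum R},
       lambda0 <= lambda%:num -> 0 < theta beta lambda) /\
  (forall beta lambda : {posnum R},
     0 < theta beta lambda -> 1 <= beta%:num * theta beta lambda ^+ 2).
Proof.
split; first by move=> beta; exact: theta_gt0_large_lambda.
by move=> beta lambda; exact: beta_theta_sqr_ge1.
Qed.
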